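(* There exists a separable metrizable zero-dimensional countable dense homogeneous topological space $X$ with the following two properties: (i) $X^2 = X \times X$ has exactly $\mathfrak{c} = 2^{\aleph_0}$ many types of countable dense subsets; (ii) if $\mathrm{MA} + \neg\mathrm{CH} + \omega_1 = (\omega_1)^{L}$ holds, then $X$ is $\boldsymbol{\Pi}^1_1$ (co-analytic).
   Context: The underlying theory is ZFC. All spaces are separable metrizable topological spaces. A space is zero-dimensional if it has a base consisting of clopen sets. For a space $Z$, $\mathcal{H}(Z)$ denotes the set of homeomorphisms of $Z$ onto itself. A space $Z$ is countable dense homogeneous (CDH) if for any two countable dense subsets $A, B$ of $Z$ there exists $h \in \mathcal{H}(Z)$ with $h(A) = B$. Two countable dense subsets $A, B$ of $Z$ are of the same type if there is $h \in \mathcal{H}(Z)$ with $h(A) = B$; this is an equivalence relation on the set of countable dense subsets of $Z$, and the number of types of countable dense subsets of $Z$ is the cardinality of its set of equivalence classes. A zero-dimensional separable metrizable space is called $\boldsymbol{\Pi}^1_1$ (co-analytic) if it is homeomorphic to a co-analytic subset of the Cantor space $2^\omega$, i.e. to the complement in $2^\omega$ of an analytic ($\boldsymbol{\Sigma}^1_1$) set. $\mathrm{MA}$ is Martin's Axiom, $\neg\mathrm{CH}$ is the negation of the Continuum Hypothesis, and $\omega_1 = (\omega_1)^{L}$ says that the first uncountable ordinal coincides with the first uncountable ordinal as computed in Gödel's constructible universe $L$. The space $X$ is a single space satisfying both (i) (with no hypothesis beyond ZFC) and the implication (ii). *)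

(* Defs.v *)
From HB Require Import structures.
From mathcomp Require Import all_boot all_order all_algebra.
From mathcomp Require Import all_classical all_reals all_analysis.

Set Implicit Arguments.
Unset Strict Implicit.
Unset Printing Implicit Defensive.

Local Open Scope classical_set_scope.
Local Open Scope card_scope.

Definition homeomorphism (X Y : topologicalType) (h : X -> Y) : Prop :=
  continuous h /\
  exists g : Y -> X, [/\ continuous g, cancel h g & cancel g h].

Definition homeomorphic (X Y : topologicalType) : Prop :=
  exists h : X -> Y, homeomorphism h.

Definition metrizable (R : realType) (X : topologicalType) : Prop :=
  exists M : metricType R, homeomorphic X M.

Definition countable_dense (X : topologicalType) (A : set X) : Prop :=
  countable A /\ dense A.

Definition separable_space (X : topologicalType) : Prop :=
  exists A : set X, countable_dense A.

(* The library's [zero_dimensional] only separates points by clopen sets,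
   which is weaker than having a clopen base. *)
Definition has_clopen_base (X : topologicalType) : Prop :=
  exists B : set (set X), basis B /\ forall U, B U -> clopen U.

Definition same_type (X : topologicalType) (A B : set X) : Prop :=
  exists h : X -> X, homeomorphism h /\ h @` A = B.

Definition CDH (X : topologicalType) : Prop :=
  forall A B : set X, countable_dense A -> countable_dense B -> same_type A B.

Definition dense_types (X : topologicalType) : set (set (set X)) :=
  [set C | exists2 A : set X, countable_dense A &
           C = [set B | countable_dense B /\ same_type A B]].

Arguments dense_types X : clear implicits.

Definition continuum : set (nat -> bool) := [set: nat -> bool].

Definition baire_space : topologicalType := prod_topology (fun _ : nat => nat).

Definition analytic (X : topologicalType) (A : set X) : Prop :=
  A = set0 \/ exists f : baire_space -> X, continuous f /\ range f = A.

Definition coanalytic (X : topologicalType) (A : set X) : Prop :=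
  analytic (~` A).

(* [set_type C] carries the subspace topology. *)
Definition coanalytic_space (X : topologicalType) : Prop :=
  exists C : set cantor_space,
    coanalytic C /\ homeomorphic X (set_type C).

Definition CH : Prop :=
  forall A : set (nat -> bool), countable A \/ A #= continuum.

Definition card_lt (T U : Type) (A : set T) (B : set U) : Prop :=
  A #<= B /\ ~ (A #= B).

Section Forcing.
Context (P : Type) (le : rel P).

(* Smaller conditions are stronger. *)
Definition compatible (p q : P) : Prop := exists r, le r p /\ le r q.

Definition antichain (A : set P) : Prop :=
  forall p q, A p -> A q -> p <> q -> ~ compatible p q.

Definition ccc : Prop := forall A : set P, antichain A -> countable A.

Definition forcing_dense (D : set P) : Prop :=
  forall p, exists q, D q /\ le q p.

Definition forcing_filter (G : set P) : Prop :=
  [/\ G !=set0,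
      forall p q, G p -> le p q -> G q &
      forall p q, G p -> G q -> exists r, [/\ G r, le r p & le r q]].

End Forcing.

Definition MA : Prop :=
  forall (P : Type) (le : rel P),
    inhabited P -> reflexive le -> transitive le -> ccc le ->
  forall F : set (set P),
    (forall D, F D -> forcing_dense le D) -> card_lt F continuum ->
  exists G : set P,
    forcing_filter le G /\ forall D, F D -> G `&` D !=set0.

(* The universe of sets is Aczel's type of well-founded trees, with
   extensional equality [veq]; in particular, two trees denote the same set
   when they are [veq], not only when they are Leibniz equal. *)
Inductive vset : Type := VSet (T : Type) (f : T -> vset).

Definition vidx (x : vset) : Type := match x with VSet T _ => T end.

Definition velt (x : vset) : vidx x -> vset :=
  match x return vidx x -> vset with VSet _ f => f end.

Fixpoint veq (x y : vset) : Prop :=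
  match x, y with
  | VSet T f, VSet U g =>
    (forall i, exists j, veq (f i) (g j)) /\
    (forall j, exists i, veq (f i) (g j))
  end.

Definition vmem (x y : vset) : Prop := exists j : vidx y, veq x (velt j).

Definition vempty : vset :=
  VSet (fun e : Empty_set => match e return vset with end).

Definition vupair (x y : vset) : vset :=
  VSet (fun b : bool => if b then x else y).

(* Kuratowski pairs. *)
Definition vpair (x y : vset) : vset := vupair (vupair x x) (vupair x y).

Definition vbigcup (T : Type) (F : T -> vset) : vset :=
  VSet (fun p : {i : T & vidx (F i)} => velt (projT2 p)).

Definition vsucc (x : vset) : vset :=
  vbigcup (fun b : bool => if b then x else vupair x x).

Definition vsep (x : vset) (Q : vset -> Prop) : vset :=
  VSet (fun i : {i : vidx x | Q (velt i)} => velt (sval i)).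

Definition vomega : vset := VSet (fun n : nat => iter n vsucc vempty).

(* First-order formulas of the language of set theory, with de Bruijn
   indices for variables. *)
Inductive formula : Type :=
  | FMem (i j : nat)
  | FEq (i j : nat)
  | FNot (phi : formula)
  | FAnd (phi psi : formula)
  | FEx (phi : formula).

(* Satisfaction in the structure (A, ∈). *)
Fixpoint sat (A : vset) (phi : formula) (e : nat -> vset) : Prop :=
  match phi with
  | FMem i j => vmem (e i) (e j)
  | FEq i j => veq (e i) (e j)
  | FNot phi => ~ sat A phi e
  | FAnd phi psi => sat A phi e /\ sat A psi e
  | FEx phi =>
    exists z, vmem z A /\ sat A phi (fun k => if k is k'.+1 then e k' else z)
  end.

(* The set of subsets of A definable over (A, ∈) with a finite sequence s of
   parameters from A: the variable 0 stands for the element x being tested and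
   k+1 for the k-th parameter; variables beyond the parameters are read as x,
   so that the empty structure also has its one definable subset. *)
Definition vdef (A : vset) : vset :=
  VSet (fun p : formula * seq (vidx A) =>
    vsep A (fun x => sat A p.1 (nth x (x :: map (@velt A) p.2)))).

(* L_a = \bigcup_(b \in a) Def(L_b), which for ordinals unfolds to L_0 = 0,
   L_(b+1) = Def(L_b), and unions at limits. *)
Fixpoint Lstage (a : vset) : vset :=
  match a with VSet T f => vbigcup (fun i : T => vdef (Lstage (f i))) end.

Definition vtransitive (x : vset) : Prop :=
  forall y z, vmem y x -> vmem z y -> vmem z x.

Definition vordinal (x : vset) : Prop :=
  vtransitive x /\ forall y, vmem y x -> vtransitive y.

Definition constructible : set vset :=
  [set x | exists a, vordinal a /\ vmem x (Lstage a)].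

Definition vinjection (f a b : vset) : Prop :=
  [/\ forall p, vmem p f ->
        exists x y, [/\ vmem x a, vmem y b & veq p (vpair x y)],
      forall x, vmem x a -> exists y, vmem (vpair x y) f,
      forall x y y', vmem (vpair x y) f -> vmem (vpair x y') f -> veq y y' &
      forall x x' y, vmem (vpair x y) f -> vmem (vpair x' y) f -> veq x x'].

(* Countability and "first uncountable ordinal" are relativized to a class M.
   For transitive M containing omega, such as the universe and L, all other notions
   involved are absolute, so only the quantifier over f depends on M. *)
Definition countable_in (M : set vset) (a : vset) : Prop :=
  exists f, M f /\ vinjection f a vomega.

Definition is_omega1 (M : set vset) (k : vset) : Prop :=
  [/\ M k, vordinal k, ~ countable_in M k &
      forall b, vmem b k -> countable_in M b].

Definition omega1_eq_omega1L : Prop :=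
  exists k : vset, is_omega1 [set: vset] k /\ is_omega1 constructible k.

(* Main.v *)
Require Import Defs.
From HB Require Import structures.
From mathcomp Require Import all_boot all_order all_algebra.
From mathcomp Require Import all_classical all_reals all_analysis.
From mathcomp Require Import wochoice.
Set Implicit Arguments.
Unset Strict Implicit.
Unset Printing Implicit Defensive.
Local Open Scope classical_set_scope.
Local Open Scope card_scope.

(* Let Y be an uncountable lambda-set in the Cantor space which is closed under changing
   finitely many coordinates, and let X be the topological sum of Y and the Cantor space.

   X is CDH: given countable dense A and B in Y, a back-and-forth construction gives an
   isometry h of the Cantor space with h(A) = B which, outside a countable set D that is
   a relative G_delta, changes only finitely many coordinates of each point.  Y \ D is a
   union of countably many closed sets, and on the n-th one h is left unchanged from
   stage n on.

   X^2 has continuum many types: compact subsets of Y are scattered, so a crowded compact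
   subset of Y x 2^w in which A is dense is, up to a nowhere dense set, contained in
   fibres {y} x 2^w with crowded trace of A.  Hence the points around which the union of
   these compact sets is not contained in a compact set can be prescribed by the choice
   of A; we make them a copy of a countable compact set with points of all finite
   Cantor-Bendixson ranks, and the set of ranks of the points of A among them is an
   arbitrary subset of w.

   In ZFC such a Y is obtained from a well-ordered unbounded family of functions that is
   increasing modulo finite sets.  Under MA + not CH + w_1 = w_1^L, every set of reals of
   size w_1 is a Q-set.  The reals in L_(w_1) form an uncountable set of size w_1 which is
   the projection of the coanalytic set of codes of well-founded levels of L; by MA the
   projection has a section which is the restriction of a Borel function, so its graph is
   coanalytic, and Y is its closure under finite changes. *)

(** * Subspaces of the Cantor space *)

(** The lambda property is used in two ways. For homogeneity, a countable relative G_delta [D] has a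
    complement covered by countably many relatively closed pieces, and each point of [D] has a
    neighbourhood missing any finitely many of them; moves made close enough to [D] thus respect the
    pieces already treated. For the square, it excludes perfect subsets of [Y]. The Cantor summand
    supplies the crowded compact fibres, whose position can then be controlled. Closure under finite
    changes lets the isometries map [Y] to itself. For complexity, the obstacle is that a projection
    of a coanalytic set need not be coanalytic, while a real of L has too many codes for the set of
    all codes to be small. One code per real has to be selected by a Borel rule. An arbitrary
    selection is enough: its domain has size w_1, so each bit of the selected code is decided on it
    by a G_delta set. *)

Definition agree (T : Type) (n : nat) (x y : nat -> T) : Prop :=
  forall i, (i < n)%N -> x i = y i.

Section Agree.
Context {T : Type}.
Implicit Types x y z : nat -> T.

Lemma agreexx n x : agree n x x. Proof. by []. Qed.

Lemma agree_sym n x y : agree n x y -> agree n y x.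
Proof. by move=> xy i /xy. Qed.

Lemma agree_trans n y x z : agree n x y -> agree n y z -> agree n x z.
Proof. by move=> xy yz i lin; rewrite xy ?yz. Qed.

Lemma agree_le m n x y : (m <= n)%N -> agree n x y -> agree m x y.
Proof. by move=> mn xy i im; apply: xy; apply: leq_trans mn. Qed.

Lemma agree_mkseq n x y : agree n x y <-> mkseq x n = mkseq y n.
Proof.
split=> [xy|xy i lin].
  by apply/eq_in_map => i; rewrite mem_iota add0n /=; apply: xy.
by rewrite -(nth_mkseq (x 0) x lin) xy nth_mkseq.
Qed.

Lemma agree_all x y : (forall n, agree n x y) -> x = y.
Proof. by move=> xy; apply/funext => i; apply: (xy i.+1). Qed.

Lemma agreeS n x y : agree n x y -> x n = y n -> agree n.+1 x y.
Proof.
by move=> xy e i; rewrite ltnS leq_eqVlt => /predU1P[->//|]; apply: xy.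
Qed.

End Agree.

Lemma agree_neq (T : eqType) (x y : nat -> T) : x <> y ->
  exists n, agree n x y /\ x n <> y n.
Proof.
move=> nxy; have ex : exists n, x n != y n.
  apply: contrapT => /forallNP xy; apply: nxy; apply/funext => n.
  by have := xy n; move=> /negP /negPn /eqP.
case: (ex_minnP ex) => n /eqP xyn mn; exists n; split=> // i lin.
by apply: contrapT => /eqP /mn; rewrite leqNgt lin.
Qed.

Section ProductNbhs.
Variable T : discreteTopologicalType.
Local Notation P := (prod_topology (fun _ : nat => T)).

(** Any discrete factor is allowed because both the Cantor space and the Baire space are
    instances. *)
Lemma prod_nbhsP (x : P) (U : set P) :
  nbhs x U <-> exists n, forall y : P, agree n x y -> U y.
Proof.
split; last first.
  case=> n HU; have : nbhs x (fun y : P => agree n x y).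
    elim: n {HU} => [|n IH]; first by apply: filterS filterT.
    have : nbhs x (fun y : P => y n = x n).
      have := @proj_continuous nat (fun=> T) n x [set x n].
      by apply; rewrite nbhs_principalE; apply/principal_filterP.
    apply: filterS2 IH => y xy e; exact: agreeS.
  by apply: filterS.
(* Read as convergence of the filter of agreement sets, the claim reduces through [cvg_sup] to a
   single coordinate. *)
move: U; have -> : (forall U : set P, nbhs x U -> exists n, forall y : P, agree n x y -> U y)
   <-> filter_from [set: nat] (fun n => [set y : P | agree n x y]) --> x.
  split=> H U /H.
    by case=> n HU; exists n.
  by case=> n _ HU; exists n.
have FF : Filter (filter_from [set: nat] (fun n => [set y : P | agree n x y])).
  apply: filter_from_filter; first by exists 0.
  move=> i j _ _; exists (maxn i j) => // y xy.
  by split; apply: agree_le xy; rewrite (leq_maxl, leq_maxr).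
apply/cvg_sup => i U; rewrite nbhsE => -[V [[W oW <-] Wx] VU].
exists i.+1 => // y xy; apply: VU; rewrite /= -(xy i) //.
Qed.

End ProductNbhs.

Section CantorSubspace.
Variable C : set cantor_space.
Implicit Types x y : set_type C.

Definition pt x : nat -> bool := set_val x.

Lemma pt_inj : injective pt.
Proof. by move=> x y; exact: val_inj. Qed.

Lemma ptP x : C (pt x). Proof. exact: set_valP. Qed.

Definition mkpt (c : nat -> bool) (Cc : C c) : set_type C := SigSub (mem_set Cc).

Lemma pt_mkpt c (Cc : C c) : pt (mkpt Cc) = c. Proof. by []. Qed.

Lemma sub_nbhsP x (U : set (set_type C)) :
  nbhs x U <-> exists n, forall y, agree n (pt x) (pt y) -> U y.
Proof.
split.
  rewrite nbhsE => -[V [[W oW <-] Wx] VU].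
  have /prod_nbhsP[n HW] : nbhs (set_val x : cantor_space) W by exact: open_nbhs_nbhs.
  by exists n => y xy; apply: VU; apply: HW.
case=> n HU; have cv := @initial_continuous (set_type C) cantor_space set_val x.
have /cv : nbhs (set_val x : cantor_space) (fun y : cantor_space => agree n (pt x) y).
  by apply/prod_nbhsP; exists n.
by rewrite nbhs_simpl /=; apply: filterS => y; exact: HU.
Qed.

Definition cyl n x : set (set_type C) := [set y | agree n (pt x) (pt y)].

Lemma open_subP (U : set (set_type C)) :
  open U <-> forall x, U x -> exists n, cyl n x `<=` U.
Proof.
rewrite openE; split=> H x /H.
  by move/sub_nbhsP => [n Hn]; exists n => y; exact: Hn.
by move=> [n Hn]; apply/sub_nbhsP; exists n => y; exact: Hn.
Qed.

Lemma cyl_clopen n x : clopen (cyl n x).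
Proof.
split.
  apply/open_subP => y xy; exists n => z yz; exact: agree_trans yz.
rewrite -[cyl n x]setCK; apply: open_closedC; apply/open_subP => y xy.
by exists n => z yz xz; apply: xy; apply: agree_trans xz (agree_sym yz).
Qed.

Lemma sub_clopen_base : has_clopen_base (set_type C).
Proof.
exists [set U | exists n x, U = cyl n x]; split; last first.
  by move=> _ [n [x ->]]; exact: cyl_clopen.
split; first by move=> _ [n [x ->]]; case: (cyl_clopen n x).
move=> x U /sub_nbhsP [n HU]; exists (cyl n x); last by move=> y; exact: HU.
by split; [exists n, x | exact: agreexx].
Qed.

Lemma sub_denseP (A : set (set_type C)) :
  dense A <-> forall x n, exists a, A a /\ agree n (pt x) (pt a).
Proof.
split=> [dA x n|H O [x Ox] /open_subP/(_ x Ox)[n nO]].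
  have [|a [xa Aa]] := dA (cyl n x) _ (cyl_clopen n x).1.
    by exists x; exact: agreexx.
  by exists a.
by have [a [Aa xa]] := H x n; exists a; split=> //; exact: nO.
Qed.

Lemma sub_separable : separable_space (set_type C).
Proof.
pose w (s : seq bool) : option (set_type C) :=
  if pselect (exists x, mkseq (pt x) (size s) = s) is left e then Some (projT1 (cid e))
  else None.
have [x0|C0] := pselect (inhabited (set_type C)); last first.
  exists set0; split=> // O [x]; by case: C0.
exists [set x | exists s, w s = Some x]; split.
  apply: (@sub_countable _ _ _ (Some @^-1` (w @` [set: seq bool]))).
    by apply: subset_card_le => x [s ws]; exists s.
  apply/(@countable_injP _ _).
  have /countable_injP[f fi] : countable (w @` [set: seq bool]).
    exact: sub_countable (card_image_le _ _) (countableP _).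
  exists (f \o Some) => x y /set_mem X /set_mem Y e.
  by have [] : Some x = Some y by apply: fi e; apply: mem_set.
apply/sub_denseP => x n.
have ex : exists z, mkseq (pt z) (size (mkseq (pt x) n)) = mkseq (pt x) n.
  by exists x; rewrite size_mkseq.
exists (projT1 (cid ex)); split.
  exists (mkseq (pt x) n); rewrite /w; case: pselect => // e.
  by congr (Some (projT1 (cid _))); apply: Prop_irrelevance.
by apply/agree_mkseq; case: (cid ex) => /= z; rewrite size_mkseq.
Qed.

Lemma sub2_nbhsP (p : set_type C * set_type C) (U : set (set_type C * set_type C)) :
  nbhs p U <-> exists n, forall q, agree n (pt p.1) (pt q.1) -> agree n (pt p.2) (pt q.2) -> U q.
Proof.
split.
  case=> -[V W] [/= /sub_nbhsP[m HV] /sub_nbhsP[n HW]] VWU.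
  exists (maxn m n) => q q1 q2; apply: (VWU q); split.
    by apply: HV; apply: agree_le q1; rewrite leq_maxl.
  by apply: HW; apply: agree_le q2; rewrite leq_maxr.
case=> n HU; exists (cyl n p.1, cyl n p.2); last first.
  by move=> [q1 q2] /= [h1 h2]; exact: HU.
by split; apply/sub_nbhsP; exists n.
Qed.

End CantorSubspace.

Section Metric.
Import Order.TTheory GRing.Theory Num.Theory.
Local Open Scope ring_scope.
Variables (R : realType) (C : set cantor_space).

Definition first_diff (x y : set_type C) : nat :=
  if pselect (exists n, pt x n != pt y n) is left e then ex_minn e else 0%N.

Lemma first_diffP x y : x <> y -> agree (first_diff x y) (pt x) (pt y) /\
  pt x (first_diff x y) <> pt y (first_diff x y).
Proof.
move=> nxy; rewrite /first_diff; case: pselect => [e|nex].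
  case: ex_minnP => n /eqP xyn mn; split=> // i lin.
  by apply: contrapT => /eqP /mn; rewrite leqNgt lin.
have [|n [_ /eqP ne]] := @agree_neq _ (pt x) (pt y); first by move/pt_inj.
by case: nex; exists n.
Qed.

Lemma agree_first_diff n x y : x <> y -> agree n (pt x) (pt y) -> (n <= first_diff x y)%N.
Proof.
move=> /first_diffP[_ ne] xy; rewrite leqNgt; apply/negP => lt.
by apply: ne; apply: xy.
Qed.

Definition cdist (x y : set_type C) : R :=
  if x == y then 0 else 2^-1 ^+ first_diff x y.

Lemma cdist_small n x y : cdist x y < 2^-1 ^+ n -> agree n (pt x) (pt y).
Proof.
rewrite /cdist; case: eqP => [->//|ne].
rewrite ltNge => H; apply: agree_le (first_diffP ne).1.
rewrite leqNgt; apply: contra H => lt.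
by rewrite ler_wiXn2l ?invr_ge0 ?invf_le1 // ?ler1n // ltnW.
Qed.

Lemma cdist_agree n x y : agree n (pt x) (pt y) -> cdist x y <= 2^-1 ^+ n.
Proof.
rewrite /cdist; case: eqP => [->|ne] xy; first by rewrite exprn_ge0 // invr_ge0.
by rewrite ler_wiXn2l ?invr_ge0 ?invf_le1 // ?ler1n //; exact: agree_first_diff.
Qed.

Lemma cdistxx x : cdist x x = 0.
Proof. by rewrite /cdist eqxx. Qed.

Lemma cdist_eq0 x y : cdist x y = 0 -> x = y.
Proof.
rewrite /cdist; case: eqP => // _ /eqP.
by rewrite expf_eq0 invr_eq0 pnatr_eq0 andbF.
Qed.

Lemma cdist_sym x y : cdist x y = cdist y x.
Proof.
have [->//|nxy] := pselect (x = y).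
rewrite /cdist [y == x]eq_sym; case: eqP => // _; congr (_ ^+ _); apply/eqP; rewrite eqn_leq.
have nyx : y <> x by move/esym.
have [a _] := first_diffP nxy; have [b _] := first_diffP nyx.
by rewrite !agree_first_diff //; exact: agree_sym.
Qed.

Lemma cdist_ge0 x y : 0 <= cdist x y.
Proof. by rewrite /cdist; case: eqP => // _; rewrite exprn_ge0 // invr_ge0. Qed.

Lemma cdist_triangle y x z : cdist x z <= cdist x y + cdist y z.
Proof.
have [->|/eqP nxy] := eqVneq x y; first by rewrite cdistxx add0r.
have [->|/eqP nyz] := eqVneq y z; first by rewrite cdistxx addr0.
have [a _] := first_diffP nxy; have [b _] := first_diffP nyz.
have [le|le] := leqP (first_diff x y) (first_diff y z).
  apply: le_trans (_ : cdist x y <= _); last by rewrite lerDl cdist_ge0.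
  rewrite {2}/cdist; case: eqP => // _; apply: cdist_agree; apply: agree_trans a _.
  exact: agree_le b.
apply: le_trans (_ : cdist y z <= _); last by rewrite lerDr cdist_ge0.
rewrite {2}/cdist; case: eqP => // _; apply: cdist_agree; apply: agree_trans _ b.
by apply: agree_le a; exact: ltnW.
Qed.

(** A second name for [set_type C], which already carries the subspace topology; the identity will
    be the homeomorphism between the two. *)
Definition cantor_metric : Type := set_type C.
HB.instance Definition _ := Choice.on cantor_metric.
HB.instance Definition _ :=
  @isMetric.Build R cantor_metric cdist cdistxx cdist_eq0 cdist_sym cdist_triangle.

Lemma small_exp (e : R) : 0 < e -> exists n, 2^-1 ^+ n < e.
Proof.
move=> e0; have [n] : exists n : nat, e^-1 < n%:R.
  by exists (Num.truncn e^-1).+1; rewrite truncnS_gt.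
move=> en; exists n.
rewrite exprVn invf_plt ?posrE ?exprn_gt0 //.
apply: lt_le_trans en _; rewrite -natrX ler_nat ltnW //; exact: ltn_expl.
Qed.

Lemma metric_nbhsP (x : cantor_metric) (U : set cantor_metric) :
  nbhs x U <-> exists n, forall y : cantor_metric, agree n (pt x) (pt y) -> U y.
Proof.
rewrite -nbhs_ballE; split.
  case=> e /= /small_exp[n ne] eU; exists n => y xy; apply: eU.
  by rewrite ballEmdist /=; apply: le_lt_trans (cdist_agree xy) ne.
case=> n HU; exists (2^-1 ^+ n); first by rewrite /= exprn_gt0 // invr_gt0.
by move=> y; rewrite ballEmdist => /cdist_small; exact: HU.
Qed.

Lemma sub_metrizable : metrizable R (set_type C).
Proof.
exists cantor_metric, id; split.
  by move=> x U /= /metric_nbhsP[n HU]; apply/sub_nbhsP; exists n.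
exists id; split=> // x U /= /sub_nbhsP[n HU]; apply/metric_nbhsP; by exists n.
Qed.

End Metric.

(** * Countable dense homogeneity by isometries *)

Local Notation real := (nat -> bool).

(** The relation E_0 of descriptive set theory. *)
Definition eqfin (x y : real) : Prop := exists n, forall i, (n <= i)%N -> x i = y i.

Lemma eqfinxx x : eqfin x x. Proof. by exists 0. Qed.

Lemma eqfin_sym x y : eqfin x y -> eqfin y x.
Proof. by case=> n xy; exists n => i /xy. Qed.

Lemma eqfin_trans y x z : eqfin x y -> eqfin y z -> eqfin x z.
Proof.
case=> m xy [n yz]; exists (maxn m n) => i; rewrite geq_max => /andP[mi ni].
by rewrite xy // yz.
Qed.

Definition ccat (n : nat) (x y : real) : real := fun i => if (i < n)%N then x i else y i.

Lemma ccat_agree n x y : agree n x (ccat n x y).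
Proof. by move=> i lin; rewrite /ccat lin. Qed.

Lemma ccat_eqfin n x y : eqfin y (ccat n x y).
Proof. by exists n => i ni; rewrite /ccat ltnNge ni. Qed.

Definition iso (h : real -> real) : Prop := forall n x y, agree n x y -> agree n (h x) (h y).

(** Bit [i] of [x] is flipped where [c] and [b] differ, but only as long as [x] has followed [c]. So
    [c] goes to [b], while any other [x] leaves [c] at a finite stage and is changed in finitely
    many coordinates. *)
Definition shift (c b x : real) : real :=
  fun i => x i (+) ((mkseq c i == mkseq x i) && (c i (+) b i)).

Lemma shiftE c b : shift c b c = b.
Proof. by apply/funext => i; rewrite /shift eqxx /= addKb. Qed.

Lemma shift_iso c b : iso (shift c b).
Proof.
move=> n x y xy i lin; rewrite /shift (xy i lin).
by have /agree_mkseq -> // := agree_le (ltnW lin) xy.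
Qed.

Lemma shift_off n c b x : agree n c b -> ~ agree n c x -> shift c b x = x.
Proof.
move=> cb cx; apply/funext => i; rewrite /shift.
have [/cb -> |ni] := ltnP i n; first by rewrite addbb andbF addbF.
have -> : (mkseq c i == mkseq x i) = false; last by rewrite addbF.
by apply/negP => /eqP/agree_mkseq/(agree_le ni).
Qed.

Lemma shift_agree n c b x : agree n c b -> agree n x (shift c b x).
Proof. by move=> cb i /cb e; rewrite /shift e addbb andbF addbF. Qed.

(** This is why [shift b c] undoes [shift c b]: at each coordinate both test the same condition. *)
Lemma shift_agE c b x n : agree n b (shift c b x) <-> agree n c x.
Proof.
elim: n => [|n IH]; first by split.
split=> H.
  have /IH cx := agree_le (leqnSn n) H; have /agree_mkseq e := cx.
  apply: agreeS => //; have := H n (ltnSn n).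
  by rewrite /shift e eqxx /=; case: (b n) (c n) (x n) => [] [] [].
have cx := agree_le (leqnSn n) H; have /agree_mkseq e := cx; have /IH bx := cx.
apply: agreeS => //; rewrite /shift e eqxx /= (H n (ltnSn n)).
by rewrite addbA addbb addFb.
Qed.

Lemma shiftK c b : cancel (shift c b) (shift b c).
Proof.
move=> x; apply/funext => i; rewrite {1}/shift.
have -> : (mkseq b i == mkseq (shift c b x) i) = (mkseq c i == mkseq x i).
  by apply/eqP/eqP => /agree_mkseq H; apply/agree_mkseq; move: H => /shift_agE.
by rewrite /shift [b i (+) _]addbC -addbA addbb addbF.
Qed.

Lemma shift_eqfin c b x : x <> c -> eqfin x (shift c b x).
Proof.
move=> xc; have [n [_ ne]] := @agree_neq _ c x (fun e => xc (esym e)).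
exists n.+1 => i ni; rewrite /shift.
have -> : (mkseq c i == mkseq x i) = false; last by rewrite addbF.
by apply/negP => /eqP/agree_mkseq/(_ n ni).
Qed.

(** * Back-and-forth on a countable set with control outside it *)

Section BackForth.
Variable D : set real.
Hypothesis D_eqfin : forall x y, eqfin x y -> D x -> D y.
(** In the application these are relatively closed pieces of the complement of [D]. A cylinder
    around a point of [D] that misses a piece can be rearranged without touching that piece. *)
Variable F : nat -> set real.
Hypothesis DF : forall d j, D d -> exists n, forall x, F j x -> ~ agree n d x.

Definition full_dense (A : set real) := forall x n, exists a, A a /\ agree n x a.

Record state := State { sh : real -> real ; sk : real -> real ; sp : seq (real * real) }.

(** The pairs match [D] with [D], respecting [A] and [B]: points of [D] lie in no [F j], so each of
    them needs an explicit partner. A matched point may have been changed in infinitely many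
    coordinates, hence the exception in the last clause. *)
Definition inv (A B : set real) (s : state) : Prop :=
  [/\ cancel (sh s) (sk s) /\ cancel (sk s) (sh s),
      iso (sh s) /\ iso (sk s),
      forall a b, (a, b) \in sp s -> [/\ sh s a = b, D a, D b & (A a <-> B b)] &
      forall x, (forall b, (x, b) \notin sp s) -> eqfin x (sh s x)].

Definition ext n (s s' : state) : Prop :=
  [/\ forall x, agree n (sh s x) (sh s' x) /\ agree n (sk s x) (sk s' x),
      {subset sp s <= sp s'} &
      forall j x, (j < n)%N -> F j x -> sh s' x = sh s x /\ sk s' x = sk s x].

Definition swp (p : real * real) := (p.2, p.1).
Definition flip (s : state) := State (sk s) (sh s) (map swp (sp s)).

Lemma mem_flip a b s : ((a, b) \in sp (flip s)) = ((b, a) \in sp s).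
Proof.
apply/mapP/idP => [[[u v] uv [-> ->]]//|ba].
by exists (b, a).
Qed.

Lemma flipK s : flip (flip s) = s.
Proof. by case: s => h k p; rewrite /flip /= -map_comp map_id_in //; case. Qed.

Lemma inv_flip A B s : inv A B s -> inv B A (flip s).
Proof.
case=> [[hk kh] [ih ik] P Q]; split=> //.
  move=> a b; rewrite mem_flip => /P[e Da Db AB]; split=> //=; last by rewrite AB.
  by rewrite -e hk.
move=> x nx /=; rewrite -{1}(kh x); apply: eqfin_sym; apply: Q => b.
apply/negP => /[dup] /P[e _ _ _]; rewrite -e kh => m.
by have := nx (sk s x); rewrite mem_flip m.
Qed.

Lemma ext_flip n s s' : ext n s s' -> ext n (flip s) (flip s').
Proof.
case=> a b c; split=> [x||j x /c/[apply][[]]//].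
  by have [] := a x.
by case=> u v; rewrite !mem_flip; exact: b.
Qed.

Lemma ext_trans n s1 s2 s3 : ext n s1 s2 -> ext n s2 s3 -> ext n s1 s3.
Proof.
case=> a b c [a' b' c']; split.
- move=> x; have [u v] := a x; have [u' v'] := a' x.
  by split; [exact: agree_trans u' | exact: agree_trans v'].
- by move=> p /b/b'.
- move=> j x jn Fx; have [-> ->] := c' j x jn Fx; exact: (c j).
Qed.

Lemma ext_le m n s s' : (m <= n)%N -> ext n s s' -> ext m s s'.
Proof.
move=> mn [a b c]; split=> //.
  by move=> x; have [u v] := a x; split; [exact: agree_le u|exact: agree_le v].
by move=> j x jm; apply: c; exact: leq_trans mn.
Qed.

Lemma ext_refl n s : ext n s s. Proof. by split. Qed.

Lemma avoidF d n : D d -> exists N, (n <= N)%N /\ forall j x, (j < n)%N -> F j x -> ~ agree N d x.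
Proof.
move=> Dd; suff [N HN] : exists N, forall j x, (j < n)%N -> F j x -> ~ agree N d x.
  exists (maxn n N); rewrite leq_maxl; split=> // j x jn Fx.
  by move/(agree_le (leq_maxr _ _)); exact: (HN j).
elim: n => [|n [N IH]]; first by exists 0.
have [M HM] := DF n Dd; exists (maxn M N) => j x; rewrite ltnS leq_eqVlt.
case/predU1P => [->|jn] Fx.
  by move/(agree_le (leq_maxl _ _)); exact: HM.
by move/(agree_le (leq_maxr _ _)); exact: (IH j).
Qed.

Lemma avoid_seq (d : real) (s : seq real) : d \notin s ->
  exists N, forall x, x \in s -> ~ agree N d x.
Proof.
elim: s => [|y s IH]; first by exists 0.
rewrite inE negb_or => /andP[/eqP dy /IH[N HN]].
have [n [_ ne]] := agree_neq dy; exists (maxn n.+1 N) => x; rewrite inE.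
case/predU1P => [->|/HN H].
  by move/(agree_le (leq_maxl _ _))/(_ n (ltnSn n)).
by move/(agree_le (leq_maxr _ _)).
Qed.

Lemma forth A B s n a : full_dense (D `&` B) -> full_dense (D `\` B) ->
  inv A B s -> D a ->
  exists s', [/\ inv A B s', ext n s s' & exists b, (a, b) \in sp s'].
Proof.
move=> dB dDB iS Da.
have [[b ab]|na] := pselect (exists b, (a, b) \in sp s).
  by exists s; split=> //; [exact: ext_refl | exists b].
case: (iS) => [[hk kh] [ih ik] P Q].
set c := sh s a.
(* Being unmatched, [a] has so far been changed in finitely many coordinates only. *)
have Dc : D c.
  by apply: D_eqfin Da; apply: Q => b; apply/negP => ab; apply: na; exists b.
(* The cylinders of length [N1] around [a] and [N2] around [c] contain no point of [F j] for
   [j < n]: the first protects the map on these sets, the second its inverse. Length [N3] protects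
   the earlier partners. *)
have [N1 [nN1 H1]] := avoidF n Da; have [N2 [nN2 H2]] := avoidF n Dc.
have [N3 H3] : exists N, forall x, x \in map snd (sp s) -> ~ agree N c x.
  apply: avoid_seq; apply/negP => /mapP[[u v] uv /= cv].
  have [e _ _ _] := P _ _ uv; apply: na; exists v.
  by rewrite -(_ : u = a) //; rewrite -(hk u) e -cv /c hk.
pose N := maxn N1 (maxn N2 N3).
have N1N : (N1 <= N)%N by rewrite leq_maxl.
have N2N : (N2 <= N)%N by rewrite /N maxnCA leq_maxl.
have N3N : (N3 <= N)%N by rewrite /N maxnA leq_maxr.
have [b [Db ABb cb]] : exists b, [/\ D b, (A a <-> B b) & agree N c b].
  have [Aa|nAa] := pselect (A a).
    by have [b [[Db Bb] cb]] := dB c N; exists b.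
  by have [b [[Db nBb] cb]] := dDB c N; exists b.
have bc : agree N b c by exact: agree_sym.
exists (State (shift c b \o sh s) (sk s \o shift b c) ((a, b) :: sp s)); split=> /=.
- split=> /=.
  + by split=> x /=; rewrite ?shiftK ?hk ?kh ?shiftK.
  + split=> m x y xy; first by apply: shift_iso; exact: ih.
    by apply: ik; exact: shift_iso.
  + move=> u v; rewrite inE => /predU1P[[-> ->]|uv].
      by split=> //; exact: shiftE.
    have [e Du Dv AB] := P _ _ uv; split=> //; rewrite e (shift_off cb) //.
    by move/(agree_le N3N); apply: H3; apply/mapP; exists (u, v).
  + move=> x nx; apply: (@eqfin_trans (sh s x)).
      by apply: Q => v; have := nx v; rewrite inE negb_or => /andP[].
    apply: shift_eqfin => e; have := nx b; rewrite inE -(hk x) e /c hk.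
    by rewrite eqxx.
- have nN : (n <= N)%N by exact: leq_trans N1N.
  split=> /=.
  + move=> x; split; first by apply: agree_le nN _; exact: shift_agree.
    by apply: agree_le nN _; apply: ik; exact: shift_agree.
  + by move=> p ps; rewrite inE ps orbT.
  + move=> j x jn Fx; rewrite !(@shift_off N) //.
      move=> bx; apply: (H2 j x jn Fx); apply: agree_le N2N _.
      exact: agree_trans bx.
    move=> /ik; rewrite /c !hk => /(agree_le N1N); exact: H1 Fx.
- by exists b; rewrite inE eqxx.
Qed.

Lemma back A B s n b : full_dense (D `&` A) -> full_dense (D `\` A) ->
  inv A B s -> D b ->
  exists s', [/\ inv A B s', ext n s s' & exists a, (a, b) \in sp s'].
Proof.
move=> dA dDA /inv_flip iS Db.
have [s' [i' e' [a m]]] := forth n dA dDA iS Db.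
exists (flip s'); split; first exact: inv_flip.
  by rewrite -[s]flipK; exact: ext_flip.
by exists a; rewrite mem_flip.
Qed.

Lemma back_and_forth A B : countable D ->
  full_dense (D `&` A) -> full_dense (D `\` A) ->
  full_dense (D `&` B) -> full_dense (D `\` B) ->
  exists h k, [/\ cancel h k, cancel k h, iso h /\ iso k,
    (forall x, D x -> D (h x) /\ (A x <-> B (h x))) /\ (forall x, D x -> D (k x)) &
    forall j x, F j x -> eqfin x (h x) /\ eqfin x (k x)].
Proof.
move=> cD dA dDA dB dDB.
have [d0 [[Dd0 _] _]] := dA (fun=> false) 0.
have [d dP] : exists d : nat -> real, forall x, D x <-> exists n, d n = x.
  have /countable_injP[g gi] := cD.
  exists (fun n => if pselect (exists x, D x /\ g x = n) is left e then projT1 (cid e) else d0).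
  move=> x; split=> [Dx|[n <-]]; last first.
    by case: pselect => // e; case: (cid e) => y [].
  exists (g x); case: pselect => [e|]; last by case; exists x.
  by case: (cid e) => y [Dy /= gy]; apply: gi => //; apply: mem_set.
have step n s : {s' | inv A B s -> [/\ inv A B s', ext n s s',
    exists b, (d n, b) \in sp s' & exists a, (a, d n) \in sp s']}.
  apply: cid; have [iS|] := pselect (inv A B s); last by exists s.
  have Dn : D (d n) by apply/dP; exists n.
  have [s1 [i1 e1 [b m1]]] := forth n dB dDB iS Dn.
  have [s2 [i2 e2 [a m2]]] := back n dA dDA i1 Dn.
  exists s2 => _; split=> //; first exact: ext_trans e2.
    by exists b; case: e2 => _ + _; apply.
  by exists a.
pose S := fix S n := if n is m.+1 then projT1 (step m (S m)) else State id id [::].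
have iS n : inv A B (S n).
  elim: n => [|n IH]; first by split=> [//||//|x _]; [split=> ? ? ? | exact: eqfinxx].
  by rewrite /=; case: (step n (S n)) => s' /= /(_ IH)[].
have stepP n := projT2 (step n (S n)) (iS n).
have eS m n : (m <= n)%N -> ext m (S m) (S n).
  elim: n => [|n IH]; first by rewrite leqn0 => /eqP ->; exact: ext_refl.
  rewrite leq_eqVlt => /predU1P[->|mn]; first exact: ext_refl.
  rewrite ltnS in mn; apply: ext_trans (IH mn) _.
  by have [_ e _ _] := stepP n; exact: ext_le e.
(* Coordinate [i] of the values no longer changes from stage [i.+1] on, so the diagonal is the limit
   of the maps and of their inverses. *)
pose h x i := sh (S i.+1) x i; pose k x i := sk (S i.+1) x i.
have hS n x : agree n (sh (S n) x) (h x).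
  move=> i lin; have [/(_ x)[H _] _ _] := eS i.+1 n lin.
  by rewrite /h H.
have kS n x : agree n (sk (S n) x) (k x).
  move=> i lin; have [/(_ x)[_ H] _ _] := eS i.+1 n lin.
  by rewrite /k H.
have ih : iso h.
  move=> n x y xy; apply: agree_trans (agree_sym (hS n x)) _.
  by apply: agree_trans (hS n y); have [_ [+ _] _ _] := iS n; apply.
have ik : iso k.
  move=> n x y xy; apply: agree_trans (agree_sym (kS n x)) _.
  by apply: agree_trans (kS n y); have [_ [_ +] _ _] := iS n; apply.
have hk : cancel h k.
  move=> x; apply: agree_all => n; apply: agree_trans (agree_sym (kS n _)) _.
  have [[e _] [_ ikn] _ _] := iS n; rewrite -{2}(e x); apply: ikn.
  exact: agree_sym.
have kh : cancel k h.
  move=> x; apply: agree_all => n; apply: agree_trans (agree_sym (hS n _)) _.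
  have [[_ e] [ihn _] _ _] := iS n; rewrite -{2}(e x); apply: ihn.
  exact: agree_sym.
have hP n a b : (a, b) \in sp (S n) -> h a = b.
  move=> ab; apply: agree_all => m.
  apply: agree_trans (agree_sym (agree_le (leq_maxr n m) (hS _ _))) _.
  have [_ + _] := eS n (maxn n m) (leq_maxl _ _) => /(_ _ ab) ab'.
  by have [_ _ /(_ _ _ ab')[-> _ _ _] _] := iS (maxn n m).
exists h, k; split=> //.
  split=> x /dP[n <-].
    have [_ _ [b m] _] := stepP n; rewrite (hP n.+1 _ _ m).
    by have [_ _ /(_ _ _ m)[_ _ Db AB] _] := iS n.+1.
  have [_ _ _ [a m]] := stepP n; rewrite -(hP n.+1 _ _ m) hk.
  by have [_ _ /(_ _ _ m)[_ Da _ _] _] := iS n.+1.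
move=> j x Fx.
have nD : ~ D x by move=> /(DF j)[n /(_ _ Fx)]; apply.
have hx : h x = sh (S j.+1) x.
  apply: agree_all => m; apply: agree_trans (agree_sym (agree_le (leq_maxr j.+1 m) (hS _ _))) _.
  by have [_ _ /(_ j x (ltnSn j) Fx)[-> _]] := eS j.+1 (maxn j.+1 m) (leq_maxl _ _).
have kx : k x = sk (S j.+1) x.
  apply: agree_all => m; apply: agree_trans (agree_sym (agree_le (leq_maxr j.+1 m) (kS _ _))) _.
  by have [_ _ /(_ j x (ltnSn j) Fx)[_ ->]] := eS j.+1 (maxn j.+1 m) (leq_maxl _ _).
rewrite hx kx; split.
  have [_ _ P Q] := iS j.+1; apply: Q => b; apply/negP => /P[_ Dx _ _].
  exact: nD.
have [_ _ P Q] := inv_flip (iS j.+1); apply: Q => b; apply/negP => /P[_ Dx _ _].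
exact: nD.
Qed.

End BackForth.

Definition eqfin_closure (S : set real) : set real := [set x | exists2 a, S a & eqfin a x].

Lemma eqfin_ccat a x : eqfin a x -> exists s : seq bool, x = ccat (size s) (nth false s) a.
Proof.
case=> n ax; exists (mkseq x n); rewrite size_mkseq; apply/funext => i.
by rewrite /ccat; case: ltnP => [lin|/ax //]; rewrite nth_mkseq.
Qed.

Lemma eqfin_closure_countable S : countable S -> countable (eqfin_closure S).
Proof.
move=> cS; have -> : eqfin_closure S =
    \bigcup_(s in [set: seq bool]) (ccat (size s) (nth false s) @` S).
  apply/seteqP; split=> [x [a Sa /eqfin_ccat[s ->]]|x [s _ [a Sa <-]]].
    by exists s => //; exists a.
  by exists a => //; exact: ccat_eqfin.
apply: bigcup_countable => // s _.
exact: sub_countable (card_image_le _ _) cS.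
Qed.

Lemma eqfin_closureP S x y : eqfin x y -> eqfin_closure S x -> eqfin_closure S y.
Proof. by move=> xy [a Sa ax]; exists a => //; exact: eqfin_trans xy. Qed.

(* Every countable subset of [Y] is a relative G_delta, coded by a set [a] of nodes of the
   binary tree. *)
Definition lambda_set (Y : set real) : Prop := forall A, A `<=` Y -> countable A ->
  exists a : set (seq bool), forall x, Y x ->
    (A x <-> forall m, exists2 n, (m <= n)%N & a (mkseq x n)).

Definition tail_lambda (Y : set real) : Prop :=
  [/\ forall x y, eqfin x y -> Y x -> Y y, lambda_set Y & ~ countable Y].

Lemma eqfin_full_dense (S : set real) z : (forall x, eqfin z x -> S x) -> full_dense S.
Proof.
move=> H x n; exists (ccat n x z); split; last exact: ccat_agree.
by apply: H; exact: ccat_eqfin.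
Qed.

Lemma countable_setU T (A B : set T) : countable A -> countable B -> countable (A `|` B).
Proof.
move=> cA cB; have -> : A `|` B = \bigcup_(b in [set: bool]) (if b then A else B).
  apply/seteqP; split=> [x [Ax|Bx]|x [[] _]]; [by exists true|by exists false|by left|by right].
by apply: bigcup_countable => // -[].
Qed.

Section Extra.
Variables (S : set real) (z : real).
Hypothesis Sz : ~ eqfin_closure S z.

(** The class of [z] is dense and disjoint from [S]. It makes the complement of [A] in [D] dense, so
    that points of [D] outside [A] find partners too. *)
Lemma dense_in A : A `<=` S -> full_dense A ->
  full_dense (eqfin_closure (S `|` [set z]) `&` A) /\
  full_dense (eqfin_closure (S `|` [set z]) `\` A).
Proof.
move=> AS dA; split.
  move=> x n; have [a [Aa xa]] := dA x n; exists a; split=> //; split=> //.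
  by exists a; [left; exact: AS | exact: eqfinxx].
apply: (eqfin_full_dense (z := z)) => x zx; split; first by exists z => //; right.
by move=> /AS Sx; apply: Sz; exists x => //; exact: eqfin_sym.
Qed.

End Extra.

Lemma tail_lambda_homogeneous Y A B : tail_lambda Y -> A `<=` Y -> B `<=` Y ->
  countable A -> countable B -> full_dense A -> full_dense B ->
  exists h k, [/\ cancel h k, cancel k h, iso h /\ iso k,
    forall x, Y x -> Y (h x) /\ Y (k x) & forall x, Y x -> (A x <-> B (h x))].
Proof.
move=> [Ye lY nY] AY BY cA cB dA dB.
have cS : countable (A `|` B) by exact: countable_setU.
have [z [Yz Sz]] : exists z, Y z /\ ~ eqfin_closure (A `|` B) z.
  apply: contrapT => /forallNP H; apply: nY.
  apply: sub_countable (eqfin_closure_countable cS); apply: subset_card_le => x Yx.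
  by apply: contrapT => nx; apply: (H x).
have [dA1 dA2] := dense_in Sz (@subsetUl _ A B) dA.
have [dB1 dB2] := dense_in Sz (@subsetUr _ A B) dB.
pose D := eqfin_closure (A `|` B `|` [set z]).
have cD : countable D.
  by apply: eqfin_closure_countable; apply: countable_setU => //; exact: countable1.
have DY : D `<=` Y.
  by move=> x [a + ax] => -[[/AY|/BY] Ya|az]; apply: Ye ax _ => //; rewrite az.
have [c cP] := lY D DY cD.
(* [D] consists of the points of [Y] with infinitely many prefixes in [c]; those with none from
   length [j] on form [F j], and these sets exhaust the rest of [Y]. *)
pose F j x := Y x /\ forall n, (j <= n)%N -> ~ c (mkseq x n).
have DF d j : D d -> exists n, forall x, F j x -> ~ agree n d x.
  move=> Dd; have [/(_ Dd)/(_ j)[n jn cn] _] := cP d (DY d Dd).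
  by exists n => x [_ /(_ n jn) H /agree_mkseq e]; apply: H; rewrite -e.
have FP x : Y x -> ~ D x -> exists j, F j x.
  move=> Yx nDx; apply: contrapT => /forallNP H; apply: nDx.
  apply/(cP x Yx) => m; apply: contrapT => nm; apply: (H m); split=> // n mn cn.
  by apply: nm; exists n.
have [h [k [hk kh ihk [hD kD] hF]]] :=
  back_and_forth (@eqfin_closureP _) DF cD dA1 dA2 dB1 dB2.
have hkF x : Y x -> ~ D x -> eqfin x (h x) /\ eqfin x (k x).
  by move=> Yx nDx; have [j Fj] := FP x Yx nDx; exact: hF Fj.
exists h, k; split=> // x Yx.
  have [Dx|/(hkF x Yx)[eh ek]] := pselect (D x); last by split; [apply: Ye eh _|apply: Ye ek _].
  by split; apply: DY; [have [] := hD x Dx | exact: kD].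
have [Dx|nDx] := pselect (D x); first by have [] := hD x Dx.
split=> [Ax|Bx]; exfalso; apply: nDx.
  by exists x; [left; left | exact: eqfinxx].
rewrite -(hk x); apply: kD; exists (h x); [by left; right | exact: eqfinxx].
Qed.

Lemma continuum_uncountable : ~ countable [set: real].
Proof.
move=> /countable_injP[f fi].
pose x n := if pselect (exists y, f y = n) is left e then ~~ (projT1 (cid e)) n else false.
have xE : x (f x) = ~~ x (f x).
  rewrite {1}/x; case: pselect => [e|]; last by case; exists x.
  by case: (cid e) => y /= /fi -> //; exact: mem_set.
by case: (x (f x)) xE.
Qed.

(** In the full Cantor space a map may act arbitrarily outside [D], hence the empty family [F] in
    the back-and-forth. *)
Lemma cantor_homogeneous A B : countable A -> countable B -> full_dense A -> full_dense B ->
  exists h k, [/\ cancel h k, cancel k h, iso h /\ iso k &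
    forall x, A x <-> B (h x)].
Proof.
move=> cA cB dA dB.
have cS : countable (A `|` B) by exact: countable_setU.
have [z Sz] : exists z, ~ eqfin_closure (A `|` B) z.
  apply: contrapT => /forallNP H; apply: continuum_uncountable.
  apply: sub_countable (eqfin_closure_countable cS); apply: subset_card_le => x _.
  by apply: contrapT => nx; apply: (H x).
have [dA1 dA2] := dense_in Sz (@subsetUl _ A B) dA.
have [dB1 dB2] := dense_in Sz (@subsetUr _ A B) dB.
pose D := eqfin_closure (A `|` B `|` [set z]).
have cD : countable D.
  by apply: eqfin_closure_countable; apply: countable_setU => //; exact: countable1.
have DF (d : real) (j : nat) : D d -> exists n, forall x, set0 x -> ~ agree n d x.
  by exists 0.
have [h [k [hk kh ihk [hD kD] _]]] :=
  back_and_forth (F := fun=> set0) (@eqfin_closureP _) DF cD dA1 dA2 dB1 dB2.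
exists h, k; split=> // x.
have [Dx|nDx] := pselect (D x); first by have [] := hD x Dx.
split=> [Ax|Bx]; exfalso; apply: nDx.
  by exists x; [left; left | exact: eqfinxx].
rewrite -(hk x); apply: kD; exists (h x); [by left; right | exact: eqfinxx].
Qed.

Definition btail (x : real) : real := fun i => x i.+1.
Definition bcons (b : bool) (x : real) : real := fun i => if i is j.+1 then x j else b.

Lemma bcons_btail x : bcons (x 0) (btail x) = x.
Proof. by apply/funext => -[|i]. Qed.

Lemma agree_bcons n b x y : agree n x y -> agree n.+1 (bcons b x) (bcons b y).
Proof. by move=> xy [|i] // /xy. Qed.

Lemma agree_btail n x y : agree n.+1 x y -> agree n (btail x) (btail y).
Proof. by move=> xy i lin; exact: xy. Qed.

(** * The topological sum of a lambda-set and the Cantor space *)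

Section Space.
Variable Y : set real.
Hypothesis gY : tail_lambda Y.

(** The first bit selects the summand: [true] for the Cantor space, [false] for [Y]. Both are
    clopen, so maps on them can be glued. *)
Definition sum_set : set cantor_space := [set x : real | x 0 \/ Y (btail x)].
Definition sum_space : topologicalType := set_type sum_set.

Lemma Y_eqfin x y : eqfin x y -> Y x -> Y y. Proof. by case: gY => + _ _; apply. Qed.

Lemma Y_nonempty : exists y, Y y.
Proof.
apply: contrapT => /forallNP H; case: gY => _ _; apply.
by have -> : Y = set0; [apply/seteqP; split=> // x /H | exact: countable0].
Qed.

Lemma Y_full_dense : full_dense Y.
Proof.
have [y Yy] := Y_nonempty; apply: (eqfin_full_dense (z := y)) => x yx.
exact: Y_eqfin Yy.
Qed.

Definition half (A : set sum_space) (b : bool) : set real :=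
  [set x | exists2 a, A a & pt a = bcons b x].

Lemma half_countable A b : countable A -> countable (half A b).
Proof.
move=> cA; apply: (@sub_countable _ _ _ ((btail \o @pt sum_set) @` A)).
  by apply: subset_card_le => x [a Aa e]; exists a => //=; rewrite e.
exact: sub_countable (card_image_le _ _) cA.
Qed.

Lemma half_sub A : half A false `<=` Y.
Proof. by move=> x [a _ e]; have [|] := ptP a; rewrite e. Qed.

Lemma half_dense b A : dense A -> full_dense (half A b).
Proof.
move=> /sub_denseP dA x n.
have [y xy Cy] : exists2 y, agree n x y & sum_set (bcons b y).
  case: b; first by exists x => //; left.
  by have [y [Yy xy]] := Y_full_dense x n; exists y => //; right.
have [a [Aa ya]] := dA (mkpt Cy) n.+1; rewrite pt_mkpt in ya.
exists (btail (pt a)); split; last by apply: agree_trans xy _; exact: agree_btail ya.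
by exists a => //; rewrite -{1}[pt a]bcons_btail -(ya 0).
Qed.

Lemma sum_space_CDH : CDH sum_space.
Proof.
move=> A B [cA dA] [cB dB].
have [h0 [k0 [hk0 kh0 [ih0 ik0] hY hAB0]]] := tail_lambda_homogeneous gY
  (@half_sub A) (@half_sub B) (half_countable false cA) (half_countable false cB)
  (half_dense false dA) (half_dense false dB).
have [h1 [k1 [hk1 kh1 [ih1 ik1] hAB1]]] := cantor_homogeneous
  (half_countable true cA) (half_countable true cB)
  (half_dense true dA) (half_dense true dB).
pose H (f g : real -> real) (x : real) := bcons (x 0) ((if x 0 then g else f) (btail x)).
have CH f g x : (forall x, Y x -> Y (f x)) -> sum_set x -> sum_set (H f g x).
  move=> fY; case x0: (x 0); first by left.
  rewrite /sum_set /= x0.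
  by case=> // Yx; right; rewrite /H x0; exact: fY.
pose hh x := H h0 h1 x; pose kk x := H k0 k1 x.
have cH f g x : btail (H f g x) = (if x 0 then g else f) (btail x) by [].
have iH f g : iso f -> iso g -> iso (H f g).
  move=> fi gi [|n] x y xy //; rewrite /H (xy 0 isT); apply: agree_bcons.
  by case: (y 0); [apply: gi|apply: fi]; exact: agree_btail.
have hhk : cancel hh kk.
  by move=> x; rewrite /kk /H cH /hh /H /= -[RHS]bcons_btail; case: (x 0); rewrite ?hk0 ?hk1.
have kkh : cancel kk hh.
  by move=> x; rewrite /hh /H cH /kk /H /= -[RHS]bcons_btail; case: (x 0); rewrite ?kh0 ?kh1.
have Chh (x : sum_space) : sum_set (hh (pt x)) by apply: CH (ptP x) => y /hY[].
have Ckk (x : sum_space) : sum_set (kk (pt x)) by apply: CH (ptP x) => y /hY[].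
pose f x := mkpt (Chh x); pose g x := mkpt (Ckk x).
have fg : cancel f g by move=> x; apply: pt_inj; exact: hhk.
have gf : cancel g f by move=> x; apply: pt_inj; exact: kkh.
exists f; split.
  split.
    move=> x U /sub_nbhsP[n HU]; apply/sub_nbhsP; exists n => y xy; apply: HU.
    exact: iH.
  exists g; split=> // x U /sub_nbhsP[n HU]; apply/sub_nbhsP; exists n => y xy.
  by apply: HU; exact: iH.
have AB x : A x <-> B (f x).
  have fE : pt (f x) = hh (pt x) by [].
  have AE : A x <-> half A (pt x 0) (btail (pt x)).
    split=> [Ax|[a Aa]]; first by exists x; rewrite ?bcons_btail.
    by rewrite bcons_btail => /pt_inj <-.
  have BE : B (f x) <-> half B (pt x 0) (btail (pt (f x))).
    have e : pt x 0 = pt (f x) 0 by [].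
    rewrite e; split=> [Ax|[a Aa]]; first by exists (f x); rewrite ?bcons_btail.
    by rewrite bcons_btail => /pt_inj <-.
  rewrite AE BE fE cH; have := ptP x; rewrite /sum_set /=.
  by case: (pt x 0) => /= [_|[//|Yx]]; [exact: hAB1|exact: hAB0].
apply/seteqP; split=> [_ [x /AB ? <-]//|y].
by rewrite -{1}(gf y) => /AB Ay; exists (g y).
Qed.

End Space.

(** * Sets and the constructible hierarchy *)

(** The step [F] receives a total function, padded with [u0] outside the predecessors; by the second
    hypothesis it cannot see the padding. *)
Lemma wf_rec (T U : Type) (u0 : U) (L : T -> T -> Prop) (F : T -> (T -> U) -> U) :
  well_founded L ->
  (forall m g g', (forall u, L u m -> g u = g' u) -> F m g = F m g') ->
  exists v : T -> U, forall m, v m = F m v.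
Proof.
move=> wL HF.
pose G m (g : forall u, L u m -> U) := F m (fun u => if pselect (L u m) is left l then g u l else u0).
exists (Fix wL (fun=> U) G) => m; rewrite Fix_eq.
  by apply: HF => u lu; case: pselect.
by move=> x f g fg; congr (F x _); apply/funext => u; case: pselect.
Qed.

Lemma veq_refl x : veq x x.
Proof. by elim: x => T f IH /=; split=> i; exists i. Qed.

Lemma veq_sym x y : veq x y -> veq y x.
Proof.
elim: x y => T f IH [U g] /= [H1 H2]; split=> [j|i].
  by have [i /IH] := H2 j; exists i.
by have [j /IH] := H1 i; exists j.
Qed.

Lemma veq_trans y x z : veq x y -> veq y z -> veq x z.
Proof.
elim: x y z => T f IH [U g] [V h] /= [H1 H2] [H3 H4]; split=> [i|k].
  by have [j /IH fg] := H1 i; have [k /fg] := H3 j; exists k.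
by have [j gh] := H4 k; have [i fg] := H2 j; exists i; exact: IH fg gh.
Qed.

Lemma veq_ext x y : veq x y <-> forall z, vmem z x <-> vmem z y.
Proof.
case: x y => [T f] [U g]; split=> [[H1 H2] z|H]; split.
- by case=> i zi; have [j] := H1 i; exists j; exact: veq_trans zi _.
- by case=> j zj; have [i] := H2 j; exists i; apply: veq_trans zj (veq_sym _).
- move=> i; have [+ _] := H (f i); case; first by exists i; exact: veq_refl.
  by move=> j /= e; exists j.
- move=> j; have [_ +] := H (g j); case; first by exists j; exact: veq_refl.
  by move=> i /= e; exists i; exact: veq_sym.
Qed.

Lemma vmem_r x y z : veq x y -> vmem z x -> vmem z y.
Proof. by move=> /veq_ext ->. Qed.

Lemma vmem_l x y z : veq x y -> vmem x z -> vmem y z.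
Proof. by move=> xy [j e]; exists j; apply: veq_trans e; exact: veq_sym. Qed.

Lemma vmem_ind (P : vset -> Prop) :
  (forall x, (forall y, vmem y x -> P y) -> P x) -> forall x, P x.
Proof.
move=> H x; suff : forall y, veq y x -> P y by apply; exact: veq_refl.
elim: x => T f IH y yx; apply: H => z /(vmem_r yx) [j]; exact: IH.
Qed.

Lemma vmem_irr x : ~ vmem x x.
Proof. by elim/vmem_ind: x => x IH xx; exact: (IH x xx xx). Qed.

Lemma velt_mem x (i : vidx x) : vmem (velt i) x.
Proof. by exists i; exact: veq_refl. Qed.

Lemma vmem_empty z : ~ vmem z vempty. Proof. by case=> -[]. Qed.

Lemma vmem_upair z x y : vmem z (vupair x y) <-> veq z x \/ veq z y.
Proof.
split; first by case=> -[]; [left|right].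
by case=> e; [exists true|exists false].
Qed.

Lemma vupair_congr x x' y y' : veq x x' -> veq y y' -> veq (vupair x y) (vupair x' y').
Proof.
move=> ex ey; split=> -[].
- by exists true.
- by exists false.
- by exists true.
- by exists false.
Qed.

Lemma vpair_congr x x' y y' : veq x x' -> veq y y' -> veq (vpair x y) (vpair x' y').
Proof. by move=> ex ey; do 2?apply: vupair_congr. Qed.

Lemma vupair_inj1 x y z : veq (vupair x x) (vupair y z) -> veq x y /\ veq x z.
Proof.
move=> /veq_ext H; split; apply: veq_sym.
  by have [] := (vmem_upair y x x).1 ((H y).2 ((vmem_upair _ _ _).2 (or_introl (veq_refl _)))).
by have [] := (vmem_upair z x x).1 ((H z).2 ((vmem_upair _ _ _).2 (or_intror (veq_refl _)))).
Qed.

Lemma vupair_injr x y z : veq (vupair x y) (vupair x z) -> veq y z.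
Proof.
move=> H; have /veq_ext E := H.
have [zx|zy] : veq z x \/ veq z y.
- by apply/vmem_upair/E/vmem_upair; right; exact: veq_refl.
- have [yx|//] : veq y x \/ veq y z.
    by apply/vmem_upair/E/vmem_upair; right; exact: veq_refl.
  exact: veq_trans yx (veq_sym zx).
- exact: veq_sym.
Qed.

Lemma vpair_inj x y x' y' : veq (vpair x y) (vpair x' y') -> veq x x' /\ veq y y'.
Proof.
move=> H; have /veq_ext E := H.
have xx' : veq x x'.
  have : vmem (vupair x x) (vpair x' y').
    by apply/E/vmem_upair; left; exact: veq_refl.
  by case/vmem_upair => /vupair_inj1[].
split=> //.
have H2 : veq (vpair x y) (vpair x y').
  apply: veq_trans H _; apply: vpair_congr; [exact: veq_sym|exact: veq_refl].
by apply: (@vupair_injr x); apply: vupair_injr H2.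
Qed.

Lemma vmem_bigcup T (F : T -> vset) z : vmem z (vbigcup F) <-> exists i, vmem z (F i).
Proof.
split; first by case=> -[i j] /= e; exists i; exists j.
by case=> i [j e]; exists (existT _ i j).
Qed.

Lemma vmem_succ z x : vmem z (vsucc x) <-> vmem z x \/ veq z x.
Proof.
split; first by case/vmem_bigcup => -[]; [left|case/vmem_upair; right].
case=> H; apply/vmem_bigcup; first by exists true.
by exists false; apply/vmem_upair; left.
Qed.

(** [vsep] tests a predicate on names, so its members are the expected ones only if [veq] names are
    not distinguished. *)
Definition vrespect (Q : vset -> Prop) := forall x y, veq x y -> Q x -> Q y.

Lemma vmem_sep x (Q : vset -> Prop) : vrespect Q ->
  forall z, vmem z (vsep x Q) <-> vmem z x /\ Q z.
Proof.
move=> rQ z; split; first case=> -[i Qi] /= e.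
  by split; [exists i|apply: rQ Qi; exact: veq_sym].
by case=> -[i e] Qz; have Qi := rQ _ _ e Qz; exists (exist _ i Qi).
Qed.

Definition vnum n := iter n vsucc vempty.

Lemma vnum_mem z n : vmem z (vnum n) <-> exists2 k, (k < n)%N & veq z (vnum k).
Proof.
elim: n => [|n IH].
  by split=> [/vmem_empty//|[]].
rewrite /= vmem_succ IH; split.
  case=> [[k kn e]|e]; first by exists k => //; exact: ltnW.
  by exists n.
case=> k; rewrite ltnS leq_eqVlt => /predU1P[->|kn] e; first by right.
by left; exists k.
Qed.

Lemma vnum_inj n m : veq (vnum n) (vnum m) -> n = m.
Proof.
move=> e; case: (ltngtP n m) => // [nm|mn]; exfalso.
  apply: (@vmem_irr (vnum m)); apply: vmem_l e _; apply/vnum_mem; exists n => //.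
  exact: veq_refl.
apply: (@vmem_irr (vnum n)); apply: vmem_l (veq_sym e) _; apply/vnum_mem; exists m => //.
exact: veq_refl.
Qed.

Lemma vmem_omega z : vmem z vomega <-> exists n, veq z (vnum n).
Proof. by split=> -[n e]; exists n. Qed.

Lemma vordinal_congr x y : veq x y -> vordinal x -> vordinal y.
Proof.
move=> xy [tx ex]; have yx := veq_sym xy; split.
  move=> a b /(vmem_r yx) ax ba; apply: vmem_r xy _; exact: tx ax ba.
by move=> a /(vmem_r yx); exact: ex.
Qed.

Lemma vordinal_mem x y : vordinal x -> vmem y x -> vordinal y.
Proof.
move=> [tx ex] yx; split; first exact: ex.
by move=> z zy; apply: ex; exact: tx zy.
Qed.

Lemma vordinal_trich x y : vordinal x -> vordinal y -> [\/ vmem x y, veq x y | vmem y x].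
Proof.
elim/vmem_ind: x y => x IHx y ox; elim/vmem_ind: y => y IHy oy.
have [[z [zx nzy]]|H1] := pselect (exists z, vmem z x /\ ~ vmem z y).
  have [zy|zy|yz] := IHx z zx y (vordinal_mem ox zx) oy; first by [].
    by apply: Or33; apply: vmem_l zy zx.
  by apply: Or33; case: ox => tx _; exact: tx yz.
have [[z [zy nzx]]|H2] := pselect (exists z, vmem z y /\ ~ vmem z x).
  have [xz|xz|zx] := IHy z zy (vordinal_mem oy zy).
  - by apply: Or31; case: oy => ty _; exact: ty xz.
  - by apply: Or31; apply: vmem_l (veq_sym xz) zy.
  - by [].
apply: Or32; apply/veq_ext => z; split=> zz; apply: contrapT => nz.
  by apply: H1; exists z.
by apply: H2; exists z.
Qed.

Definition scons (T : Type) (z : T) (e : nat -> T) (k : nat) := if k is k'.+1 then e k' else z.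

Lemma sat_congr phi A B e e' : veq A B -> (forall k, veq (e k) (e' k)) ->
  sat A phi e -> sat B phi e'.
Proof.
elim: phi A B e e' => [i j|i j|phi IH|phi IH1 psi IH2|phi IH] A B e e' AB ee' /=.
- by move=> H; apply: vmem_r (ee' j) _; apply: vmem_l H; exact: ee'.
- by move=> H; apply: veq_trans (veq_sym (ee' i)) _; apply: veq_trans H _.
- by move=> H H'; apply: H; apply: IH H'; [exact: veq_sym|move=> k; exact: veq_sym].
- by case=> H1 H2; split; [exact: IH1 H1|exact: IH2 H2].
- case=> z [zA H]; exists z; split; first exact: vmem_r zA.
  by apply: IH H => // -[|k] //; exact: veq_refl.
Qed.

Definition penv (T : Type) (u : T) (ps : seq T) : nat -> T := nth u (u :: ps).

Lemma penv_congr u u' ps : veq u u' -> forall k, veq (penv u ps k) (penv u' ps k).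
Proof.
move=> uu'; rewrite /penv => -[|k] //=.
by elim: ps k => [|p ps IH] [|k] //=; exact: veq_refl.
Qed.

Lemma map_penv (T U : Type) (v : T -> U) u ps k :
  v (penv u ps k) = penv (v u) (map v ps) k.
Proof. by rewrite /penv; case: k => //=; elim: ps => [|p ps IH] [|k] //=. Qed.

Fixpoint Forall (T : Type) (P : T -> Prop) (s : seq T) : Prop :=
  if s is x :: s' then P x /\ Forall P s' else True.

Lemma Forall_imp (T : Type) (P Q : T -> Prop) s :
  (forall x, P x -> Q x) -> Forall P s -> Forall Q s.
Proof. by move=> PQ; elim: s => //= x s IH [/PQ ? /IH]. Qed.

Lemma Forall_map (T U : Type) (P : U -> Prop) (f : T -> U) s :
  Forall P (map f s) <-> Forall (P \o f) s.
Proof. by elim: s => //= x s ->. Qed.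

Lemma vmem_def A z : vmem z (vdef A) <-> exists phi ps, Forall (vmem^~ A) ps /\
  forall u, vmem u z <-> vmem u A /\ sat A phi (penv u ps).
Proof.
have R phi ps : vrespect (fun x => sat A phi (penv x ps)).
  by move=> x y xy; apply: sat_congr; [exact: veq_refl|exact: penv_congr].
split.
  case=> -[phi s] /= e; exists phi, (map (@velt A) s); split.
    by elim: s {e} => //= i s IH; split=> //; exact: velt_mem.
  by move=> u; rewrite ((veq_ext z _).1 e) vmem_sep //; exact: R.
case=> phi [ps [Aps H]].
have [s sP] : exists s : seq (vidx A), size s = size ps /\
    forall k u, veq (nth u ps k) (nth u (map (@velt A) s) k).
  elim: ps Aps {H} => [|p ps IH] /=; first by exists [::]; split=> // k u; rewrite !nth_nil; exact: veq_refl.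
  case=> -[i ei] /IH[s [ss sP]]; exists (i :: s); split; first by rewrite /= ss.
  by case.
exists (phi, s); apply/veq_ext => u; rewrite H /= vmem_sep; last exact: R.
have E k : veq (penv u ps k) (penv u (map (@velt A) s) k).
  rewrite /penv; case: k => [|k] /=; first exact: veq_refl.
  by case: sP.
split=> -[uA us]; split=> //; apply: sat_congr us; try exact: veq_refl; first exact: E.
by move=> k; apply: veq_sym; exact: E.
Qed.

Lemma vdef_congr A B : veq A B -> veq (vdef A) (vdef B).
Proof.
suff H A' B' z : veq A' B' -> vmem z (vdef A') -> vmem z (vdef B').
  by move=> AB; apply/veq_ext => z; split; apply: H => //; exact: veq_sym.
move=> AB /vmem_def[phi [ps [Aps H]]]; apply/vmem_def; exists phi, ps; split.
  by apply: Forall_imp Aps => x; exact: vmem_r.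
move=> u; rewrite H; split=> -[uA us]; split; try by apply: vmem_r uA => //; exact: veq_sym.
  by apply: sat_congr us => // k; exact: veq_refl.
by apply: sat_congr us; [exact: veq_sym|move=> k; exact: veq_refl].
Qed.

Lemma Lstage_congr a b : veq a b -> veq (Lstage a) (Lstage b).
Proof.
elim: a b => T f IH [U g] [H1 H2]; apply/veq_ext => z; rewrite /= !vmem_bigcup; split.
  case=> i zi; have [j /IH e] := H1 i; exists j; apply: vmem_r zi; exact: vdef_congr.
case=> j zj; have [i /IH e] := H2 j; exists i; apply: vmem_r zj.
by apply: veq_sym; exact: vdef_congr.
Qed.

Lemma vmem_Lstage z a : vmem z (Lstage a) <-> exists b, vmem b a /\ vmem z (vdef (Lstage b)).
Proof.
case: a => T f /=; rewrite vmem_bigcup; split.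
  by case=> i zi; exists (f i); split=> //; exists i; exact: veq_refl.
case=> b [[i bi] zb]; exists i; apply: vmem_r zb.
by apply: vdef_congr; exact: Lstage_congr.
Qed.

Lemma Lstage_trans a : vordinal a -> vtransitive (Lstage a).
Proof.
move=> [ta _] y z /vmem_Lstage[b [ba /vmem_def[phi [ps [_ H]]]]] /H[zb _].
case/vmem_Lstage: zb => c [cb zc]; apply/vmem_Lstage; exists c; split=> //.
exact: ta cb.
Qed.

Lemma vordinal_succ a : vordinal a -> vordinal (vsucc a).
Proof.
move=> [ta ea]; split.
  move=> y z /vmem_succ[ya|ya] zy; apply/vmem_succ; left; first exact: ta zy.
  exact: vmem_r zy.
move=> y /vmem_succ[/ea//|ya]; have [//] := vordinal_congr (veq_sym ya) (conj ta ea).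
Qed.

(** * Countable codes for levels of L *)

Definition extE (E : nat -> nat -> Prop) (u v : nat) : Prop := forall k, E k u <-> E k v.

Fixpoint gsat (E : nat -> nat -> Prop) (D : nat -> Prop) (phi : formula) (e : nat -> nat) : Prop :=
  match phi with
  | FMem i j => E (e i) (e j)
  | FEq i j => extE E (e i) (e j)
  | FNot phi => ~ gsat E D phi e
  | FAnd phi psi => gsat E D phi e /\ gsat E D psi e
  | FEx phi => exists z, D z /\ gsat E D phi (scons z e)
  end.

(* A code represents a level of the constructible hierarchy on the set [nat]: [E] is
   membership, possibly with several names for a set, and [L i j] means that [i] is
   constructed at an earlier stage than [j].  Stages are thus part of the structure, so
   that no axiom V = L is needed to recognise codes. *)
Definition code_elem (E L : nat -> nat -> Prop) m phi ps u : Prop :=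
  exists u', [/\ L u' m, extE E u u' & gsat E (L^~ m) phi (penv u' ps)].

(** Besides transitivity: each set is definable over the names of earlier stages, and each stage is
    full, since the set defined over the names before [m] has a name [m'] that precedes everything
    after [m]. With well-foundedness this leaves only the true hierarchy, see [stage_o]. *)
Definition code_ok (E L : nat -> nat -> Prop) : Prop :=
  [/\ forall i j k, L i j -> L j k -> L i k,
      forall m, exists phi ps, Forall (L^~ m) ps /\
        forall u, E u m <-> code_elem E L m phi ps u &
      forall m phi ps, Forall (L^~ m) ps -> exists m',
        (forall n, L m n -> L m' n) /\
        forall u, E u m' <-> code_elem E L m phi ps u].

(** Phrased with descending sequences, so that the negation is an existential quantifier over
    sequences of numbers and hence analytic. *)
Definition code_wf (L : nat -> nat -> Prop) : Prop :=
  ~ exists s : nat -> nat, forall n, L (s n.+1) (s n).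

Lemma code_wfP L : code_wf L -> well_founded L.
Proof.
move=> wL m; apply: contrapT => nacc; apply: wL.
have step (x : {m | ~ Acc L m}) : {y : {m | ~ Acc L m} | L (sval y) (sval x)}.
  apply: cid; case: x => x nx /=; apply: contrapT => /forallNP H; apply: nx.
  constructor => y yx; apply: contrapT => ny; exact: (H (exist _ y ny)).
pose s := fix s n : {m | ~ Acc L m} := if n is k.+1 then sval (step (s k)) else exist _ m nacc.
exists (fun n => sval (s n)) => n /=; exact: (svalP (step (s n))).
Qed.

Section Decode.
Variables E L : nat -> nat -> Prop.
Hypothesis cE : code_ok E L.
Hypothesis wL : well_founded L.

(** Collapse of the code along [L]: [gval] yields the set named by [m], [gord] the ordinal of its
    stage. Only elements with an earlier name are collected; by [E_low] every element has such a
    name. *)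
Definition gval (m : nat) (g : nat -> vset) : vset :=
  VSet (fun u : {u | L u m /\ E u m} => g (sval u)).
Definition gord (m : nat) (g : nat -> vset) : vset :=
  VSet (fun u : {u | L u m} => g (sval u)).

Lemma gval_ex : exists v, forall m, v m = gval m v.
Proof.
apply: (wf_rec vempty wL) => m g g' gg'; rewrite /gval; congr VSet; apply/funext => -[u [lu eu]] /=.
exact: gg'.
Qed.

Lemma gord_ex : exists v, forall m, v m = gord m v.
Proof.
apply: (wf_rec vempty wL) => m g g' gg'; rewrite /gord; congr VSet; apply/funext => -[u lu] /=.
exact: gg'.
Qed.

Variables v o : nat -> vset.
Hypothesis vE : forall m, v m = gval m v.
Hypothesis oE : forall m, o m = gord m o.

Lemma mem_v z m : vmem z (v m) <-> exists u, [/\ L u m, E u m & veq z (v u)].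
Proof.
rewrite vE; split; first by case=> -[u [lu eu]] /= e; exists u.
by case=> u [lu eu e]; exists (exist _ u (conj lu eu)).
Qed.

Lemma mem_o z m : vmem z (o m) <-> exists2 u, L u m & veq z (o u).
Proof.
rewrite oE; split; first by case=> -[u lu] /= e; exists u.
by case=> u lu e; exists (exist _ u lu).
Qed.

Lemma extE_sym u w : extE E u w -> extE E w u. Proof. by move=> H k; rewrite H. Qed.
Lemma extE_trans u w x : extE E u w -> extE E w x -> extE E u x.
Proof. by move=> H H' k; rewrite H H'. Qed.

Lemma E_low u m : E u m -> exists u', [/\ L u' m, extE E u u' & E u' m].
Proof.
case: cE => _ C2 _; have [phi [ps [_ H]]] := C2 m.
move=> /H[u' [lu' uu' gs]]; exists u'; split=> //; apply/H; exists u'; split=> //.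
Qed.

Lemma E_congr u u' m : extE E u u' -> E u m -> E u' m.
Proof.
case: cE => _ C2 _; have [phi [ps [_ H]]] := C2 m.
move=> uu' /H[w [lw uw gs]]; apply/H; exists w; split=> //.
exact: extE_trans (extE_sym uu') uw.
Qed.

Lemma extE_veq u w : extE E u w -> veq (v u) (v w).
Proof.
elim/(well_founded_ind wL): u w => u IH w uw; apply/veq_ext => z; rewrite !mem_v; split.
  case=> k [ku Eku zk]; have /E_low[k' [k'w kk' Ek']] : E k w by apply/uw.
  exists k'; split=> //; apply: veq_trans zk _; exact: IH.
case=> k [kw Ekw zk]; have /E_low[k' [k'u kk' Ek']] : E k u by apply/uw.
exists k'; split=> //; apply: veq_trans zk _; apply: veq_sym; apply: IH => //.
exact: extE_sym.
Qed.

Lemma veq_extE u w : veq (v u) (v w) -> extE E u w.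
Proof.
elim/(well_founded_ind wL): u w => u IH w /veq_ext uw k; split=> /E_low[k' [lk kk' Ek']].
  have /uw/mem_v[k2 [k2w Ek2 /IH e]] : vmem (v k') (v u) by apply/mem_v; exists k'; split=> //; exact: veq_refl.
  apply: E_congr Ek2; apply: extE_sym; apply: extE_trans kk' _; exact: e.
have /uw/mem_v[k2 [k2w Ek2 e]] : vmem (v k') (v w) by apply/mem_v; exists k'; split=> //; exact: veq_refl.
apply: E_congr Ek2; apply: extE_trans (extE_sym kk').
by apply: IH => //; exact: veq_sym.
Qed.

Lemma E_mem u w : E u w <-> vmem (v u) (v w).
Proof.
split=> [/E_low[u' [lu uu' Eu]]|/mem_v[u' [lu Eu e]]].
  by apply/mem_v; exists u'; split=> //; exact: extE_veq.
by apply: E_congr Eu; apply: extE_sym; exact: veq_extE.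
Qed.

Lemma gsat_sat D A phi e : (forall z, vmem z A <-> exists2 u, D u & veq z (v u)) ->
  gsat E D phi e <-> sat A phi (v \o e).
Proof.
move=> HA; elim: phi e => [i j|i j|phi IH|phi IH1 psi IH2|phi IH] e /=.
- exact: E_mem.
- by split; [exact: extE_veq|exact: veq_extE].
- by rewrite IH.
- by rewrite IH1 IH2.
have sc u z : veq z (v u) -> forall k, veq (v (scons u e k)) (match k with 0 => z | k'.+1 => v (e k') end).
  by move=> zu [|k] //=; [exact: veq_sym|exact: veq_refl].
split.
  case=> u [Du /IH H]; exists (v u); split; first by apply/HA; exists u => //; exact: veq_refl.
  by apply: sat_congr H; [exact: veq_refl|apply: sc; exact: veq_refl].
case=> z [/HA[u Du zu] H]; exists u; split=> //; apply/IH.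
by apply: sat_congr H; [exact: veq_refl|move=> k; apply: veq_sym; exact: sc].
Qed.

Lemma code_elem_vset m A phi ps u : (forall z, vmem z A <-> exists2 u, L u m & veq z (v u)) ->
  code_elem E L m phi ps u <-> vmem (v u) A /\ sat A phi (penv (v u) (map v ps)).
Proof.
move=> HA; split.
  case=> u' [lu /extE_veq uu' /(gsat_sat _ _ HA) H]; split; first by apply/HA; exists u'.
  apply: sat_congr H; first exact: veq_refl.
  by move=> k; rewrite -[(v \o _) k]/(v (penv u' ps k)) (map_penv v); apply: penv_congr; exact: veq_sym.
case=> /HA[u' lu uu'] H; exists u'; split=> //; first exact: veq_extE.
apply/(gsat_sat _ _ HA); apply: sat_congr H; first exact: veq_refl.
by move=> k; rewrite -[(v \o _) k]/(v (penv u' ps k)) (map_penv v); exact: penv_congr.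
Qed.

(** Induction along [L]. A set definable over an earlier stage [w] has a name by fullness, and this
    name precedes [m] because [w] does; conversely the definability clause puts each earlier name
    into the next definable power set. *)
Lemma stage_o m z : vmem z (Lstage (o m)) <-> exists2 u, L u m & veq z (v u).
Proof.
case: (cE) => tL C2 C3.
elim/(well_founded_ind wL): m z => m IH z; rewrite vmem_Lstage; split.
  case=> b [/mem_o[w wm bw]] zb.
  have /vmem_def[phi [ps [Aps H]]] : vmem z (vdef (Lstage (o w))).
    by apply: vmem_r zb; apply: vdef_congr; exact: Lstage_congr.
  have HA := IH w wm.
  have [ps' [psL psE]] : exists ps', Forall (L^~ w) ps' /\ forall u k, veq (penv u ps k) (penv u (map v ps') k).
    elim: ps Aps {H} => [|p ps IHp] /=; first by exists [::]; split=> // u k; exact: veq_refl.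
    case=> /HA[q qw pq] /IHp[ps' [H1 H2]]; exists (q :: ps'); split=> //= u [|[|k]] //=.
      exact: veq_refl.
    exact: (H2 u k.+1).
  have [m' [m'L m'E]] := C3 w phi ps' psL.
  exists m'; first exact: m'L.
  apply/veq_ext => y; rewrite H; split.
    case=> yA ys; have /HA[q qw yq] := yA; apply: vmem_l (veq_sym yq) _; apply/E_mem.
    apply/m'E/(code_elem_vset _ _ _ HA); split; first exact: vmem_l yA.
    apply: sat_congr ys; first exact: veq_refl.
    by move=> k; apply: veq_trans (psE _ _) _; exact: penv_congr.
  case/mem_v=> q [_ /m'E/(code_elem_vset _ _ _ HA)[qA qs] yq]; split.
    by apply: vmem_l qA; exact: veq_sym.
  apply: sat_congr qs; first exact: veq_refl.
  move=> k; apply: veq_trans (veq_sym (psE _ _)) _.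
  by apply: penv_congr; exact: veq_sym.
case=> u um zu; exists (o u); split; first by apply/mem_o; exists u => //; exact: veq_refl.
have [phi [ps [psL H]]] := C2 u; have HA := IH u um.
apply/vmem_def; exists phi, (map v ps); split.
  by apply/Forall_map; apply: Forall_imp psL => p pu /=; apply/HA; exists p => //; exact: veq_refl.
move=> y; split.
  move=> /(vmem_r zu)/mem_v[q [_ /H/(code_elem_vset _ _ _ HA)[qA qs] yq]]; split.
    by apply: vmem_l qA; exact: veq_sym.
  by apply: sat_congr qs; [exact: veq_refl|apply: penv_congr; exact: veq_sym].
case=> yA ys; have /HA[q qu yq] := yA; apply: vmem_r (veq_sym zu) _.
apply: vmem_l (veq_sym yq) _; apply/E_mem/H/(code_elem_vset _ _ _ HA); split; first exact: vmem_l yA.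
by apply: sat_congr ys; [exact: veq_refl|exact: penv_congr].
Qed.

Lemma gord_ordinal m : vordinal (o m).
Proof.
case: (cE) => tL _ _.
have tr k : vtransitive (o k).
  move=> y z /mem_o[u uk yu] /(vmem_r yu)/mem_o[w wu zw]; apply/mem_o; exists w => //.
  exact: tL uk.
split; first exact: tr.
move=> y /mem_o[u _ yu] a b ay ba; apply: vmem_r (veq_sym yu) _.
by apply: tr ba; exact: vmem_r ay.
Qed.

End Decode.

Lemma code_decode E L m : code_ok E L -> code_wf L ->
  exists v b, [/\ vordinal b,
    exists c : nat -> vset, forall x, vmem x b -> exists n, veq x (c n),
    (forall z, vmem z (Lstage b) -> exists n, veq z (v n)) &
    forall N, L N m -> vmem (v N) (Lstage b) /\
      forall phi, gsat E (L^~ m) phi (fun=> N) <-> sat (Lstage b) phi (fun=> v N)].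
Proof.
move=> cE /code_wfP wL.
have [v vE] := gval_ex E wL; have [od oE] := gord_ex wL.
have St := stage_o cE wL vE oE.
exists v, (od m); split.
- exact: (gord_ordinal cE oE).
- by exists od => x /(mem_o oE)[n _ xn]; exists n.
- by move=> z /St[n _ zn]; exists n.
- move=> N Nm; split; first by apply/St; exists N => //; exact: veq_refl.
  by move=> phi; exact: (gsat_sat cE wL vE phi (fun=> N) (St m)).
Qed.

Fixpoint fcode (phi : formula) : GenTree.tree nat :=
  match phi with
  | FMem i j => GenTree.Node 0 [:: GenTree.Leaf i; GenTree.Leaf j]
  | FEq i j => GenTree.Node 1 [:: GenTree.Leaf i; GenTree.Leaf j]
  | FNot p => GenTree.Node 2 [:: fcode p]
  | FAnd p q => GenTree.Node 3 [:: fcode p; fcode q]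
  | FEx p => GenTree.Node 4 [:: fcode p]
  end.

Lemma fcode_inj : injective fcode.
Proof.
elim=> [i j|i j|p IH|p IHp q IHq|p IH] [i' j'|i' j'|p'|p' q'|p'] //=.
- by case=> -> ->.
- by case=> -> ->.
- by case=> /IH ->.
- by case=> /IHp -> /IHq ->.
- by case=> /IH ->.
Qed.

Lemma formula_enum : exists dec : nat -> formula, forall phi, exists n, dec n = phi.
Proof.
exists (fun n => if pselect (exists phi, pickle (fcode phi) = n) is left e
                 then projT1 (cid e) else FMem 0 0).
move=> phi; exists (pickle (fcode phi)); case: pselect => [e|]; last by case; exists phi.
by case: (cid e) => psi /= /(pcan_inj pickleK) /fcode_inj.
Qed.

(** The closure of [base] is enumerated by terms: finite trees whose nodes carry the codes of
    operations, of which there are countably many. *)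
Lemma skolem_closure (M : Type) (K : countType) (F : K -> seq M -> M) (base : M) :
  exists g : nat -> M, (exists i, g i = base) /\
    forall k s, exists i, g i = F k (map g s).
Proof.
pose ev := fix ev (t : GenTree.tree unit) : M := match t with
  | GenTree.Leaf _ => base
  | GenTree.Node n ts => if unpickle n is Some k then F k (map ev ts) else base
  end.
pose tr n : GenTree.tree unit := odflt (GenTree.Leaf tt) (unpickle n).
exists (ev \o tr); split; first by exists (pickle (GenTree.Leaf tt)); rewrite -[LHS]/(ev (tr _)) /tr pickleK.
move=> k s; exists (pickle (GenTree.Node (pickle k) (map tr s))).
by rewrite /= /tr pickleK /= pickleK -map_comp.
Qed.

(** * Countable codes from Skolem hulls *)

Section Encode.
Variable a : vset.
Hypothesis oa : vordinal a.
Variable f : vset.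
Hypothesis fa : vmem f (Lstage a).

Definition lelem := {p : vset * vset | vmem p.1 (vsucc a) /\ vmem p.2 (vdef (Lstage p.1))}.
Definition lst (p : lelem) := (sval p).1.
Definition lv (p : lelem) := (sval p).2.
Definition low (u m : lelem) := vmem (lst u) (lst m).
Definition lA (m : lelem) := Lstage (lst m).

Lemma lelem_ex b z : vmem b (vsucc a) -> vmem z (vdef (Lstage b)) ->
  exists m : lelem, lst m = b /\ lv m = z.
Proof. by move=> H1 H2; exists (exist _ (b, z) (conj H1 H2)). Qed.

Lemma lst_ordinal m : vordinal (lst m).
Proof. by have [H _] := svalP m; apply: vordinal_mem H; exact: vordinal_succ. Qed.

Lemma mem_lA m z : vmem z (lA m) <-> exists2 u, low u m & lv u = z.
Proof.
rewrite vmem_Lstage; split.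
  case=> b [bm zb]; have [|u [ub uz]] := @lelem_ex b z _ zb.
    by have [H _] := svalP m; have [ts _] := vordinal_succ oa; exact: ts H bm.
  by exists u => //; rewrite /low ub.
by case=> -[[b y] [H1 H2]] /= um <-; exists b.
Qed.

Lemma lv_def m : vmem (lv m) (vdef (lA m)).
Proof. by case: m => -[b z] []. Qed.

Lemma low_trans i j k : low i j -> low j k -> low i k.
Proof. by move=> ij jk; have [tk _] := lst_ordinal k; exact: tk ij. Qed.

Lemma low_map m ps : Forall (vmem^~ (lA m)) ps ->
  exists qs, map lv qs = ps /\ Forall (low^~ m) qs.
Proof.
elim: ps => [|p ps IH] /=; first by exists [::].
case=> /mem_lA[u um <-] /IH[qs [<- H]]; by exists (u :: qs).
Qed.

Lemma params m : exists phi qs, Forall (low^~ m) qs /\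
  forall u, vmem u (lv m) <-> vmem u (lA m) /\ sat (lA m) phi (penv u (map lv qs)).
Proof.
have /vmem_def[phi [ps [/low_map[qs [<- H]] H']]] := lv_def m.
by exists phi, qs.
Qed.

(* The Skolem hull of [f] in a level of L is again a code: this plays the role of
   condensation. *)
Lemma code_encode : exists E L m N, [/\ code_ok E L, code_wf L, L N m &
  forall phi, gsat E (L^~ m) phi (fun=> N) <-> sat (Lstage a) phi (fun=> f)].
Proof.
have [dec decP] := formula_enum.
have [f0 f0a fE] : exists2 f0, vmem (lst f0) a & lv f0 = f.
  have /vmem_Lstage[b [ba fb]] := fa.
  have [|u [ub uf]] := lelem_ex _ fb; first by apply/vmem_succ; left.
  by exists u => //; rewrite ub.
have [m0 m0a] : exists m : lelem, lst m = a.
  have H : vmem (Lstage a) (vdef (Lstage a)).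
    apply/vmem_def; exists (FEq 0 0), [::]; split=> // u /=.
    by split=> [|[]//]; split=> //; exact: veq_refl.
  by have [|m [ma _]] := lelem_ex _ H; [apply/vmem_succ; right; exact: veq_refl|exists m].
have [par parP] : exists par : lelem -> formula * seq lelem, forall m,
    Forall (low^~ m) (par m).2 /\ forall u, vmem u (lv m) <->
      vmem u (lA m) /\ sat (lA m) (par m).1 (penv u (map lv (par m).2)).
  have H m : exists p : formula * seq lelem, Forall (low^~ m) p.2 /\ forall u, vmem u (lv m) <->
      vmem u (lA m) /\ sat (lA m) p.1 (penv u (map lv p.2)).
    by have [phi [qs H]] := params m; exists (phi, qs).
  by exists (fun m => projT1 (cid (H m))) => m; exact: (projT2 (cid (H m))).
have ch (P : lelem -> Prop) : exists w, (exists x, P x) -> P w.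
  have [[x Px]|nx] := pselect (exists x, P x); first by exists x.
  by exists f0.
pose choo P := projT1 (cid (ch P)).
have chooP P x : P x -> P (choo P) by move=> Px; apply: (projT2 (cid (ch P))); exists x.
(* The Skolem operations, with [m] the first argument: 0 gives the top element [m0], 1 a parameter
   in the definition of [m], 2 a witness below [m] for a formula, 3 an element of [m] missing from a
   second set, 4 an element below [m] equal to a given set, 5 the set defined by a formula at the
   stage of [m]. *)
pose F (k : nat * nat) (s : seq lelem) : lelem :=
  let m := head f0 s in
  match k.1 with
  | 0 => m0
  | 1 => nth f0 (par m).2 k.2
  | 2 => choo (fun w => low w m /\ sat (lA m) (dec k.2)
           (scons (lv w) (lv \o nth (nth f0 s 1) (behead (behead s)))))
  | 3 => choo (fun w => (vmem (lv w) (lv m) /\ ~ vmem (lv w) (lv (nth f0 s 1))))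
  | 4 => choo (fun w => low w m /\ veq (lv (nth f0 s 1)) (lv w))
  | _ => choo (fun w => lst w = lst m /\ forall u, vmem u (lv w) <->
           vmem u (lA m) /\ sat (lA m) (dec k.2) (penv u (map lv (behead s))))
  end.
have [g [[i0 g0] gF]] := skolem_closure F f0.
pose E i j := vmem (lv (g i)) (lv (g j)).
pose L i j := low (g i) (g j).
have extEP u w : extE E u w <-> veq (lv (g u)) (lv (g w)).
  split; last by move=> /veq_ext H k; exact: H.
  have sub u' w' : extE E u' w' -> forall z, vmem z (lv (g u')) -> vmem z (lv (g w')).
    move=> H z zu; apply: contrapT => nzw.
    have /mem_lA[x _ xz] : vmem z (lA (g u')).
      by have /vmem_def[phi [ps [_ H']]] := lv_def (g u'); have [] := (H' z).1 zu.
    have [k gk] := gF (3, 0) [:: u'; w']; move: gk; rewrite /F /= => gk.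
    have := @chooP (fun w => (vmem (lv w) (lv (g u')) /\ ~ vmem (lv w) (lv (g w')))) x.
    rewrite -gk xz => -[//|ku kw]; apply: kw; exact: (H k).1.
  by move=> H; apply/veq_ext => z; split; apply: sub => //; exact: extE_sym.
(* Environments are restricted to the form [nth d s], since a Skolem operation receives a finite
   list of arguments. *)
have gs phi m d s : gsat E (L^~ m) phi (nth d s) <->
    sat (lA (g m)) phi (fun k => lv (g (nth d s k))).
  elim: phi s => [i j|i j|phi IH|phi IH1 psi IH2|phi IH] s //=.
  - by rewrite IH.
  - by rewrite IH1 IH2.
  have sc z : scons z (nth d s) = nth d (z :: s) by apply/funext => -[].
  split.
    case=> z [zm]; rewrite sc => /IH H; exists (lv (g z)); split.
      by apply/mem_lA; exists (g z).
    by apply: sat_congr H => // [|[|k]] /=; exact: veq_refl.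
  case=> _ [/mem_lA[u um <-]] H; have [n decn] := decP phi.
  have [k gk] := gF (2, n) [:: m, d & s]; move: gk; rewrite /F /= => gk.
  have ge : lv \o nth (g d) (map g s) = fun k => lv (g (nth d s k)).
    apply/funext => i /=; congr lv; have [lt|ge] := ltnP i (size s).
      by rewrite (nth_map d).
    by rewrite !nth_default // size_map.
  have := @chooP (fun w => low w (g m) /\ sat (lA (g m)) (dec n)
           (scons (lv w) (lv \o nth (g d) (map g s)))) u.
  rewrite -gk ge decn => -[//|km H']; exists k; split=> //; rewrite sc; apply/IH.
  by apply: sat_congr H' => // [|[|i]]; exact: veq_refl.
have gsp phi m u ps : gsat E (L^~ m) phi (penv u ps) <->
    sat (lA (g m)) phi (penv (lv (g u)) (map lv (map g ps))).
  rewrite /penv gs; have -> // : (fun k => lv (g (nth u (u :: ps) k))) = nth (lv (g u)) (lv (g u) :: map lv (map g ps)).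
  by apply/funext => k; rewrite -[RHS]/(penv _ _ k) -map_comp -(map_penv (lv \o g)).
have Ce phi m ps u : code_elem E L m phi ps u <->
    vmem (lv (g u)) (lA (g m)) /\ sat (lA (g m)) phi (penv (lv (g u)) (map lv (map g ps))).
  split.
    case=> u' [um /extEP uu' /gsp H]; split.
      by apply: vmem_l (veq_sym uu') _; apply/mem_lA; exists (g u').
    by apply: sat_congr H; [exact: veq_refl|apply: penv_congr; exact: veq_sym].
  case=> /mem_lA[x xm xu] H.
  have [k gk] := gF (4, 0) [:: m; u]; move: gk; rewrite /F /= => gk.
  have := @chooP (fun w => low w (g m) /\ veq (lv (g u)) (lv w)) x.
  rewrite -gk xu => -[|km ku]; first by split=> //; exact: veq_refl.
  exists k; split=> //; first exact/extEP.
  by apply/gsp; apply: sat_congr H; [exact: veq_refl|exact: penv_congr].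
have [i1 g1] := gF (0, 0) [::]; rewrite /F /= in g1.
have Em u m : E u m -> vmem (lv (g u)) (lA (g m)).
  by have /vmem_def[phi [ps [_ H]]] := lv_def (g m); move=> /H[].
have lowS m m' : lst m = lst m' -> lA m = lA m' by rewrite /lA => ->.
exists E, L, i1, i0; split.
- split.
  + by move=> i j k; exact: low_trans.
  + move=> m; have [P1 P2] := parP (g m).
    have [ps psE] : exists ps, map g ps = (par (g m)).2.
      have H n : exists k, g k = nth f0 (par (g m)).2 n.
        by have [k gk] := gF (1, n) [:: m]; exists k; rewrite gk /F.
      pose ps := mkseq (fun n => projT1 (cid (H n))) (size (par (g m)).2).
      exists ps; apply: (@eq_from_nth _ f0); first by rewrite size_map size_mkseq.
      rewrite size_map size_mkseq => i lti; rewrite (nth_map 0) ?size_mkseq // nth_mkseq //.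
      exact: (projT2 (cid (H i))).
    exists (par (g m)).1, ps; split; first by rewrite -psE Forall_map in P1.
    by move=> u; rewrite Ce psE -P2.
  + move=> m phi ps psm; have [n decn] := decP phi.
    have [k gk] := gF (5, n) (m :: ps); move: gk; rewrite /F /= => gk.
    have R : vrespect (fun x => sat (lA (g m)) phi (penv x (map lv (map g ps)))).
      by move=> x y xy; apply: sat_congr; [exact: veq_refl|exact: penv_congr].
    have zdef : vmem (vsep (lA (g m)) (fun x => sat (lA (g m)) phi (penv x (map lv (map g ps)))))
        (vdef (lA (g m))).
      apply/vmem_def; exists phi, (map lv (map g ps)); split; last by move=> u; exact: vmem_sep.
      rewrite !Forall_map; apply: Forall_imp psm => p pm /=.
      by apply/mem_lA; exists (g p).
    have [|x [xm xE]] := lelem_ex _ zdef; first by have [] := svalP (g m).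
    have := @chooP (fun w => lst w = lst (g m) /\ forall u, vmem u (lv w) <->
           vmem u (lA (g m)) /\ sat (lA (g m)) (dec n) (penv u (map lv (map g ps)))) x.
    rewrite -gk => -[|km kE].
      by split=> // u; rewrite xE decn; exact: vmem_sep.
    exists k; split; first by move=> j; rewrite /L /low km.
    by move=> u; rewrite Ce /E kE decn.
- case=> s sL; have : forall x, (exists n, veq x (lst (g (s n)))) -> False.
    elim/vmem_ind => x IH [n xn]; apply: (IH (lst (g (s n.+1)))).
      by apply: vmem_r (veq_sym xn) _; exact: sL.
    by exists n.+1; exact: veq_refl.
  by apply; exists 0; exact: veq_refl.
- by rewrite /L /low g0 g1 m0a.
- move=> phi; have -> : (fun=> i0) = nth i0 [::] by apply/funext => k; rewrite nth_nil.
  rewrite gs /lA g1 m0a; suff -> : (fun k => lv (g (nth i0 [::] k))) = fun=> f by [].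
  by apply/funext => k; rewrite nth_nil g0 fE.
Qed.

End Encode.

(* [Theta n m] says of [f] that it contains pairs (u, n) and (v, m) with u in v or
   u = v.  When [f] injects an ordinal into omega, the resulting relation on omega
   determines the ordinal: see [xrel_inj]. *)
Definition FOr p q := FNot (FAnd (FNot p) (FNot q)).
Definition FIff p q := FAnd (FNot (FAnd p (FNot q))) (FNot (FAnd q (FNot p))).
Definition FAll p := FNot (FEx (FNot p)).
Definition FUpair a b c := FAll (FIff (FMem 0 c.+1) (FOr (FEq 0 a.+1) (FEq 0 b.+1))).
Definition FPair u s p := FEx (FEx (FAnd (FUpair u.+2 u.+2 1)
  (FAnd (FUpair u.+2 s.+2 0) (FUpair 1 0 p.+2)))).
Fixpoint FNum n s := if n is k.+1 then
    FEx (FAnd (FNum k 0) (FAll (FIff (FMem 0 s.+2) (FOr (FMem 0 1) (FEq 0 1)))))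
  else FNot (FEx (FMem 0 s.+1)).
Definition Theta n m : formula :=
  FEx (FEx (FEx (FEx (FEx (FEx (FAnd (FAnd (FNum n 4) (FAnd (FPair 5 4 3) (FMem 3 6)))
    (FAnd (FAnd (FNum m 1) (FAnd (FPair 2 1 0) (FMem 0 6))) (FOr (FMem 5 2) (FEq 5 2))))))))).

Definition xrel (f : vset) (n m : nat) : Prop := exists u v,
  [/\ vmem (vpair u (vnum n)) f, vmem (vpair v (vnum m)) f & vmem u v \/ veq u v].

Lemma not_and_not (P Q : Prop) : ~ (~ P /\ ~ Q) <-> P \/ Q.
Proof. by rewrite -not_orE not_notE. Qed.

Section SatTheta.
Variable A : vset.
Hypothesis tA : vtransitive A.
Implicit Types e : nat -> vset.

Definition inA e := forall k, vmem (e k) A.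

Lemma inA_scons e z : inA e -> vmem z A -> inA (scons z e).
Proof. by move=> eA zA [|k] //=. Qed.

Lemma sat_or p q e : sat A (FOr p q) e <-> sat A p e \/ sat A q e.
Proof. by rewrite /= -not_orE not_notE. Qed.

Lemma sat_iff p q e : sat A (FIff p q) e <-> (sat A p e <-> sat A q e).
Proof.
rewrite /=; split=> [[H1 H2]|H]; last by split=> -[H1 H2]; apply: H2; apply/H.
by split=> H; apply: contrapT => H'; [apply: H1|apply: H2].
Qed.

Lemma sat_all p e : sat A (FAll p) e <-> forall z, vmem z A -> sat A p (scons z e).
Proof.
split=> [H z zA|H [z [zA]]]; last by apply; exact: H.
by apply: contrapT => nz; apply: H; exists z.
Qed.

Lemma sat_ex p e : sat A (FEx p) e <-> exists2 z, vmem z A & sat A p (scons z e).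
Proof. by split=> [[z [zA H]]|[z zA H]]; exists z. Qed.

Lemma sat_upair a b c e : inA e ->
  sat A (FUpair a b c) e <-> veq (e c) (vupair (e a) (e b)).
Proof.
move=> eA; rewrite sat_all veq_ext; split=> H z.
  split=> [zc|].
    have zA := tA (eA c) zc.
    by have /sat_iff[/= H1 _] := H z zA; apply/vmem_upair; exact: ((not_and_not _ _).1 (H1 zc)).
  move=> zab; have zA : vmem z A.
    by case/vmem_upair: zab => E; apply: vmem_l (veq_sym E) _; exact: eA.
  by have /sat_iff[/= _ H1] := H z zA; apply: H1; apply/not_and_not/vmem_upair.
move=> zA; apply/sat_iff; rewrite sat_or /=.
by rewrite H vmem_upair.
Qed.

Lemma sat_pair u s p e : inA e ->
  sat A (FPair u s p) e <-> veq (e p) (vpair (e u) (e s)).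
Proof.
move=> eA; rewrite sat_ex; split.
  case=> c cA /sat_ex[d dA [/sat_upair H1 [/sat_upair H2 /sat_upair H3]]].
  have eA' := inA_scons (inA_scons eA cA) dA.
  apply: veq_trans (H3 eA') _; apply: vupair_congr; [exact: H1|exact: H2].
move=> H; have cp : vmem (vupair (e u) (e u)) (e p).
  by apply: vmem_r (veq_sym H) _; apply/vmem_upair; left; exact: veq_refl.
have dp : vmem (vupair (e u) (e s)) (e p).
  by apply: vmem_r (veq_sym H) _; apply/vmem_upair; right; exact: veq_refl.
have cA := tA (eA p) cp; have dA := tA (eA p) dp.
exists (vupair (e u) (e u)) => //; apply/sat_ex; exists (vupair (e u) (e s)) => //.
have eA' := inA_scons (inA_scons eA cA) dA.
split; last split; (apply: (sat_upair _ _ _ eA').2; exact: veq_refl || exact: H).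
Qed.

Lemma sat_num n s e : inA e -> sat A (FNum n s) e <-> veq (e s) (vnum n).
Proof.
elim: n s e => [|n IH] s e eA.
  split=> [H|H [z [zA /= zs]]]; last by apply: (@vmem_empty z); exact: vmem_r zs.
  apply/veq_ext => z; split=> [zs|/vmem_empty//]; exfalso; apply: H.
  by exists z; split=> //; exact: tA zs.
have succE r : vmem r A -> sat A (FAll (FIff (FMem 0 s.+2) (FOr (FMem 0 1) (FEq 0 1)))) (scons r e)
    <-> veq (e s) (vsucc r).
  move=> rA; rewrite sat_all veq_ext; split=> H z.
    split=> zs.
      have /H/sat_iff[/(_ zs) H1 _] := tA (eA s) zs.
      by apply/vmem_succ; exact: ((not_and_not _ _).1 H1).
    have zA : vmem z A.
      by case/vmem_succ: zs => [/(tA rA)//|E]; apply: vmem_l (veq_sym E) _.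
    by have /H/sat_iff[_] := zA; apply; apply/sat_or/vmem_succ.
  by move=> zA; apply/sat_iff; rewrite sat_or /= H vmem_succ.
have succ_congr x y : veq x y -> veq (vsucc x) (vsucc y).
  move=> xy; apply/veq_ext => z; rewrite !vmem_succ; split=> -[H|H].
  - by left; exact: vmem_r H.
  - by right; exact: veq_trans xy.
  - by left; apply: vmem_r H; exact: veq_sym.
  - by right; apply: veq_trans H _; exact: veq_sym.
rewrite [FNum _ _]/= sat_ex; split.
  case=> r rA [/IH H1 /succE H2]; apply: veq_trans (H2 rA) _.
  by apply: succ_congr; apply: H1; exact: inA_scons.
move=> H; have rA : vmem (vnum n) A.
  apply: tA (eA s) _; apply: vmem_r (veq_sym H) _.
  by apply/vmem_succ; right; exact: veq_refl.
exists (vnum n) => //; split; last exact/succE.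
by apply/IH; [exact: inA_scons|exact: veq_refl].
Qed.

(** Absoluteness: everything quantified in [Theta] (variables 5, 4, 3 for u, n and their pair,
    variables 2, 1, 0 for v, m and theirs) lies in the transitive closure of [f], hence in [A]. *)
Lemma sat_Theta n m f : vmem f A -> sat A (Theta n m) (fun=> f) <-> xrel f n m.
Proof.
move=> fA; have e0 : inA (fun=> f) by [].
split.
  case/sat_ex=> u uA /sat_ex[s sA /sat_ex[p pA /sat_ex[v vA /sat_ex[t tA' /sat_ex[q qA]]]]].
  have eA := inA_scons (inA_scons (inA_scons (inA_scons (inA_scons (inA_scons e0 uA) sA) pA) vA) tA') qA.
  case=> -[H1 [H2 pf]] [[H3 [H4 qf]] uv]; exists u, v.
  have sn := (sat_num _ _ eA).1 H1; have pE := (sat_pair _ _ _ eA).1 H2.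
  have tm := (sat_num _ _ eA).1 H3; have qE := (sat_pair _ _ _ eA).1 H4.
  split; last exact: ((not_and_not _ _).1 uv).
    apply: vmem_l pf; apply: veq_trans pE _; apply: vpair_congr sn; exact: veq_refl.
  apply: vmem_l qf; apply: veq_trans qE _; apply: vpair_congr tm; exact: veq_refl.
case=> u [v [unf vmf uv]].
have dec x y : vmem (vpair x y) f -> [/\ vmem (vpair x y) A, vmem x A & vmem y A].
  move=> xyf; have pA := tA fA xyf.
  have /(tA pA) xyA : vmem (vupair x y) (vpair x y).
    by apply/vmem_upair; right; exact: veq_refl.
  by split=> //; apply: tA xyA _; apply/vmem_upair; [left|right]; exact: veq_refl.
have [pA uA nA] := dec _ _ unf; have [qA vA mA] := dec _ _ vmf.
apply/sat_ex; exists u => //; apply/sat_ex; exists (vnum n) => //.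
apply/sat_ex; exists (vpair u (vnum n)) => //; apply/sat_ex; exists v => //.
apply/sat_ex; exists (vnum m) => //; apply/sat_ex; exists (vpair v (vnum m)) => //.
have eA := inA_scons (inA_scons (inA_scons (inA_scons (inA_scons (inA_scons e0 uA) nA) pA) vA) mA) qA.
split; split; last exact: ((not_and_not _ _).2 uv).
- by apply: (sat_num _ _ eA).2; exact: veq_refl.
- by split=> //; apply: (sat_pair _ _ _ eA).2; exact: veq_refl.
- split; first by apply: (sat_num _ _ eA).2; exact: veq_refl.
  by split=> //; apply: (sat_pair _ _ _ eA).2; exact: veq_refl.
Qed.

End SatTheta.

(** By induction on membership, elements with the same code are equal, as the codes of their
    elements are the same. Allowing u = v in [xrel] records which numbers are codes; with strict
    membership alone the ordinals 0 and 1 would have the same relation. *)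
Lemma xrel_inj f b f' b' : vordinal b -> vordinal b' ->
  vinjection f b vomega -> vinjection f' b' vomega ->
  (forall n m, xrel f n m <-> xrel f' n m) -> veq b b'.
Proof.
suff H f1 b1 f2 b2 : vordinal b1 -> vordinal b2 -> vinjection f1 b1 vomega ->
    vinjection f2 b2 vomega -> (forall n m, xrel f1 n m -> xrel f2 n m) ->
    (forall n m, xrel f2 n m -> xrel f1 n m) ->
    forall z, vmem z b1 -> vmem z b2.
  move=> ob ob' fb fb' ff'; apply/veq_ext => z; split; apply: H; try eassumption;
    by move=> n m; rewrite ff'.
move=> [tb1 _] [tb2 _] [dom1 tot1 fun1 inj1] [dom2 tot2 fun2 inj2] H12 H21.
have code f3 b3 u : vinjection f3 b3 vomega -> vmem u b3 -> exists n, vmem (vpair u (vnum n)) f3.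
  case=> dom tot _ _ ub; have [y uy] := tot u ub; have [x' [y' [_ /vmem_omega[n yn] e]]] := dom _ uy.
  have [_ yy'] := vpair_inj e; exists n; apply: vmem_l uy; apply: vpair_congr (veq_refl _) _.
  exact: veq_trans yy' yn.
have i1 : vinjection f1 b1 vomega by split.
have i2 : vinjection f2 b2 vomega by split.
have inb f3 b3 u n : vinjection f3 b3 vomega -> vmem (vpair u (vnum n)) f3 -> vmem u b3.
  case=> dom _ _ _ /dom[x [y [xb _ e]]]; have [ux _] := vpair_inj e.
  exact: vmem_l (veq_sym ux) xb.
(* an element of u is sent into u', given the codes of u and u' agree *)
have half gf gb hf hb u u' n : vtransitive gb -> vinjection gf gb vomega ->
    vinjection hf hb vomega -> (forall n m, xrel gf n m -> xrel hf n m) ->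
    vmem (vpair u (vnum n)) gf -> vmem (vpair u' (vnum n)) hf ->
    forall w, vmem w u -> exists w' m, [/\ vmem w' u', vmem (vpair w (vnum m)) gf
       & vmem (vpair w' (vnum m)) hf].
  move=> tg ig ih gh un un' w wu.
  have wb : vmem w gb by apply: (tg _ _ _ wu); exact: (inb _ _ _ _ ig un).
  have [m wm] := code _ _ _ ig wb.
  have /gh[w' [u2 [w'm u2n wu2]]] : xrel gf m n by exists w, u; split=> //; left.
  have [_ _ funh injh] := ih; have u2u' := injh _ _ _ u2n un'.
  exists w', m; split=> //; case: wu2 => [wu2|wu2]; first exact: vmem_r wu2.
  have mn : m = n.
    apply: vnum_inj; apply: funh w'm _; apply: vmem_l u2n.
    by apply: vpair_congr; [exact: veq_sym|exact: veq_refl].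
  rewrite mn in wm; have [_ _ _ injg] := ig; have wu' := injg _ _ _ wm un.
  by case: (@vmem_irr u); exact: vmem_l wu' wu.
have same : forall u, forall u' n, vmem (vpair u (vnum n)) f1 -> vmem (vpair u' (vnum n)) f2 -> veq u u'.
  elim/vmem_ind => u IH u' n un un'; apply/veq_ext => w; split=> wu.
    have [w' [m [w'u' wm w'm]]] := half _ _ _ _ _ _ _ tb1 i1 i2 H12 un un' w wu.
    by apply: (vmem_l _ w'u'); apply: veq_sym; exact: (IH _ wu _ _ wm w'm).
  have [w' [m [w'u wm w'm]]] := half _ _ _ _ _ _ _ tb2 i2 i1 H21 un' un w wu.
  by apply: (vmem_l _ w'u); exact: (IH _ w'u _ _ w'm wm).
move=> z zb; have [n zn] := code _ _ _ i1 zb.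
have /H12[u [u2 [un _ _]]] : xrel f1 n n by exists z, z; split=> //; right; exact: veq_refl.
by apply: vmem_l (veq_sym (same _ _ _ zn un)) _; exact: (inb _ _ _ _ i2 un).
Qed.

Lemma xrel_congr f g n m : veq f g -> xrel f n m -> xrel g n m.
Proof.
by move=> fg [u [v [H1 H2 H3]]]; exists u, v; split=> //; exact: vmem_r fg _.
Qed.

Lemma countable_enum M b : countable_in M b ->
  exists c : nat -> vset, forall x, vmem x b -> exists n, veq x (c n).
Proof.
case=> f [_ [dom tot fn inj]].
exists (fun n => if pselect (exists x, vmem (vpair x (vnum n)) f) is left e
                 then projT1 (cid e) else vempty).
move=> x xb; have [y xy] := tot x xb; have [x' [y' [_ /vmem_omega[n yn] e]]] := dom _ xy.
have [_ yy'] := vpair_inj e.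
have xn : vmem (vpair x (vnum n)) f.
  by apply: vmem_l xy; apply: vpair_congr (veq_refl _) _; exact: veq_trans yn.
exists n; case: pselect => [ex|]; last by case; exists x.
by case: (cid ex) => z /= zn; exact: inj xn zn.
Qed.

Lemma enum_countable b (c : nat -> vset) : (forall x, vmem x b -> exists n, veq x (c n)) ->
  countable_in [set: vset] b.
Proof.
move=> cP.
(* The index is minimal over all names [veq] to [x], so that it depends on the set and not on the
   name. *)
have H x : exists n, vmem x b -> veq x (c n) /\ forall y, veq x y ->
    forall m, veq y (c m) -> (n <= m)%N.
  have [xb|] := pselect (vmem x b); last by exists 0.
  have ex : exists n, `[< veq x (c n) >] by have [n H] := cP x xb; exists n; apply/asboolP.
  case: (ex_minnP ex) => n /asboolP xn mn; exists n => _; split=> // y xy m ym.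
  by apply: mn; apply/asboolP; exact: veq_trans ym.
pose code x := projT1 (cid (H x)).
have codeP x : vmem x b -> veq x (c (code x)) /\ forall y, veq x y ->
    forall m, veq y (c m) -> (code x <= m)%N by exact: (projT2 (cid (H x))).
have code_congr x y : vmem x b -> veq x y -> code x = code y.
  move=> xb xy; have yb := vmem_l xy xb; apply/eqP; rewrite eqn_leq.
  have [xc xm] := codeP x xb; have [yc ym] := codeP y yb.
  by rewrite (xm y xy _ yc) (ym x (veq_sym xy) _ xc).
exists (VSet (fun i : vidx b => vpair (velt i) (vnum (code (velt i))))); split=> //.
split.
- move=> p [i e]; exists (@velt b i), (vnum (code (@velt b i))); split; [exact: velt_mem| |exact: e].
  by apply/vmem_omega; eexists; exact: veq_refl.
- move=> x xb; have [i xi] := xb; exists (vnum (code (velt i))); exists i.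
  by apply: vpair_congr xi _; exact: veq_refl.
- move=> x y y' [i /vpair_inj[xi yi]] [j /vpair_inj[xj yj]].
  apply: veq_trans yi _; apply: veq_trans (veq_sym yj).
  rewrite (code_congr (@velt b i) (@velt b j)); [exact: veq_refl|exact: velt_mem|].
  exact: veq_trans (veq_sym xi) xj.
- move=> x x' y [i /vpair_inj[xi yi]] [j /vpair_inj[xj yj]].
  have ij : code (@velt b i) = code (@velt b j).
    by apply: vnum_inj; exact: veq_trans (veq_sym yi) yj.
  have [ic _] := codeP _ (@velt_mem b i); have [jc _] := codeP _ (@velt_mem b j).
  apply: veq_trans xi _; apply: veq_trans ic _; rewrite ij.
  by apply: veq_trans (veq_sym jc) _; exact: veq_sym.
Qed.

(** * The size of the set of constructible reals *)

Section Small.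
Variable A0 : set real.

(* [small S]: the cardinality of [S] is at most that of [A0] times [nat]. *)
Definition small (T : Type) (S : set T) : Prop :=
  exists f : real -> nat -> T, forall s, S s -> exists a n, A0 a /\ f a n = s.

Hypothesis A0_uncountable : ~ countable A0.

(** Injects w_1 into [A0] by recursion: a countable ordinal takes a point of [A0] not taken by any
    of its elements, which exists because [A0] is uncountable. *)
Fixpoint vrank (x : vset) : real :=
  match x with VSet T f => get (fun r => A0 r /\ forall i, vrank (f i) <> r) end.

Definition fresh (x : vset) : set real := [set r | A0 r /\ forall z, vmem z x -> vrank z <> r].

Lemma vrank_congr x y : veq x y -> vrank x = vrank y.
Proof.
elim: x y => T f IH [U g] [H1 H2] /=; congr get; apply/funext => r; apply/propext.
split=> -[Ar nr]; split=> // i.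
  by have [j /IH <-] := H2 i.
by have [j /IH ->] := H1 i.
Qed.

Lemma vrankE x : vrank x = get (fresh x).
Proof.
case: x => T f /=; congr get; apply/funext => r; apply/propext; split=> -[Ar nr]; split=> //.
  by move=> z [i /vrank_congr ->]; exact: nr.
by move=> i; apply: nr; exists i; exact: veq_refl.
Qed.

Lemma vrank_fresh x (c : nat -> vset) : (forall z, vmem z x -> exists n, veq z (c n)) ->
  fresh x (vrank x).
Proof.
move=> cP; rewrite vrankE; apply: getPex; apply: contrapT => /forallNP H.
apply: A0_uncountable; apply: (@sub_countable _ _ _ (range (vrank \o c))).
  apply: subset_card_le => r Ar; apply: contrapT => nr; apply: (H r); split=> // z /cP[n zn] e.
  by apply: nr; exists n => //=; rewrite -e; apply: esym; exact: vrank_congr.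
exact: sub_countable (card_image_le _ _) (countableP _).
Qed.

Variable k : vset.
Hypothesis kV : is_omega1 [set: vset] k.
Hypothesis kL : is_omega1 constructible k.

Lemma k_enum b : vmem b k -> exists c : nat -> vset, forall x, vmem x b -> exists n, veq x (c n).
Proof. by case: kV => _ _ _ /[apply]; exact: countable_enum. Qed.

Lemma vrank_inj b b' : vmem b k -> vmem b' k -> vrank b = vrank b' -> veq b b'.
Proof.
move=> bk bk' e; have [c cP] := k_enum bk; have [c' cP'] := k_enum bk'.
have [_ nb] := vrank_fresh cP; have [_ nb'] := vrank_fresh cP'.
have [_ ok _ _] := kV.
have [bb'|//|bb'] := vordinal_trich (vordinal_mem ok bk) (vordinal_mem ok bk').
  by case: (nb' b bb').
by case: (nb b' bb').
Qed.

(** Among the reals of L, those that code a relation [xrel f] with [f] in a countable level. By way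
    of [Theta] such a real is read off arithmetically from a code of the level. *)
Definition Lreals : set real := [set x | exists E L m N, [/\ code_ok E L, code_wf L, L N m &
  forall n, x n <-> exists i j, unpickle n = Some (i, j) /\ gsat E (L^~ m) (Theta i j) (fun=> N)]].

Definition xcode (f : vset) : real :=
  fun n => `[< exists i j, unpickle n = Some (i, j) /\ xrel f i j >].

Lemma xcodeP f i j : xcode f (pickle (i, j)) <-> xrel f i j.
Proof.
split; first by move/asboolP => [i' [j' []]]; rewrite pickleK => -[<- <-].
by move=> H; apply/asboolP; exists i, j; rewrite pickleK.
Qed.

Lemma xcode_congr f g : veq f g -> xcode f = xcode g.
Proof.
move=> fg; apply/funext => n; congr asbool; apply/propext.
by split=> -[i [j [e H]]]; exists i, j; split=> //; apply: xrel_congr H => //; exact: veq_sym.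
Qed.

Lemma Lreals_decode x : Lreals x -> exists b (v : nat -> vset) N, [/\ vmem b k,
  forall z, vmem z (Lstage b) -> exists n, veq z (v n), vmem (v N) (Lstage b) & x = xcode (v N)].
Proof.
case=> E [L [m [N [cE wL Nm H]]]].
have [v [b [ob [c cP] vP gP]]] := code_decode m cE wL.
have [vN gN] := gP N Nm.
exists b, v, N; split=> //; last first.
  apply/funext => n; apply/idP/idP => [/H[i [j [e]]]|/asboolP[i [j [e]]]].
    move=> /gN/(sat_Theta (Lstage_trans ob) _ _ vN) xij; apply/asboolP; by exists i, j.
  move=> /(sat_Theta (Lstage_trans ob) _ _ vN)/gN xij; apply/H; by exists i, j.
have [_ ok nc _] := kV; have [tk _] := ok.
have [//|bk|kb] := vordinal_trich ob ok; exfalso; apply: nc; apply: (enum_countable (c := c)).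
  by move=> z zk; apply: cP; exact: vmem_r (veq_sym bk) zk.
by move=> z zk; apply: cP; case: ob => tb _; exact: tb kb zk.
Qed.

(** A real of this kind is determined by an ordinal [b] below w_1, represented by the point
    [vrank b] of [A0], and an index in a fixed enumeration of the countable level at [b]. *)
Lemma small_Lreals : small Lreals.
Proof.
pose P a (v : nat -> vset) := exists b, [/\ vmem b k, vrank b = a &
  forall z, vmem z (Lstage b) -> exists n, veq z (v n)].
pose G a := if pselect (exists v, P a v) is left e then projT1 (cid e) else fun=> vempty.
have GP a v : P a v -> P a (G a).
  by rewrite /G; case: pselect => [e _|ne Pv]; [exact: (projT2 (cid e))|case: ne; exists v].
exists (fun a n => xcode (G a n)) => x /Lreals_decode[b [v [N [bk vP vN ->]]]].
have [c cP] := k_enum bk; have [Ab _] := vrank_fresh cP.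
have Pv : P (vrank b) v by exists b.
have [b' [bk' e vP']] := GP _ _ Pv.
have bb' := vrank_inj bk' bk e.
have [n nP] : exists n, veq (v N) (G (vrank b) n).
  by apply: vP'; apply: vmem_r vN; apply: Lstage_congr; exact: veq_sym.
by exists (vrank b), n; split=> //; apply: xcode_congr; exact: veq_sym.
Qed.

(** As w_1 is w_1 of L, some injection of [b] into omega is constructible, perhaps only at an
    uncountable stage; the hull of [code_encode] brings it into a countable code. *)
Lemma Lreals_encode b : vmem b k -> exists2 f, vinjection f b vomega & Lreals (xcode f).
Proof.
move=> bk; have [_ _ _ /(_ b bk)[f [[a [oa fa]] fb]]] := kL; exists f => //.
have [E [L [m [N [cE wL Nm H]]]]] := code_encode oa fa.
exists E, L, m, N; split=> // n; split=> [/asboolP[i [j [e]]]|[i [j [e]]]].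
  by move=> /(sat_Theta (Lstage_trans oa) _ _ fa)/H xij; exists i, j.
by move=> /H/(sat_Theta (Lstage_trans oa) _ _ fa) xij; apply/asboolP; exists i, j.
Qed.

(** By [xrel_inj] different ordinals below w_1 give different reals, so a countable set of reals
    would enumerate w_1. *)
Lemma Lreals_uncountable : ~ countable Lreals.
Proof.
move=> /countable_injP[t ti]; have [_ ok nc _] := kV; apply: nc.
pose P n b := vmem b k /\ exists f, [/\ vinjection f b vomega, Lreals (xcode f) & t (xcode f) = n].
pose c n := if pselect (exists b, P n b) is left e then projT1 (cid e) else vempty.
apply: (enum_countable (c := c)) => b bk.
have [f fb Lf] := Lreals_encode bk; exists (t (xcode f)).
rewrite /c; case: pselect => [e|]; last by case; exists b; split=> //; exists f.
case: (cid e) => b' /= [bk' [f' [fb' Lf' tt]]].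
apply: (xrel_inj _ _ fb fb'); try exact: vordinal_mem ok _.
have ff' : xcode f' = xcode f by apply: ti tt; exact: mem_set.
by move=> i j; rewrite -!xcodeP ff'.
Qed.

End Small.

(** * Martin's axiom and coanalytic sets *)

Definition Gdelta (a : set (seq bool)) : set real :=
  [set x | forall m, exists2 n, (m <= n)%N & a (mkseq x n)].

(** * Q-sets from Martin's axiom *)

Section Uniformize.
Variable A0 : set real.
Hypothesis A0_small : ~ small A0 [set: real].

Lemma small_sub T (S S' : set T) : S `<=` S' -> small A0 S' -> small A0 S.
Proof. by move=> SS [f H]; exists f => s /SS/H. Qed.

Lemma small_image T U (g : nat -> T -> U) (S : set T) : small A0 S ->
  small A0 [set u | exists n t, S t /\ g n t = u].
Proof.
case=> f H; exists (fun a n => let p := odflt (0, 0) (unpickle n) in g p.1 (f a p.2)).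
move=> u [n [t [/H[a [m [Aa <-]]] <-]]]; exists a, (pickle (n, m)); split=> //.
by rewrite pickleK.
Qed.

Definition sec (k : nat) (w : real) : real := fun i => w (pickle (k, i)).

Lemma card_small T (S : set T) : small A0 S -> card_lt S continuum.
Proof.
case=> f H; split.
  pose num (r : real) := if pselect (exists i, r i) is left e then ex_minn e else 0.
  apply: card_le_trans (card_image_le (fun r => f (sec 0 r) (num (sec 1 r))) [set: real]).
  apply: subset_card_le => s /H[a [n [_ <-]]].
  pose r : real := fun i => match unpickle i : option (nat * nat) with
    | Some (0, j) => a j | Some (_, j) => j == n | None => false end.
  exists r => //; have -> : sec 0 r = a by apply/funext => i; rewrite /sec /r pickleK.
  have -> : sec 1 r = eq_op^~ n by apply/funext => i; rewrite /sec /r pickleK.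
  congr f; rewrite /num; case: pselect => [e|]; last by case; exists n.
  by case: ex_minnP => m /eqP.
case/card_eqPle => _ /card_leP/unsquash h.
apply: A0_small.
pose hr (r : real) : set_type S := h (SigSub (mem_set (I : [set: real] r))).
have hi r r' : hr r = hr r' -> r = r'.
  move=> e; have := @inj _ _ _ h _ _ _ _ e; rewrite !inE => /(_ I I).
  by move/(congr1 (@set_val _ _)).
pose g t := if pselect (exists r, set_val (hr r) = t) is left e then projT1 (cid e) else fun=> false.
exists (fun a n => g (f a n)) => r _.
have /H[a [n [Aa fan]]] : S (set_val (hr r)) by exact: set_valP.
exists a, n; split=> //; rewrite fan /g; case: pselect => [e|]; last by case; exists r.
by case: (cid e) => r' /= /val_inj; exact: hi.
Qed.

Section QSet.
Hypothesis ma : MA.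
Variables S S' : set real.
Hypothesis sS : small A0 S.

(** Almost disjoint coding: a finite part of the set of nodes to be built, and finitely many reals.
    For those of the reals that lie outside [S'], an extension may add no further prefix. *)
Definition cond := (seq (seq bool) * seq real)%type.

Definition cond_le : rel cond := fun q p => `[< [/\ {subset p.1 <= q.1}, {subset p.2 <= q.2} &
  forall s x, s \in q.1 -> s \notin p.1 -> x \in p.2 -> ~ S' x -> mkseq x (size s) <> s] >].

Lemma cond_refl : reflexive cond_le.
Proof. by move=> p; apply/asboolP; split=> // s x sp; rewrite sp. Qed.

Lemma cond_trans : transitive cond_le.
Proof.
move=> q r p /asboolP[a b c] /asboolP[a' b' c']; apply/asboolP; split.
- by move=> s /a'/a.
- by move=> s /b'/b.
- move=> s x sr sp xp nx; have [sq|nsq] := boolP (s \in q.1); first exact: c'.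
  by apply: c => //; exact: b'.
Qed.

(** Conditions with the same nodes are compatible by joining their lists of reals, and there are
    only countably many lists of nodes. *)
Lemma cond_ccc : ccc cond_le.
Proof.
move=> A antiA; apply/countable_injP; exists (pickle \o fst) => p q /set_mem Ap /set_mem Aq /=.
move=> /(pcan_inj pickleK) e; apply: contrapT => npq; apply: (antiA p q Ap Aq npq).
exists (p.1, p.2 ++ q.2); split; apply/asboolP; split=> /= [s|x xp|s x sp nsp].
- by [].
- by rewrite mem_cat xp.
- by rewrite sp in nsp.
- by rewrite e.
- by rewrite mem_cat xp orbT.
- by rewrite -e sp in nsp.
Qed.

(** Index 0 makes the generic filter promise to stop adding prefixes of [x], when [x] is outside
    [S']; index [k.+1] asks for a prefix of length at least [k] and is shown dense for [x] in [S'].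
    One indexing by numbers lets [small_image] bound the whole family. *)
Definition cond_dense (x : real) (n : nat) : set cond :=
  if n is k.+1 then [set p | exists2 l, (k <= l)%N & mkseq x l \in p.1]
  else [set p | x \in p.2].

Lemma cond_dense_dense0 x : forcing_dense cond_le (cond_dense x 0).
Proof.
move=> p; exists (p.1, x :: p.2); split; first by rewrite /= inE eqxx.
apply/asboolP; split=> //= [y yp|s y sp]; first by rewrite inE yp orbT.
by rewrite sp.
Qed.

Lemma cond_dense_denseS x n : S' x -> forcing_dense cond_le (cond_dense x n.+1).
Proof.
move=> Sx p; pose F := seq.filter (fun z => ~~ `[< S' z >]) p.2.
have [N HN] : exists N, forall z, z \in F -> ~ agree N x z.
  by apply: avoid_seq; rewrite mem_filter negb_and negbK; apply/orP; left; apply/asboolP.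
exists (mkseq x (maxn n N) :: p.1, p.2); split.
  by exists (maxn n N); rewrite ?leq_maxl //= inE eqxx.
apply/asboolP; split=> //= [s sp|s z]; first by rewrite inE sp orbT.
rewrite inE => /predU1P[->|-> //] _ zp nz.
rewrite size_mkseq => e; apply: (HN z).
  by rewrite mem_filter zp andbT; apply/negP => /asboolP.
by apply: agree_le (leq_maxr n N) _; apply/agree_mkseq.
Qed.

Lemma MA_Qset : exists a : set (seq bool), forall x, S x -> (S' x <-> Gdelta a x).
Proof.
pose Fam := [set D | forcing_dense cond_le D /\ exists n x, S x /\ cond_dense x n = D].
have sF : small A0 Fam.
  apply: (@small_sub _ _ [set D | exists n x, S x /\ cond_dense x n = D]); first by move=> D [].
  exact: (@small_image _ _ (fun n x => cond_dense x n)).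
have FD D : Fam D -> forcing_dense cond_le D by case.
have [G [[[p0 Gp0] upG dirG] GD]] :=
  @ma cond cond_le (inhabits ([::], [::])) cond_refl cond_trans cond_ccc _ FD (card_small sF).
exists [set s | exists2 p, G p & s \in p.1] => x Sx; split.
  move=> S'x m; have [|p [Gp [l ml lp]]] := GD (cond_dense x m.+1).
    by split; [exact: cond_dense_denseS|exists m.+1, x].
  by exists l => //; exists p.
move=> H; apply: contrapT => nSx.
have [|p [Gp /= xp]] := GD (cond_dense x 0).
  by split; [exact: cond_dense_dense0|exists 0, x].
have [M HM] : exists M, forall s, s \in p.1 -> (size s < M)%N.
  elim: (p.1) => [|s ss [M IH]]; first by exists 0.
  exists (maxn (size s).+1 M) => t; rewrite inE => /predU1P[->|/IH lt]; first by rewrite leq_maxl.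
  by apply: leq_trans lt _; rewrite leq_maxr.
have [l Ml [q Gq lq]] := H M; have [r [Gr /asboolP[rp _ H1] /asboolP[rq _ _]]] := dirG _ _ Gp Gq.
have lr := rq _ lq; have [lp|nlp] := boolP (mkseq x l \in p.1).
  by have := HM _ lp; rewrite size_mkseq ltnNge Ml.
by have := H1 _ _ lr nlp xp nSx; rewrite size_mkseq.
Qed.

End QSet.
End Uniformize.

(** A diagonal argument in place of cardinal arithmetic: if for each [n] some real [z n] were missed
    by the [n]-th sections of the values at index [n], the real assembled from all [z n] would be no
    value at all. So some section maps [A0] itself onto the reals. *)
Lemma notCH_witness : ~ CH -> exists A0, ~ countable A0 /\ ~ small A0 [set: real].
Proof.
move=> /existsNP[A0 /not_orP[ncA neA]]; exists A0; split=> // -[f H]; apply: neA.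
have [n nP] : exists n, forall z, exists a, A0 a /\ sec n (f a n) = z.
  apply: contrapT => /forallNP Hn.
  have /choice[z zP] : forall n, exists z, ~ exists a, A0 a /\ sec n (f a n) = z.
    by move=> n; have /existsNP := Hn n.
  pose y : real := fun i => if unpickle i is Some (n, j) then z n j else false.
  have [a [n [Aa fan]]] := H y I; apply: (zP n); exists a; split=> //.
  by rewrite fan; apply/funext => j; rewrite /sec /y pickleK.
apply/card_eqPle; split; first exact: card_leT.
have /choice[g gP] := nP.
apply/pcard_leP/injfunPex; exists g; first by move=> z _; have [] := gP z.
by move=> z z' _ _ e; have [_ <-] := gP z; have [_ <-] := gP z'; rewrite e.
Qed.

(** * Analytic sets and their closure properties *)

Definition cont2 (F : real -> (nat -> nat) -> bool) : Prop :=
  forall x s, exists N, forall x' s', agree N x x' -> agree N s s' -> F x' s' = F x s.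

(** Projection of a closed set, presented as an intersection of clopen conditions. Closure
    properties are easier in this form than for continuous images, to which [sigma11_analytic]
    returns. *)
Definition sigma11 (A : set real) : Prop := exists F : nat -> real -> (nat -> nat) -> bool,
  (forall n, cont2 (F n)) /\ forall x, A x <-> exists s, forall n, F n x s.

Definition cont1 (g : real -> bool) : Prop := forall x, exists N, forall x', agree N x x' -> g x' = g x.

Lemma eq_sigma11 (A B : set real) : (forall x, A x <-> B x) -> sigma11 A -> sigma11 B.
Proof. by move=> AB [F [cF FP]]; exists F; split=> // x; rewrite -AB. Qed.

Lemma sigma11_cont1 g : cont1 g -> sigma11 [set x | g x].
Proof.
move=> cg; exists (fun _ x _ => g x); split.
  by move=> _ x s; have [N HN] := cg x; exists N => x' s' /HN.
by move=> x; split=> [gx|[s /(_ 0)]//]; exists (fun=> 0).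
Qed.

Lemma sigma11_bigcap (A : nat -> set real) : (forall k, sigma11 (A k)) -> sigma11 [set x | forall k, A k x].
Proof.
move=> /choice[F FP].
pose G n x s := if unpickle n is Some p then F p.1 p.2 x (fun i => s (pickle (p.1, i))) else true.
exists G; split.
  move=> n x s; rewrite /G; case: (unpickle n : option (nat * nat)) => [[k m] /=|]; last by exists 0.
  have [cF _] := FP k; have [N HN] := cF m x (fun i => s (pickle (k, i))).
  have [M NM HM] : exists2 M, (N <= M)%N & forall i, (i < N)%N -> (pickle (k, i) < M)%N.
    elim: {HN} N => [|N [M NM IH]]; first by exists 0.
    exists (maxn M (maxn N.+1 (pickle (k, N)).+1)); first by rewrite !leq_max leqnn orbT.
    move=> i; rewrite ltnS leq_eqVlt => /predU1P[->|/IH lt]; rewrite !leq_max ?leqnn ?orbT //.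
    by rewrite lt.
  exists M => x' s' xx' ss'; apply: HN; first exact: agree_le xx'.
  by move=> i /HM; exact: ss'.
move=> x; split=> [Ax|[s sP] k]; last first.
  have [_ ->] := FP k; exists (fun i => s (pickle (k, i))) => m.
  by have := sP (pickle (k, m)); rewrite /G pickleK.
have /choice[t tP] : forall k, exists t, forall n, F k n x t.
  by move=> k; have [_ <-] := FP k.
pose s n := if unpickle n is Some p then t p.1 p.2 else 0; exists s => n.
rewrite /G; case: (unpickle n : option (nat * nat)) => [[k m] /=|//].
have -> : (fun i => s (pickle (k, i))) = t k by apply/funext => i; rewrite /s pickleK.
exact: tP.
Qed.

Lemma sigma11_bigcup (A : nat -> set real) : (forall k, sigma11 (A k)) -> sigma11 [set x | exists k, A k x].
Proof.
move=> /choice[F FP]; exists (fun n x s => F (s 0) n x (fun i => s i.+1)); split.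
  move=> n x s; have [cF _] := FP (s 0); have [N HN] := cF n x (fun i => s i.+1).
  exists N.+1 => x' s' xx' ss'; rewrite -(ss' 0) //; apply: HN.
    exact: agree_le xx'.
  by move=> i lin; exact: (ss' i.+1).
move=> x; split=> [[k]|[s sP]].
  have [_ ->] := FP k; case=> s sP; by exists (fun i => if i is j.+1 then s j else k).
by exists (s 0); have [_ ->] := FP (s 0); exists (fun i => s i.+1).
Qed.

Lemma sigma11_and A B : sigma11 A -> sigma11 B -> sigma11 [set x | A x /\ B x].
Proof.
move=> aA aB; pose G k := if k is 0 then A else B.
apply: (@eq_sigma11 [set x | forall k, G k x]).
  by move=> x; split=> [H|[a b] [|k]//]; split; [exact: (H 0)|exact: (H 1)].
by apply: sigma11_bigcap => -[].
Qed.

Lemma sigma11_or A B : sigma11 A -> sigma11 B -> sigma11 [set x | A x \/ B x].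
Proof.
move=> aA aB; pose G k := if k is 0 then A else B.
apply: (@eq_sigma11 [set x | exists k, G k x]).
  by move=> x; split=> [[[|k]]|[]]; [left|right|exists 0|exists 1].
by apply: sigma11_bigcup => -[].
Qed.

Lemma sigma11_not_and A B : sigma11 (~` A) -> sigma11 (~` B) -> sigma11 (~` [set x | A x /\ B x]).
Proof. by move=> aA aB; apply: eq_sigma11 (sigma11_or aA aB) => x; rewrite /setC /= not_andE. Qed.

Definition cont_map (h : real -> real) : Prop :=
  forall x n, exists N, forall x', agree N x x' -> agree n (h x) (h x').

Lemma sigma11_preim h A : cont_map h -> sigma11 A -> sigma11 [set x | A (h x)].
Proof.
move=> ch [F [cF FP]]; exists (fun n x s => F n (h x) s); split; last by move=> x; exact: FP.
move=> n x s; have [N HN] := cF n (h x) s; have [M HM] := ch x N.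
exists (maxn N M) => x' s' xx' ss'; apply: HN.
  by apply: HM; apply: agree_le xx'; rewrite leq_maxr.
by apply: agree_le ss'; rewrite leq_maxl.
Qed.

(** Takes the place of the Borel sets: it contains the clopen sets and is stable under negation and
    quantifiers over countable types, hence under arithmetical definitions. *)
Definition delta11 (A : set real) : Prop := sigma11 A /\ sigma11 (~` A).

Lemma eq_delta11 (A B : set real) : (forall x, A x <-> B x) -> delta11 A -> delta11 B.
Proof.
by move=> AB [a b]; split; [apply: eq_sigma11 a|apply: eq_sigma11 b => x /=; rewrite AB].
Qed.

Lemma delta11_not A : delta11 A -> delta11 [set x | ~ A x].
Proof. by case=> a b; split=> //; apply: eq_sigma11 a => x /=; rewrite not_notE. Qed.

Lemma delta11_cont1 g : cont1 g -> delta11 [set x | g x].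
Proof.
move=> cg; split; first exact: sigma11_cont1.
have cg' : cont1 (fun x => ~~ g x) by move=> x; have [N HN] := cg x; exists N => x' /HN ->.
by apply: eq_sigma11 (sigma11_cont1 cg') => x /=; split=> /negP.
Qed.

Lemma delta11_forall_nat (A : nat -> set real) : (forall k, delta11 (A k)) -> delta11 [set x | forall k, A k x].
Proof.
move=> bA; split; first by apply: sigma11_bigcap => k; case: (bA k).
apply: eq_sigma11 (sigma11_bigcup (fun k => (bA k).2)) => x /=.
by rewrite -existsNE.
Qed.

Lemma delta11_const (P : Prop) : delta11 [set x | P].
Proof.
apply: (eq_delta11 (A := [set x | `[< P >]])); first by move=> x /=; split=> /asboolP.
by apply: delta11_cont1 => x; exists 0.
Qed.

Lemma delta11_forall (K : countType) (A : K -> set real) :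
  (forall k, delta11 (A k)) -> delta11 [set x | forall k, A k x].
Proof.
move=> bA; pose B n := [set x | if unpickle n is Some k then A k x else True].
apply: (@eq_delta11 [set x | forall n, B n x]).
  move=> x; split=> H k; first by have := H (pickle k); rewrite /B /= pickleK.
  by rewrite /B /=; case: unpickle => // l; exact: H.
apply: delta11_forall_nat => n; rewrite /B; case: unpickle => [k|]; first exact: bA.
exact: delta11_const.
Qed.

Lemma delta11_exists (K : countType) (A : K -> set real) :
  (forall k, delta11 (A k)) -> delta11 [set x | exists k, A k x].
Proof.
move=> bA; apply: (@eq_delta11 [set x | ~ forall k, ~ A k x]).
  by move=> x /=; rewrite -existsNE; split=> -[k]; [rewrite not_notE|move=> Ak]; exists k; rewrite ?not_notE.
by apply: delta11_not; apply: delta11_forall => k; exact: delta11_not.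
Qed.

Lemma delta11_and A B : delta11 A -> delta11 B -> delta11 [set x | A x /\ B x].
Proof.
move=> bA bB; apply: (@eq_delta11 [set x | forall b : bool, (if b then A else B) x]).
  by move=> x; split=> [H|[a b] []//]; split; [exact: (H true)|exact: (H false)].
by apply: delta11_forall => -[].
Qed.

Lemma delta11_imp A B : delta11 A -> delta11 B -> delta11 [set x | A x -> B x].
Proof.
move=> bA bB; apply: (@eq_delta11 [set x | ~ (A x /\ ~ B x)]).
  move=> x /=; split=> [H a|H [a b]]; last exact: b (H a).
  by apply: contrapT => b; exact: H.
apply: delta11_not; apply: delta11_and => //; exact: delta11_not.
Qed.

Lemma delta11_iff A B : delta11 A -> delta11 B -> delta11 [set x | A x <-> B x].
Proof. by move=> bA bB; apply: delta11_and; apply: delta11_imp. Qed.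

Lemma delta11_bit n : delta11 [set x : real | x n].
Proof. by apply: delta11_cont1 => x; exists n.+1 => x' /(_ n (ltnSn n)). Qed.

Lemma delta11_preim h A : cont_map h -> delta11 A -> delta11 [set x | A (h x)].
Proof. by move=> ch [a b]; split; [exact: sigma11_preim a|exact: sigma11_preim b]. Qed.

Lemma delta11_Gdelta a : delta11 (Gdelta a).
Proof.
apply: delta11_forall => m; apply: (@eq_delta11 [set x | exists n, (m <= n)%N /\ `[< a (mkseq x n) >]]).
  by move=> x; split=> [[n [mn /asboolP]]|[n mn /asboolP]]; exists n.
apply: delta11_exists => n; apply: delta11_and; first exact: delta11_const.
by apply: delta11_cont1 => x; exists n => x' /agree_mkseq ->.
Qed.

(** A nonempty closed subset [Cl] of the Baire space is a retract of it: [r] fixes [Cl] and sends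
    any other [t] to a chosen point of [Cl] sharing with [t] the longest prefix that extends into
    [Cl]. *)
Lemma sigma11_analytic (A : set real) : sigma11 A -> analytic (A : set cantor_space).
Proof.
case=> F [cF FP].
have [[x0 Ax0]|nA] := pselect (exists x, A x); last first.
  by left; apply/seteqP; split=> // x Ax; apply: nA; exists x.
right.
(* Even coordinates carry the real, with 0 standing for [true], and odd coordinates carry the
   witness. *)
pose X (t : nat -> nat) : real := fun i => t i.*2 == 0.
pose S (t : nat -> nat) := fun i => t i.*2.+1.
pose Cl t := forall n, F n (X t) (S t).
have agX n t t' : agree n.*2 t t' -> agree n (X t) (X t').
  by move=> tt' i lin; rewrite /X tt' // ltn_double.
have agreeS' n t t' : agree n.*2 t t' -> agree n (S t) (S t').
  by move=> tt' i lin; rewrite /S tt' // ltn_Sdouble.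
have Cl_closed t : (forall n, exists2 t', Cl t' & agree n t t') -> Cl t.
  move=> H n; have [N HN] := cF n (X t) (S t); have [t' Ct' tt'] := H N.*2.
  by rewrite -(HN (X t') (S t')) //; [exact: agX|exact: agreeS'].
have CX x : A x -> exists2 t, Cl t & X t = x.
  move=> /FP[s sP]; pose t i := if odd i then s i./2 else if x i./2 then 0 else 1.
  have Xt : X t = x.
    by apply/funext => i; rewrite /X /t odd_double doubleK; case: (x i).
  have St : S t = s by apply/funext => i; rewrite /S /t /= odd_double /= uphalf_double.
  by exists t => // n; rewrite Xt St.
have [t0 Ct0 _] := CX x0 Ax0.
pose p (t : nat -> nat) n : nat -> nat := if pselect (exists t', Cl t' /\ agree n t t') is left e
  then projT1 (cid e) else t0.
have pC t n : Cl (p t n) by rewrite /p; case: pselect => // e; case: (cid e) => ? [].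
have p_agree t n : (exists t', Cl t' /\ agree n t t') -> agree n t (p t n).
  by rewrite /p; case: pselect => // e _; case: (cid e) => ? [].
(* The choice is made from a predicate that depends on the prefix only; continuity of [r] rests on
   this. *)
have p_cong t t' n : agree n t t' -> p t n = p t' n.
  move=> tt'; rewrite /p; have E : (fun u => Cl u /\ agree n t u) = (fun u => Cl u /\ agree n t' u).
    apply/funext => u; apply/propext; split=> -[Cu tu]; split=> //.
      by apply: agree_trans tu; exact: agree_sym.
    exact: agree_trans tt' tu.
  by rewrite E.
pose bad t n := ~ exists t', Cl t' /\ agree n.+1 t t'.
pose r t : nat -> nat := if pselect (exists n, `[< bad t n >]) is left e then p t (ex_minn e) else t.
have rC t : Cl (r t).
  rewrite /r; case: pselect => [e|ne]; first exact: pC.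
  apply: Cl_closed => -[|n]; first by exists t0.
  apply: contrapT => H; apply: ne; exists n; apply/asboolP => -[t' [Ct' tt']].
  by apply: H; exists t'.
have r_id t : Cl t -> r t = t.
  move=> Ct; rewrite /r; case: pselect => // e; exfalso.
  by case: e => n /asboolP; apply; exists t.
have bad_agree t t' n : agree n.+1 t t' -> bad t n -> bad t' n.
  by move=> tt' bt [u [Cu tu]]; apply: bt; exists u; split=> //; exact: agree_trans tu.
have r_agree n t : (forall i, (i < n)%N -> ~ bad t i) -> agree n t (r t).
  move=> nb; rewrite /r; case: pselect => [e|//]; case: ex_minnP => m /asboolP bm mm.
  have nm : (n <= m)%N by rewrite leqNgt; apply/negP => /nb.
  apply: agree_le nm _; apply: p_agree; case: m bm mm => [|m] bm mm; first by exists t0.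
  apply: contrapT => H; have : (m.+1 <= m)%N by apply: mm; apply/asboolP.
  by rewrite ltnn.
have rcont t n : exists N, forall t', agree N t t' -> agree n (r t) (r t').
  have [[b bb]|nb] := pselect (exists n, bad t n); last first.
    exists n => t' tt'; have tr : agree n t (r t) by apply: r_agree => i _ bi; apply: nb; exists i.
    apply: agree_trans (agree_sym tr) _; apply: (agree_trans tt'); apply: r_agree => i lin bi.
    by apply: nb; exists i; apply: bad_agree bi; apply: agree_sym; exact: agree_le tt'.
  have e : exists n, `[< bad t n >] by exists b; apply/asboolP.
  case: (ex_minnP e) => m /asboolP bm mm; exists m.+1 => t' tt'.
  have mE u : agree m.+1 t u -> r u = p u m.
    move=> tu; rewrite /r; case: pselect => [e'|]; last first.
      by case; exists m; apply/asboolP; exact: bad_agree bm.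
    case: ex_minnP => m' /asboolP bm' mm'; congr p; apply/eqP; rewrite eqn_leq.
    have m'm : (m' <= m)%N by apply: mm'; apply/asboolP; exact: bad_agree bm.
    rewrite m'm mm //; apply/asboolP; apply: bad_agree bm'; apply: agree_sym.
    exact: agree_le tu.
  rewrite (mE t) // (mE t') // (p_cong t t' m) //; exact: agree_le tt'.
exists (fun t => X (r t)); split.
  move=> t U /prod_nbhsP[n HU]; apply/prod_nbhsP.
  have [N HN] := rcont t n.*2; exists N => t' tt'; apply: HU.
  by apply: agX; exact: HN.
apply/seteqP; split=> [_ [t _ <-]|x /CX[t Ct Xt]]; last by exists t => //; rewrite r_id.
by apply/FP; exists (S (r t)); exact: rC.
Qed.

Lemma delta11_exists_formula (A : formula -> set real) :
  (forall phi, delta11 (A phi)) -> delta11 [set x | exists phi, A phi x].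
Proof.
move=> bA; have [dec decP] := formula_enum.
apply: (@eq_delta11 [set x | exists n, A (dec n) x]).
  move=> x; split=> [[n An]|[phi Ap]]; first by exists (dec n).
  by have [n e] := decP phi; exists n; rewrite e.
by apply: delta11_exists => n; exact: bA.
Qed.

Lemma delta11_forall_formula (A : formula -> set real) :
  (forall phi, delta11 (A phi)) -> delta11 [set x | forall phi, A phi x].
Proof.
move=> bA; have [dec decP] := formula_enum.
apply: (@eq_delta11 [set x | forall n, A (dec n) x]).
  move=> x; split=> H => [phi|n]; last exact: H.
  by have [n <-] := decP phi.
by apply: delta11_forall => n; exact: bA.
Qed.

(** * Complexity of the set of codes *)

Definition code_mem (w : real) (i j : nat) : Prop := sec 1 w (pickle (i, j)).
Definition code_low (w : real) (i j : nat) : Prop := sec 2 w (pickle (i, j)).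

Lemma delta11_code_mem i j : delta11 [set w | code_mem w i j]. Proof. exact: delta11_bit. Qed.
Lemma delta11_code_low i j : delta11 [set w | code_low w i j]. Proof. exact: delta11_bit. Qed.

Lemma delta11_extE u v : delta11 [set w | extE (code_mem w) u v].
Proof. by apply: delta11_forall => k; apply: delta11_iff; exact: delta11_code_mem. Qed.

Lemma delta11_gsat phi m e : delta11 [set w | gsat (code_mem w) ((code_low w)^~ m) phi e].
Proof.
elim: phi e => [i j|i j|phi IH|phi IH1 psi IH2|phi IH] e /=.
- exact: delta11_code_mem.
- exact: delta11_extE.
- exact: delta11_not (IH e).
- exact: delta11_and (IH1 e) (IH2 e).
- by apply: delta11_exists => z; exact: delta11_and (delta11_code_low z m) (IH _).
Qed.

Lemma delta11_Forall m ps : delta11 [set w | Forall ((code_low w)^~ m) ps].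
Proof.
elim: ps => [|p ps IH] /=; first exact: delta11_const.
by apply: delta11_and => //; exact: delta11_code_low.
Qed.

Lemma delta11_code_elem m phi ps u : delta11 [set w | code_elem (code_mem w) (code_low w) m phi ps u].
Proof.
apply: (@eq_delta11 [set w | exists u', code_low w u' m /\ (extE (code_mem w) u u' /\
   gsat (code_mem w) ((code_low w)^~ m) phi (penv u' ps))]).
  by move=> w; split=> [[u' [a [b c]]]|[u' [a b c]]]; exists u'.
apply: delta11_exists => u'; apply: delta11_and; first exact: delta11_code_low.
by apply: delta11_and; [exact: delta11_extE|exact: delta11_gsat].
Qed.

Lemma delta11_code_ok : delta11 [set w | code_ok (code_mem w) (code_low w)].
Proof.
apply: (@eq_delta11 [set w |
  (forall i j k, code_low w i j -> code_low w j k -> code_low w i k) /\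
  ((forall m, exists phi ps, Forall ((code_low w)^~ m) ps /\
      forall u, code_mem w u m <-> code_elem (code_mem w) (code_low w) m phi ps u) /\
   (forall m phi ps, Forall ((code_low w)^~ m) ps -> exists m',
        (forall n, code_low w m n -> code_low w m' n) /\
        forall u, code_mem w u m' <-> code_elem (code_mem w) (code_low w) m phi ps u))]).
  by move=> w; split=> [[a [b c]]|[a b c]].
apply: delta11_and; last apply: delta11_and.
- do 3!apply: delta11_forall => ?; do 2?apply: delta11_imp; exact: delta11_code_low.
- apply: delta11_forall => m; apply: delta11_exists_formula => phi; apply: delta11_exists => ps.
  apply: delta11_and; first exact: delta11_Forall.
  by apply: delta11_forall => u; apply: delta11_iff; [exact: delta11_code_mem|exact: delta11_code_elem].
- apply: delta11_forall => m; apply: delta11_forall_formula => phi; apply: delta11_forall => ps.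
  apply: delta11_imp; first exact: delta11_Forall.
  apply: delta11_exists => m'; apply: delta11_and.
    by apply: delta11_forall => n; apply: delta11_imp; exact: delta11_code_low.
  by apply: delta11_forall => u; apply: delta11_iff; [exact: delta11_code_mem|exact: delta11_code_elem].
Qed.

Lemma sigma11_not_wf : sigma11 [set w | ~ code_wf (code_low w)].
Proof.
exists (fun n w s => sec 2 w (pickle (s n.+1, s n))); split; last first.
  move=> w; rewrite /= /code_wf not_notE; by [].
move=> n w s; exists (maxn n.+2 (pickle (2, pickle (s n.+1, s n))).+1) => w' s' ww' ss'.
rewrite /sec -(ss' n) ?leq_max ?leqnSn // -(ss' n.+1) ?leq_max ?leqnn //.
by rewrite -ww' // leq_max leqnn orbT.
Qed.

Definition Lcodes : set real := [set w | (code_ok (code_mem w) (code_low w) /\ exists m N, code_low w N m /\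
  forall n, sec 0 w n <-> exists i j, unpickle n = Some (i, j) /\
    gsat (code_mem w) ((code_low w)^~ m) (Theta i j) (fun=> N)) /\ code_wf (code_low w)].

Lemma sigma11_not_Lcodes : sigma11 (~` Lcodes).
Proof.
have B : delta11 [set w | code_ok (code_mem w) (code_low w) /\ exists m N, code_low w N m /\
  forall n, sec 0 w n <-> exists i j, unpickle n = Some (i, j) /\
    gsat (code_mem w) ((code_low w)^~ m) (Theta i j) (fun=> N)].
  apply: delta11_and; first exact: delta11_code_ok.
  apply: delta11_exists => m; apply: delta11_exists => N; apply: delta11_and; first exact: delta11_code_low.
  apply: delta11_forall => n; apply: delta11_iff; first exact: delta11_bit.
  apply: delta11_exists => i; apply: delta11_exists => j; apply: delta11_and; first exact: delta11_const.
  exact: delta11_gsat.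
have [_ aB] := B.
by apply: (sigma11_not_and aB); exact: sigma11_not_wf.
Qed.

Lemma Lreals_sec x : Lreals x <-> exists2 w, Lcodes w & sec 0 w = x.
Proof.
split; last first.
  case=> w [[c [m [N [Nm H]]]] wf] <-; by exists (code_mem w), (code_low w), m, N.
case=> E [L [m [N [c wf Nm H]]]].
pose w : real := fun n => match unpickle n : option (nat * nat) with
  | Some (0, i) => x i
  | Some (1, i) => if unpickle i is Some p then `[< E p.1 p.2 >] else false
  | Some (_, i) => if unpickle i is Some p then `[< L p.1 p.2 >] else false
  | None => false end.
have w0 : sec 0 w = x by apply/funext => i; rewrite /sec /w pickleK.
have wE : code_mem w = E.
  apply/funext => i; apply/funext => j; apply/propext; rewrite /code_mem /sec /w !pickleK /=.
  by split=> /asboolP.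
have wL : code_low w = L.
  apply/funext => i; apply/funext => j; apply/propext; rewrite /code_low /sec /w !pickleK /=.
  by split=> /asboolP.
exists w => //; rewrite /Lcodes /= wE wL w0; split=> //; split=> //; by exists m, N.
Qed.

Lemma eqfin_closure_seq (W : set real) y :
  eqfin_closure W y <-> exists s : seq bool, W (ccat (size s) (nth false s) y).
Proof.
split=> [[w Ww /eqfin_sym/eqfin_ccat[s wE]]|[s Ws]]; first by exists s; rewrite -wE.
by exists (ccat (size s) (nth false s) y) => //; apply: eqfin_sym; exact: ccat_eqfin.
Qed.

Lemma cont_map_ccat (s : seq bool) : cont_map (ccat (size s) (nth false s)).
Proof.
move=> x n; exists n => x' xx' i lin; rewrite /ccat; case: ifP => // _; exact: xx'.
Qed.

(* Under MA, a choice of codes for the constructible reals is the restriction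
   of a Borel function; its graph is the required coanalytic set. *)
Lemma coanalytic_tail_lambda : MA -> ~ CH -> omega1_eq_omega1L ->
  exists Y, tail_lambda Y /\ sigma11 (~` Y).
Proof.
move=> ma /notCH_witness[A0 [A0u A0s]] [k [kV kL]].
have smL := small_Lreals A0u kV.
have ncL := Lreals_uncountable kV kL.
have /choice[c cP] : forall x, exists w, Lreals x -> Lcodes w /\ sec 0 w = x.
  move=> x; have [/Lreals_sec[w]|] := pselect (Lreals x); last by exists x.
  by exists w.
have /choice[a aP] : forall n, exists a, forall x, Lreals x -> (c x n <-> Gdelta a x).
  by move=> n; exact: (MA_Qset A0s ma (fun x => c x n : Prop) smL).
(* This is the range of [c] on [Lreals]: section 0 of [c x] is [x], and the sets [a n] recover every
   bit of [c x] from that section. *)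
pose W := [set w | Lcodes w /\ forall n, w n <-> Gdelta (a n) (sec 0 w)].
have Wc w : W w <-> exists2 x, Lreals x & c x = w.
  split=> [[Lw wP]|[x Lx <-]].
    have Lx : Lreals (sec 0 w) by apply/Lreals_sec; exists w.
    exists (sec 0 w) => //; apply/funext => n; apply/idP/idP.
      by move/aP => /(_ Lx)/wP.
    by move/wP => /aP; apply.
  have [Lc cx] := cP x Lx; split=> // n; rewrite cx; exact: aP.
have aW : sigma11 (~` W).
  have B : delta11 [set w : real | forall n, w n <-> Gdelta (a n) (sec 0 w)].
    apply: delta11_forall => n; apply: delta11_iff; first exact: delta11_bit.
    apply: (delta11_preim (h := sec 0)); last exact: delta11_Gdelta.
    move=> x m; elim: m => [|m [N HN]]; first by exists 0.
    exists (maxn N (pickle (0, m)).+1) => x' xx'.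
    apply: agreeS; first by apply: HN; apply: agree_le xx'; rewrite leq_maxl.
    by rewrite /sec xx' // leq_max leqnn orbT.
  have [_ aB] := B.
  by apply: (sigma11_not_and _ aB); exact: sigma11_not_Lcodes.
exists (eqfin_closure W); split; last first.
  pose A n := [set y | if (unpickle n : option (seq bool)) is Some s then
    ~ W (ccat (size (s : seq bool)) (nth false s) y) else True].
  apply: (@eq_sigma11 [set y | forall n, A n y]).
    move=> y /=; rewrite eqfin_closure_seq -forallNE; split=> H s.
      by have := H (pickle s); rewrite /A pickleK.
    by rewrite /A /=; case: unpickle => // t; exact: H.
  apply: sigma11_bigcap => n; rewrite /A; case: unpickle => [s|]; last by case: (delta11_const True).
  exact: (sigma11_preim (@cont_map_ccat s) aW).
split.
- by move=> x y xy; exact: eqfin_closureP.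
- have smW : small A0 W.
    apply: (@small_sub _ _ _ [set w | exists (n : nat) x, Lreals x /\ c x = w]).
      by move=> w /Wc[x Lx <-]; exists 0, x.
    exact: (@small_image A0 _ _ (fun=> c)).
  have smY : small A0 (eqfin_closure W).
    pose g n (w : real) := if (unpickle n : option (seq bool)) is Some s then ccat (size s) (nth false s) w else w.
    apply: (@small_sub _ _ _ [set y | exists n w, W w /\ g n w = y]).
      by move=> y [w Ww /eqfin_ccat[s ->]]; exists (pickle s), w; rewrite /g pickleK.
    exact: (@small_image A0 _ _ g).
  move=> A _ _; exact: (MA_Qset A0s ma A smY).
- move=> cY; apply: ncL.
  have cW : countable W.
    by apply: sub_countable cY; apply: subset_card_le => w Ww; exists w => //; exact: eqfinxx.
  apply: (@sub_countable _ _ _ (sec 0 @` W)); last exact: sub_countable (card_image_le _ _) cW.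
  apply: subset_card_le => x Lx; have [_ e] := cP x Lx; exists (c x) => //.
  by apply/Wc; exists x.
Qed.

Lemma coanalytic_sum_space Y : sigma11 (~` Y) -> coanalytic_space (sum_space Y).
Proof.
move=> aY; exists (sum_set Y); split; last first.
  by exists id; split; [move=> x; exact: cvg_id|exists id; split=> // x; exact: cvg_id].
apply: sigma11_analytic; have aC : sigma11 [set x : real | ~ x 0 /\ ~ Y (btail x)].
  have [a0 _] := delta11_not (delta11_bit 0).
  have a1 : sigma11 [set x | ~ Y (btail x)].
    apply: (sigma11_preim (h := btail) _ aY) => x n; exists n.+1 => x' xx'; exact: agree_btail.
  exact: sigma11_and a0 a1.
by apply: eq_sigma11 aC => x; rewrite /sum_set /= not_orE.
Qed.

(** * A lambda-set in ZFC *)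

Lemma wo_lt (T : eqType) : exists lt : T -> T -> Prop,
  well_founded lt /\ forall x y, [\/ lt x y, x = y | lt y x].
Proof.
have [R woR] := well_ordering_principle T.
have minP (P : T -> Prop) x : P x -> exists z, P z /\ forall y, P y -> R z y.
  move=> Px; have [|z [[Pz lz] _]] := woR (fun y => `[< P y >]).
    by exists x; apply/asboolP.
  by exists z; split; [exact/asboolP|move=> y Py; apply: lz; apply/asboolP].
have anti x y : R x y -> R y x -> x = y.
  move=> xy yx; have [|z [_ uz]] := woR (pred2 x y); first by exists x; rewrite inE eqxx.
  have Rxx : R x x by have [z' [e H]] := minP (eq x) x erefl; rewrite -e in H; exact: H.
  have Ryy : R y y by have [z' [e H]] := minP (eq y) y erefl; rewrite -e in H; exact: H.
  have zx : z = x by apply: uz; split; [rewrite inE eqxx|move=> u; rewrite inE => /orP[] /eqP ->].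
  have zy : z = y by apply: uz; split; [rewrite inE eqxx orbT|move=> u; rewrite inE => /orP[] /eqP ->].
  by rewrite -zx zy.
exists (fun x y => R x y /\ x <> y); split.
  move=> m; apply: contrapT => nm; have [z [nz zm]] := minP (fun x => ~ Acc (fun x y : T => R x y /\ x <> y) x) m nm.
  apply: nz; constructor => y [yz ne]; apply: contrapT => ny.
  by apply: ne; apply: anti => //; exact: zm.
move=> x y; have [->|ne] := pselect (x = y); first exact: Or32.
have [z [[->|->] zm]] := minP (fun z => z = x \/ z = y) x (or_introl erefl).
  by apply: Or31; split=> //; apply: zm; right.
by apply: Or33; split; [apply: zm; left|move/esym].
Qed.

Definition lefin (f g : nat -> nat) : Prop := exists N, forall n, (N <= n)%N -> (f n <= g n)%N.

Lemma lefin_refl f : lefin f f. Proof. by exists 0. Qed.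

Lemma lefin_trans g f h : lefin f g -> lefin g h -> lefin f h.
Proof.
case=> N fg [M gh]; exists (maxn N M) => n; rewrite geq_max => /andP[Nn Mn].
exact: leq_trans (fg n Nn) (gh n Mn).
Qed.

(** Says that the cardinality of [I] is less than the bounding number. *)
Definition bounded (T : Type) (I : set T) : Prop :=
  forall F : T -> nat -> nat, exists g, forall i, I i -> lefin (F i) g.

Lemma lefin_countable (F : nat -> nat -> nat) : exists g, forall i, lefin (F i) g.
Proof.
exists (fun n => \max_(i < n.+1) F i n) => i; exists i => n lin.
exact: (@leq_bigmax _ (fun i : 'I_n.+1 => F i n) (Ordinal (lin : (i < n.+1)%N))).
Qed.

(** [J] is a least segment of a well-order of all functions that carries an unbounded family [F].
    Proper segments being bounded, recursion can choose [f j] above all earlier [f i] and above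
    [F j]. *)
Lemma scale_exists : exists (T : Type) (J : set T) (lt : T -> T -> Prop) (f : T -> nat -> nat),
  [/\ forall x y, [\/ lt x y, x = y | lt y x],
      forall j, J j -> bounded (lt^~ j),
      forall i j, J j -> lt i j -> lefin (f i) (f j) &
      forall g, exists2 j, J j & ~ lefin (f j) g].
Proof.
have [lt [wlt tlt]] := wo_lt (nat -> nat).
have nT : ~ bounded [set: nat -> nat].
  move=> /(_ id)[g /(_ (fun n => (g n).+1) I)[N /(_ N (leqnn N))]].
  by rewrite ltnn.
have [J [nJ JP]] : exists J : set (nat -> nat), ~ bounded J /\ forall j, J j -> bounded (lt^~ j).
  have [[t nt]|all_b] := pselect (exists t, ~ bounded (lt^~ t)); last first.
    exists setT; split=> // j _; apply: contrapT => nj; apply: all_b; by exists j.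
  elim/(well_founded_ind wlt): t nt => t IH nt.
  have [[s [st ns]]|H] := pselect (exists s, lt s t /\ ~ bounded (lt^~ s)); first exact: IH st ns.
  by exists (lt^~ t); split=> // j jt; apply: contrapT => nj; apply: H; exists j.
have /existsNP[F FP] := nJ.
pose B j (f : (nat -> nat) -> nat -> nat) : nat -> nat :=
  if pselect (exists g, (forall i, lt i j -> lefin (f i) g) /\ lefin (F j) g) is left e
  then projT1 (cid e) else fun=> 0.
have [f fE] : exists f, forall j, f j = B j f.
  apply: (wf_rec (fun=> 0) wlt) => j g g' gg'; rewrite /B.
  have -> // : (fun h => (forall i, lt i j -> lefin (g i) h) /\ lefin (F j) h) =
          (fun h => (forall i, lt i j -> lefin (g' i) h) /\ lefin (F j) h).
  apply/funext => h; apply/propext; split=> -[H1 H2]; split=> // i ij.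
    by rewrite -gg' //; exact: H1.
  by rewrite gg' //; exact: H1.
have fP j : J j -> (forall i, lt i j -> lefin (f i) (f j)) /\ lefin (F j) (f j).
  move=> Jj; rewrite (fE j) /B; case: pselect => [e|]; first exact: (projT2 (cid e)).
  case; have [g gP] := JP j Jj f; exists (fun n => maxn (g n) (F j n)); split.
    move=> i ij; have [N H] := gP i ij; exists N => n /H le.
    by rewrite leq_max le.
  by exists 0 => n _; rewrite leq_max leqnn orbT.
exists (nat -> nat), J, lt, f; split=> //.
  by move=> i j /fP[+ _]; apply.
move=> g; apply: contrapT => H; apply: FP; exists g => j Jj.
apply: lefin_trans (fP j Jj).2 _; apply: contrapT => nl; apply: H; by exists j.
Qed.

Definition graph (f : nat -> nat) : real := fun n =>
  if (unpickle n : option (nat * nat)) is Some p then p.2 == f p.1 else false.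

Lemma graphE f n k : graph f (pickle (n, k)) = (k == f n).
Proof. by rewrite /graph pickleK. Qed.

Lemma graph_inj : injective graph.
Proof.
move=> f g fg; apply/funext => n; apply/eqP.
by have := graphE g n (f n); rewrite -fg graphE eqxx => <-.
Qed.

(** A set closed under finite changes that contains [graph g] exactly when [f] is not eventually
    below [g]; it extends this comparison from graphs to all their finite modifications. *)
Definition below (f : nat -> nat) : set real :=
  [set x | forall m, exists n, (m <= n)%N /\ exists2 k, (k < f n)%N & x (pickle (n, k))].

Lemma pickle_large N : exists M, forall n k : nat, (M <= n)%N -> (N <= pickle (n, k))%N.
Proof.
elim: N => [|N [M IH]]; first by exists 0.
exists (maxn M (if (unpickle N : option (nat * nat)) is Some p then p.1.+1 else 0)) => n k.
rewrite geq_max => /andP[Mn le2]; have le1 := IH n k Mn; rewrite ltn_neqAle le1 andbT.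
by apply/eqP => e; move: le2; rewrite e pickleK /= ltnn.
Qed.

Lemma below_eqfin f x y : eqfin x y -> below f x -> below f y.
Proof.
case=> N xy xf m; have [M HM] := pickle_large N.
have [n [mn [k kf xnk]]] := xf (maxn m M); rewrite geq_max in mn.
case/andP: mn => mn Mn; exists n; split=> //; exists k => //.
by rewrite -xy //; exact: HM.
Qed.

Lemma below_graph f g : below f (graph g) <-> ~ lefin f g.
Proof.
split=> [H [N HN]|H m].
  have [n [Nn [k kf]]] := H N; rewrite graphE => /eqP e; rewrite e in kf.
  by have := HN n Nn; rewrite leqNgt kf.
apply: contrapT => nm; apply: H; exists m => n mn; rewrite leqNgt; apply/negP => lt.
by apply: nm; exists n; split=> //; exists (g n) => //; rewrite graphE.
Qed.

Lemma diff_bound : exists D : real -> real -> nat, forall x y, x <> y -> ~ agree (D x y) x y.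
Proof.
have H (p : real * real) : exists n, p.1 <> p.2 -> ~ agree n p.1 p.2.
  have [e|ne] := pselect (p.1 = p.2); first by exists 0.
  by have [n [_ nn]] := agree_neq ne; exists n.+1 => _ /(_ n (ltnSn n)).
have /choice[D DP] := H; by exists (fun x y => D (x, y)) => x y; exact: (DP (x, y)).
Qed.

Lemma countable_seq (T : Type) (A : set T) x0 : A x0 -> countable A ->
  exists s : nat -> T, (forall n, A (s n)) /\ forall x, A x -> exists n, s n = x.
Proof.
move=> Ax0 /countable_injP[g gi].
exists (fun n => if pselect (exists x, A x /\ g x = n) is left e then projT1 (cid e) else x0).
split=> [n|x Ax]; first by case: pselect => // e; case: (cid e) => y [].
exists (g x); case: pselect => [e|]; last by case; exists x.
by case: (cid e) => y [Ay /= gy]; apply: gi => //; apply: mem_set.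
Qed.

(** For countable [A] choose [k] such that [f k] is not eventually below a common bound of the
    functions behind [A]. Then [A] lies in [below (f k)], whereas a point of [Y] in that set comes
    from an index before [k]. These indices form a bounded set, so a single function separates the
    points they give from [A]. *)
Lemma tail_lambda_exists : exists Y, tail_lambda Y.
Proof.
have [T [J [lt [f [tlt Jb finc fun_]]]]] := scale_exists.
pose Z := [set graph (f j) | j in J].
exists (eqfin_closure Z).
have [j0 Jj0 _] := fun_ (fun=> 0).
split; first by move=> x y; exact: eqfin_closureP.
- move=> A AY cA.
  have [[a0 Aa0]|nA] := pselect (exists a, A a); last first.
    exists set0 => x _; split=> [Ax|/(_ 0)[n _ []]]; by case: nA; exists x.
  have [al [Aal alP]] := countable_seq Aa0 cA.
  have /choice[jj jjP] : forall n, exists j, J j /\ eqfin (graph (f j)) (al n).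
    by move=> n; have [_ [j Jj <-] e] := AY _ (Aal n); exists j.
  have [g gP] := lefin_countable (fun n => f (jj n)).
  have [k Jk nkg] := fun_ g.
  have alk n : below (f k) (al n).
    have [_ e] := jjP n; apply: below_eqfin e _; apply/below_graph => le; apply: nkg.
    exact: lefin_trans (gP n).
  (* Each [al n] recurs infinitely often, so that agreement with [be m] for infinitely many [m] can
     be demanded. *)
  pose be m := al (if (unpickle m : option (nat * nat)) is Some p then p.1 else 0).
  have be_inf n M : exists2 m, (M <= m)%N & be m = al n.
    have [N HN] := pickle_large M; have [M' HM'] : exists i : nat, (M <= pickle (n, i))%N.
      have inj : injective (fun i : nat => pickle (n, i)) by move=> i j /(pcan_inj pickleK)[].
      by have [i /ltnW] := injective_gtn inj M; exists i.
    by exists (pickle (n, M')) => //; rewrite /be pickleK.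
  have [D DP] := diff_bound.
  pose pt j p := ccat (size (odflt [::] (unpickle p : option (seq bool))))
     (nth false (odflt [::] (unpickle p : option (seq bool)))) (graph (f j)).
  have /choice[h hP] : forall j, exists h, forall p, lefin (fun m => D (pt j p) (be m)) h.
    by move=> j; exact: lefin_countable.
  have [g2 g2P] := Jb k Jk h.
  have /choice[c cP] : forall m, exists c : nat * nat, [/\ (m <= c.1)%N, (c.2 < f k c.1)%N & be m (pickle c)].
    move=> m; have [n [mn [l lk bl]]] := alk (if (unpickle m : option (nat * nat)) is Some p then p.1 else 0) m.
    by exists (n, l).
  (* A prefix of this length contains a witness for [be m] in [below (f k)] and, for large [m],
     distinguishes [be m] from any given other point arising from an index before [k]. *)
  pose len m := maxn m (maxn (g2 m) (pickle (c m)).+1).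
  exists [set s | exists m, s = mkseq (be m) (len m)] => y Yy; split.
    move=> /alP[n <-] M; have [m Mm bm] := be_inf n M.
    exists (len m); first by rewrite leq_max Mm.
    by exists m; rewrite bm.
  move=> H; apply: contrapT => nAy.
  have inf M : exists2 m, (M <= m)%N & agree (len m) (be m) y.
    have [L HL] : exists L, forall m, (m < M)%N -> (len m < L)%N.
      elim: M => [|M [L HL]]; first by exists 0.
      exists (maxn L (len M).+1) => m; rewrite ltnS leq_eqVlt => /predU1P[->|/HL lt1].
        by rewrite leq_max leqnn orbT.
      by rewrite leq_max lt1.
    have [l Ll [m e]] := H L; have lE : l = len m.
      by rewrite -(size_mkseq y l) e size_mkseq.
    exists m; last by apply/agree_mkseq; rewrite -e lE.
    by rewrite leqNgt; apply/negP => /HL; rewrite -lE ltnNge Ll.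
  have [_ [j Jj <-] ej] := Yy.
  have yk : below (f k) y.
    move=> M; have [m Mm am] := inf M; have [c1 c2 c3] := cP m.
    exists (c m).1; split; first exact: leq_trans c1.
    exists (c m).2 => //; rewrite -surjective_pairing -am // /len !leq_max leqnn !orbT //.
  have jk : lt j k.
    have /below_graph nle := below_eqfin (eqfin_sym ej) yk.
    have [//|e|kj] := tlt j k; exfalso; apply: nle; first by rewrite e; exact: lefin_refl.
    exact: finc.
  have [N1 HN1] := g2P j jk; have [s sE] := eqfin_ccat ej.
  have [N2 HN2] := hP j (pickle s).
  have [m mN am] := inf (maxn N1 N2); rewrite geq_max in mN; case/andP: mN => m1 m2.
  have yE : pt j (pickle s) = y by rewrite /pt pickleK /= -sE.
  have := HN2 m m2; rewrite yE => le1; have le2 := leq_trans le1 (HN1 m m1).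
  apply: (DP y (be m)) => [e|]; first by apply: nAy; rewrite e; exact: Aal.
  apply: agree_sym; apply: agree_le am; apply: leq_trans le2 _.
  by rewrite /len !leq_max leqnn orbT.
- move=> cY.
  have Y0 : eqfin_closure Z (graph (f j0)) by exists (graph (f j0)); [exists j0|exact: eqfinxx].
  have [y [_ yP]] := countable_seq Y0 cY.
  have /choice[F FP] : forall n, exists F, forall j, J j -> graph (f j) = y n -> F = f j.
    move=> n; have [[j [Jj e]]|ne] := pselect (exists j, J j /\ graph (f j) = y n).
      by exists (f j) => i Ji ei; apply: graph_inj; rewrite ei.
    by exists (fun=> 0) => j Jj e; case: ne; exists j.
  have [g gP] := lefin_countable F; have [j Jj nj] := fun_ g; apply: nj.
  have Yj : eqfin_closure Z (graph (f j)) by exists (graph (f j)); [exists j|exact: eqfinxx].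
  have [n yn] := yP _ Yj.
  by rewrite -(FP n j Jj (esym yn)).
Qed.

(** * Types of countable dense subsets of the square *)

Section Invariant.
Variable Z : topologicalType.
Implicit Types (A D K : set Z).

Definition derived D : set Z :=
  [set p | forall U, nbhs p U -> exists q, [/\ D q, U q & q <> p]].

Definition dense_in_set A K := forall p U, K p -> nbhs p U -> exists q, [/\ K q, U q & A q].

Definition crowded_hull A : set Z :=
  [set p | exists K, [/\ compact K, K `<=` derived K, dense_in_set A K & K p]].

Definition nonlc A : set Z :=
  [set p | forall V, nbhs p V -> ~ exists Q, compact Q /\ V `&` crowded_hull A `<=` Q].

Definition nonlc_der A n := iter n derived (nonlc A).

Definition marks A : set nat :=
  [set n | exists a, [/\ A a, nonlc_der A n a & ~ nonlc_der A n.+1 a]].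

End Invariant.

Section InvariantHomeo.
Variables (Z : topologicalType).

Definition homeo_pair (h g : Z -> Z) :=
  [/\ continuous h, continuous g, cancel h g & cancel g h].

Lemma homeo_pair_sym h g : homeo_pair h g -> homeo_pair g h.
Proof. by case. Qed.

Lemma compact_image (h : Z -> Z) (K : set Z) : continuous h -> compact K -> compact (h @` K).
Proof. by move=> ch; apply: continuous_compact; exact: continuous_subspaceT. Qed.

Lemma transport_sym (h g : Z -> Z) (A B : set Z) : homeo_pair h g ->
  (forall p, A p <-> B (h p)) -> forall p, B p <-> A (g p).
Proof. by case=> _ _ _ gh AB p; rewrite AB gh. Qed.

Lemma derived_homeo h g (A B : set Z) : homeo_pair h g -> (forall p, A p <-> B (h p)) ->
  forall p, derived A p -> derived B (h p).
Proof.
move=> [ch cg hg gh] AB p dA U hU; have [q [Aq Uq ne]] := dA _ (ch p U hU).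
exists (h q); split=> //; first exact/AB.
by move=> e; apply: ne; rewrite -(hg q) e hg.
Qed.

Lemma hull_homeo h g (A B : set Z) : homeo_pair h g -> (forall p, A p <-> B (h p)) ->
  forall p, crowded_hull A p -> crowded_hull B (h p).
Proof.
move=> hp AB p [K [cK dK AK Kp]]; case: (hp) => ch cg hg gh.
exists (h @` K); split; [exact: compact_image| | |by exists p].
  move=> _ [q Kq <-]; apply: (derived_homeo hp _ (dK q Kq)) => r.
  by split=> [Kr|[r' Kr' e]]; [exists r|rewrite -(hg r) -e hg].
move=> _ U [q Kq <-] hU; have [r [Kr Ur Ar]] := AK q _ Kq (ch q U hU).
exists (h r); split; [by exists r|by []|exact/AB].
Qed.

Lemma nonlc_homeo h g (A B : set Z) : homeo_pair h g -> (forall p, A p <-> B (h p)) ->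
  forall p, nonlc A p -> nonlc B (h p).
Proof.
move=> hp AB p nA V hV [Q [cQ VQ]]; case: (hp) => ch cg hg gh.
apply: (nA _ (ch p V hV)); exists (g @` Q); split; first exact: compact_image.
move=> q [Vq Aq]; exists (h q); rewrite ?hg //; apply: VQ; split=> //.
exact: hull_homeo hp AB q Aq.
Qed.

Lemma nonlc_der_homeo h g (A B : set Z) n : homeo_pair h g -> (forall p, A p <-> B (h p)) ->
  forall p, nonlc_der A n p <-> nonlc_der B n (h p).
Proof.
move=> hp AB; have hp' := homeo_pair_sym hp; have BA := transport_sym hp AB.
case: (hp) => ch cg hg gh.
elim: n => [|n IH] p /=.
  by split=> [|/(nonlc_homeo hp' BA)]; [exact: nonlc_homeo hp AB p|rewrite hg].
split=> [|H]; first exact: derived_homeo hp IH p.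
by rewrite -(hg p); apply: (derived_homeo hp' (transport_sym hp IH)).
Qed.

Lemma marks_same_type (A B : set Z) : same_type A B -> marks A = marks B.
Proof.
case=> h [[ch [g [cg hg gh]]] hAB]; have hp : homeo_pair h g by [].
have AB p : A p <-> B (h p).
  by rewrite -hAB; split=> [Ap|[q Aq e]]; [exists p|rewrite -(hg p) -e hg].
apply/seteqP; split=> n [a [Aa Da nDa]].
  exists (h a); split; [exact/AB|exact/(nonlc_der_homeo n hp AB)|].
  by move/(nonlc_der_homeo n.+1 hp AB).
exists (g a); split; first by apply/AB; rewrite gh.
  by apply/(nonlc_der_homeo n hp AB); rewrite gh.
by move/(nonlc_der_homeo n.+1 hp AB); rewrite gh.
Qed.

End InvariantHomeo.

Lemma dense_seq (Q : set real) q0 : Q q0 -> exists d : nat -> real,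
  (forall n, Q (d n)) /\ forall q n, Q q -> exists m, agree n q (d m).
Proof.
move=> Qq0.
have /choice[e eP] : forall s : seq bool, exists e, Q e /\
    ((exists2 q, Q q & mkseq q (size s) = s) -> mkseq e (size s) = s).
  move=> s; have [[q Qq e]|ne] := pselect (exists2 q, Q q & mkseq q (size s) = s).
    by exists q.
  by exists q0; split=> // H; case: ne.
exists (fun n => e (odflt [::] (unpickle n : option (seq bool)))); split.
  by move=> n; have [] := eP (odflt [::] (unpickle n : option (seq bool))).
move=> q n Qq; exists (pickle (mkseq q n)); rewrite pickleK /=; apply/agree_mkseq.
have [_ H] := eP (mkseq q n); rewrite size_mkseq in H.
by rewrite H //; exists q.
Qed.

(* Baire category: a countable dense subset of a perfect set is not a relative G_delta. *)
Lemma lambda_set_no_perfect (Y Q : set real) : lambda_set Y -> Q `<=` Y -> Q !=set0 ->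
  (forall z, (forall n, exists2 q, Q q & agree n z q) -> Q z) ->
  exists2 q, Q q & exists n, forall q', Q q' -> agree n q q' -> q' = q.
Proof.
move=> lY QY [q0 Qq0] clQ; apply: contrapT => niso.
have iso q n : Q q -> exists q', [/\ Q q', agree n q q' & q' <> q].
  move=> Qq; apply: contrapT => H; apply: niso; exists q => //; exists n => q' Qq' a.
  by apply: contrapT => ne; apply: H; exists q'.
have [d [Qd dP]] := dense_seq Qq0.
have cD : countable (range d) by exact: sub_countable (card_image_le _ _) (countableP _).
have DY : range d `<=` Y by move=> _ [n _ <-]; exact: QY.
have [a aP] := lY _ DY cD.
(* One step towards a point of [Q] in the G_delta set but off the sequence [d]: the cylinder is
   refined so as to exclude [d n] and to exhibit a prefix in [a] of length at least [n]. *)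
have step n (p : real * nat) : exists p' : real * nat, Q p.1 ->
    [/\ Q p'.1, agree p.2 p.1 p'.1, (p.2 < p'.2)%N, ~ agree p'.2 (d n) p'.1 &
      exists m, [/\ (n <= m)%N, (m <= p'.2)%N & a (mkseq p'.1 m)]].
  case: p => q l /=; have [Qq|nQ] := pselect (Q q); last by exists (q, l).
  have [q' [Qq' qq' ne]] : exists q', [/\ Q q', agree l q q' & q' <> d n].
    have [->|ne] := pselect (q = d n); first exact: iso.
    by exists q.
  have [N [_ nN]] := agree_neq ne.
  have [m qm] := dP q' (maxn l N.+1) Qq'.
  have /aP[+ _] : Y (d m) by exact: QY.
  case/(_ _ n); first by exists m.
  move=> k nk ak; exists (d m, maxn (maxn l.+1 N.+1) k) => _ /=; split=> //.
  - by apply: agree_trans qq' _; apply: agree_le qm; rewrite leq_maxl.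
  - by rewrite !leq_max leqnn.
  - move=> H; apply: nN; rewrite (qm N) ?leq_max ?leqnn ?orbT // -(H N) //.
    by rewrite !leq_max leqnn orbT.
  - by exists k; split=> //; rewrite leq_max leqnn orbT.
have /choice[st stP] : forall np : nat * (real * nat), exists p', Q np.2.1 ->
    [/\ Q p'.1, agree np.2.2 np.2.1 p'.1, (np.2.2 < p'.2)%N, ~ agree p'.2 (d np.1) p'.1 &
      exists m, [/\ (np.1 <= m)%N, (m <= p'.2)%N & a (mkseq p'.1 m)]].
  by case=> n p; exact: step.
pose S := fix S n : real * nat := if n is m.+1 then st (m, S m) else (q0, 0).
have QS n : Q (S n).1.
  by elim: n => [|n IH] //=; have [] := stP (n, S n) IH.
have SP n := stP (n, S n) (QS n).
have lS n : (n <= (S n).2)%N.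
  elim: n => [|n IH] //; have [_ _ lt _ _] := SP n; exact: leq_ltn_trans lt.
have aS n m : (n <= m)%N -> agree (S n).2 (S n).1 (S m).1.
  elim: m => [|m IH]; first by rewrite leqn0 => /eqP ->.
  rewrite leq_eqVlt => /predU1P[->//|nm]; rewrite ltnS in nm.
  have [_ a1 lt _ _] := SP m; apply: agree_trans (IH nm) _; apply: agree_le a1.
  elim: m nm {IH lt} => [|m IH]; first by rewrite leqn0 => /eqP ->.
  rewrite leq_eqVlt => /predU1P[->//|nm]; rewrite ltnS in nm.
  by apply: leq_trans (IH nm) _; have [_ _ /ltnW] := SP m.
pose z i := (S i.+1).1 i.
have zS n : agree (S n).2 (S n).1 z.
  move=> i lin; rewrite /z; have [le|lt] := leqP n i.+1.
    by rewrite (aS n i.+1).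
  by apply: esym; apply: (aS i.+1 n (ltnW lt)); exact: (lS i.+1).
have Qz : Q z.
  by apply: clQ => n; exists (S n).1 => //; apply: agree_sym; apply: agree_le (zS n).
have /aP[_ zD] := QY z Qz.
case: zD => [n|m _ dz].
  have [_ _ _ _ [m [nm ml am]]] := SP n; exists m => //.
  by have /agree_mkseq <- := agree_le ml (zS n.+1).
have [_ _ _ nz _] := SP m; apply: nz.
by apply: agree_sym; rewrite -[d m]/(d m) dz; exact: zS m.+1.
Qed.

(** * Crowded compact subsets of the square *)

Section Square.
Variable Y : set real.
Hypothesis gY : tail_lambda Y.
Local Notation X := (sum_space Y).
Local Notation XX := (X * X)%type.
Implicit Types (A K : set XX) (p q : XX).

Definition agree2 n p q := agree n (pt p.1) (pt q.1) /\ agree n (pt p.2) (pt q.2).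

Lemma agree2_sym n p q : agree2 n p q -> agree2 n q p.
Proof. by case=> a b; split; exact: agree_sym. Qed.
Lemma agree2_trans n q p r : agree2 n p q -> agree2 n q r -> agree2 n p r.
Proof. by case=> a b [a' b']; split; [exact: agree_trans a'|exact: agree_trans b']. Qed.
Lemma agree2_le m n p q : (m <= n)%N -> agree2 n p q -> agree2 m p q.
Proof. by move=> mn [a b]; split; [exact: agree_le a|exact: agree_le b]. Qed.
Lemma agree2xx n p : agree2 n p p. Proof. by split. Qed.

Lemma agree2_neq p q : p <> q -> exists n, ~ agree2 n p q.
Proof.
move=> ne; apply: contrapT => /forallNP H; apply: ne.
have e n : agree2 n p q by apply: contrapT; exact: H.
by case: p q {H} e => p1 p2 [q1 q2] e; congr pair; apply: pt_inj; apply: agree_all => n; have [] := e n.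
Qed.

Lemma nbhs_agree2 p (U : set XX) : nbhs p U <-> exists n, forall q, agree2 n p q -> U q.
Proof.
rewrite sub2_nbhsP; split=> -[n H]; exists n => q.
  by case=> a b; exact: H.
by move=> a b; apply: H.
Qed.

Lemma derivedP A p : derived A p <-> forall n, exists q, [/\ A q, agree2 n p q & q <> p].
Proof.
split=> H; first by move=> n; apply: (H (agree2 n p)); apply/nbhs_agree2; exists n.
by move=> U /nbhs_agree2[n HU]; have [q [Aq pq ne]] := H n; exists q; split=> //; exact: HU.
Qed.

Lemma pt_closed (Q : set X) : compact Q -> forall z, (forall n, exists2 q, Q q & agree n z (pt q)) ->
  exists2 q, Q q & pt q = z.
Proof.
move=> cQ z H.
have cp : compact ((set_val : X -> cantor_space) @` Q).
  by apply: continuous_compact => //; apply: continuous_subspaceT; exact: initial_continuous.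
have cl := compact_closed cantor_space_hausdorff cp.
have /cl [q Qq e] : closure (set_val @` Q : set cantor_space) z; last by exists q.
move=> U /prod_nbhsP[n HU]; have [q Qq zq] := H n; exists (pt q); split; last exact: HU.
by exists q.
Qed.

Lemma crowded_avoid K (l : seq XX) p n : K `<=` derived K -> K p ->
  exists q m, [/\ K q, agree2 n p q, (n <= m)%N & forall r, r \in l -> ~ agree2 m q r].
Proof.
move=> dK Kp; elim: l => [|z l [q [m [Kq pq nm H]]]]; first by exists p, n; split.
have [q' [Kq' qq' ne]] : exists q', [/\ K q', agree2 m q q' & q' <> z].
  have [e|ne] := pselect (q = z); last by exists q; split.
  by have /derivedP/(_ m)[q' [a b c]] := dK _ Kq; exists q'; rewrite -e.
have [k nk] := agree2_neq ne; exists q', (maxn m k); split=> //.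
- by apply: agree2_trans pq _; exact: agree2_le qq'.
- by rewrite leq_max nm.
move=> r; rewrite inE => /predU1P[->|rl] a.
  by apply: nk; apply: agree2_le a; rewrite leq_maxr.
by apply: (H r rl); apply: agree2_trans qq' _; apply: agree2_le a; rewrite leq_maxl.
Qed.

(** Near [p0] the projection of a crowded compact [K] would be a compact subset of [Y], hence have
    an isolated point. Over it [K] is a crowded piece of a single fibre in which [A] is dense,
    although that fibre holds only finitely many points of [A] near [p0]. *)
Lemma box_lemma (pi : XX -> X) A p0 N :
  continuous pi -> (forall n p q, agree2 n p q -> agree n (pt (pi p)) (pt (pi q))) ->
  pt (pi p0) 0 = false ->
  (forall x1, exists l : seq XX, forall a, A a -> pi a = x1 -> agree2 N.+1 p0 a -> a \in l) ->
  ~ crowded_hull A p0.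
Proof.
move=> cpi agpi p00 fin [K [cK dK AK Kp0]].
pose K0 := K `&` [set q | agree2 N.+1 p0 q].
have cK0 : compact K0.
  apply: compact_closedI => //; rewrite -[X in closed X]setCK; apply: open_closedC.
  rewrite openE => p np; apply/nbhs_agree2; exists N.+1 => q pq p0q; apply: np.
  by apply: agree2_trans p0q _; exact: agree2_sym.
have bit q : K0 q -> pt (pi q) 0 = false.
  by case=> _ /agpi/(_ 0 isT) <-.
pose Q := [set btail (pt (pi q)) | q in K0].
have QY : Q `<=` Y.
  by move=> _ [q Kq <-]; have := ptP (pi q); case=> //; rewrite (bit q Kq).
have [_ lY _] := gY.
have [||q1 [q [Kq0 piq] <-] [n nP]] := lambda_set_no_perfect lY QY.
- by exists (btail (pt (pi p0))), p0 => //; split=> //; exact: agree2xx.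
- move=> z H; have [||x [q Kq <-] e] := @pt_closed (pi @` K0) _ (bcons false z).
  + by apply: continuous_compact => //; apply: continuous_subspaceT.
  + move=> n; have [_ [q Kq <-] zq] := H n; exists (pi q); first by exists q.
    rewrite -[pt (pi q)]bcons_btail (bit q Kq); apply: agree_le (leqnSn n) _; exact: agree_bcons.
  + by exists q => //; rewrite e.
(* near q, the set K is contained in the fibre of pi through q *)
pose M := maxn N.+1 n.+1.
have fib r : K r -> agree2 M q r -> pi r = pi q.
  move=> Kr qr; have K0r : K0 r.
    split=> //; apply: agree2_trans piq _; apply: agree2_le qr; rewrite leq_maxl //.
  have e := nP (btail (pt (pi r))) (ex_intro2 _ _ r K0r erefl).
  apply: pt_inj; rewrite -[LHS]bcons_btail -[RHS]bcons_btail (bit r K0r) (bit q (conj Kq0 piq)) e //.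
  by apply: agree_btail; apply: agpi; apply: agree2_le qr; rewrite leq_maxr.
have [l lP] := fin (pi q).
have [q' [m [Kq' qq' Mm Hl]]] := crowded_avoid l M dK Kq0.
have [|a [Ka q'a Aa]] := AK q' (agree2 m q') Kq'; first by apply/nbhs_agree2; exists m.
have qa : agree2 M q a by apply: agree2_trans qq' _; exact: agree2_le q'a.
apply: (Hl a) => //; apply: lP => //; first exact: fib.
by apply: agree2_trans piq _; apply: agree2_le qa; rewrite leq_maxl.
Qed.

End Square.

(* [Lder 0] is a countable closed set and [Lder n] its n-th Cantor-Bendixson derivative;
   [unit_real m] has rank m. *)
Definition ones (x : real) (i : nat) : nat := \sum_(j < i) x j.
Definition first1 (x : real) (m : nat) : Prop := x m /\ forall j, (j < m)%N -> x j = false.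
Definition Lder (n : nat) (x : real) : Prop := forall m i, first1 x m -> (ones x i + n <= m.+1)%N.
Definition unit_real (m : nat) : real := fun i => i == m.

Lemma onesS x i : ones x i.+1 = ones x i + x i.
Proof. by rewrite /ones big_ord_recr. Qed.

Lemma ones_le x i j : (i <= j)%N -> (ones x i <= ones x j)%N.
Proof.
elim: j => [|j IH]; first by rewrite leqn0 => /eqP ->.
rewrite leq_eqVlt => /predU1P[->//|ij]; rewrite onesS; apply: leq_trans (IH ij) _.
exact: leq_addr.
Qed.

Lemma ones_agree n x y i : agree n x y -> (i <= n)%N -> ones x i = ones y i.
Proof.
move=> xy le; apply: eq_bigr => j _; rewrite xy //.
exact: leq_trans (ltn_ord j) le.
Qed.

Lemma first1_agree n x y m : agree n x y -> (m < n)%N -> first1 x m -> first1 y m.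
Proof.
move=> xy lt [xm H]; split; first by rewrite -xy.
by move=> j jm; rewrite -xy ?H //; exact: ltn_trans lt.
Qed.

Lemma first1_ex (x : real) j : x j -> exists m, first1 x m.
Proof.
move=> xj; have ex : exists j, x j by exists j.
case: (ex_minnP ex) => m xm mm; exists m; split=> // i im.
by apply/negP => /mm; rewrite leqNgt im.
Qed.

Lemma ones_unit_real m i : ones (unit_real m) i = (m < i)%N.
Proof.
elim: i => [|i IH]; first by rewrite /ones big_ord0.
rewrite onesS IH /unit_real ltnS; case: (ltngtP m i) => //.
Qed.

Lemma first1_unit_real m m' : first1 (unit_real m) m' -> m' = m.
Proof. by case=> /eqP. Qed.

Lemma Lder_unit_real n m : Lder n (unit_real m) <-> (n <= m)%N.
Proof.
split=> [H|nm m' i /first1_unit_real ->].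
  have : first1 (unit_real m) m by split=> [|j jm]; rewrite /unit_real ?eqxx // ltn_eqF.
  by move/(H m m.+1); rewrite ones_unit_real ltnSn add1n ltnS.
by rewrite ones_unit_real; case: (m < i)%N; rewrite ?add1n ?add0n //; exact: leqW.
Qed.

Lemma Lder_closed n x : (forall N, exists2 l, Lder n l & agree N x l) -> Lder n x.
Proof.
move=> H m i f; have [l Ll xl] := H (maxn m.+1 i).
rewrite (ones_agree xl) ?leq_maxr //; apply: Ll; apply: first1_agree xl _ f.
by rewrite leq_max ltnSn.
Qed.

(** With first 1 at [m], at most m + 1 - n ones are allowed; for n = 0 this is the Schreier family.
    If room for one more is left, a 1 can be added arbitrarily far out. If not, nearby points of
    [Lder n] have no further ones and equal [x]. *)
Lemma Lder_derived n x :
  Lder n.+1 x <-> forall N, exists l, [/\ Lder n l, agree N x l & l <> x].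
Proof.
split=> [H N|H].
  have [[j xj]|x0] := pselect (exists j, x j); last first.
    have x0' i : x i = false by apply/negP => xi; apply: x0; exists i.
    exists (unit_real (maxn N n)); split; first by apply/Lder_unit_real; rewrite leq_maxr.
      move=> i lin; rewrite x0' /unit_real; apply/esym/ltn_eqF; apply: leq_trans lin _.
      by rewrite leq_maxl.
    by move/(congr1 (fun x => x (maxn N n))); rewrite x0' /unit_real eqxx.
  have [m fm] := first1_ex xj.
  have [k [kN km xk]] : exists k, [/\ (N <= k)%N, (m < k)%N & x k = false].
    apply: contrapT => nk; pose J := maxn N m.+1.
    have all1 d : x (J + d).
      apply: contrapT => /negP/negbTE xd; apply: nk; exists (J + d); split=> //.
        by apply: leq_trans (leq_addr _ _); rewrite leq_maxl.
      by apply: leq_trans (leq_addr _ _); rewrite leq_maxr.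
    have big d : (d <= ones x (J + d))%N.
      by elim: d => // d IH; rewrite addnS onesS all1 addn1 ltnS.
    have := H m (J + m.+1) fm; rewrite addnS ltnS => le.
    by have := leq_trans (big m.+1) (leq_trans (leq_addr _ _) le); rewrite ltnn.
  pose l : real := fun i => x i || (i == k).
  have lcnt i : (ones l i <= ones x i + (k < i))%N.
    elim: i => [|i IH]; first by rewrite /ones !big_ord0.
    rewrite !onesS /l ltnS; case: (ltngtP k i) IH => [lt|lt|ki] IH.
    - by rewrite orbF addnAC leq_add2r.
    - by rewrite orbF addnAC leq_add2r.
    - have -> : x i = false by rewrite -ki.
      by apply: leq_add; [move: IH; rewrite /= !addn0|case: (_ || _)].
  exists l; split.
  - move=> m' i [lm' fm'].
    have mm' : m' = m.
      case: (ltngtP m' m) => // lt.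
        by move: lm'; rewrite /l; case: fm => _ -> //=; rewrite ltn_eqF // (ltn_trans lt km).
      by have := fm' m lt; rewrite /l; case: fm => ->.
    rewrite mm'; apply: leq_trans (H m i fm).
    by rewrite addnS -addSn leq_add2r; apply: leq_trans (lcnt i) _; case: (k < i)%N; rewrite ?addn1 ?addn0.
  - move=> i lin; rewrite /l ltn_eqF ?orbF //; exact: leq_trans lin kN.
  - by move/(congr1 (fun x => x k)); rewrite /l eqxx orbT xk.
have Lx : Lder n x by apply: Lder_closed => N; have [l [Ll xl _]] := H N; exists l.
move=> m i f; rewrite addnS ltnNge; apply/negP => lt.
have eq : ones x i + n = m.+1.
  by apply/eqP; rewrite eqn_leq Lx // lt.
have zero z : Lder n z -> first1 z m -> ones z i = ones x i -> forall j, (i <= j)%N -> z j = false.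
  move=> Lz fz e j ij; apply/negP => zj; have := Lz m j.+1 fz.
  rewrite onesS zj addn1 -eq addSn leqNgt ltnS leq_add2r -e ones_le //.
have [l [Ll xl ne]] := H (maxn m.+1 i); apply: ne; apply/funext => j.
have [ij|ji] := leqP i j.
  rewrite (zero x) // (zero l) //; first by apply: first1_agree xl _ f; rewrite leq_max ltnSn.
  by rewrite (ones_agree xl) // leq_maxr.
by rewrite xl // leq_max ji orbT.
Qed.

(** * Dense sets coding subsets of omega *)

Section Construction.
Variable Y : set real.
Hypothesis gY : tail_lambda Y.
Local Notation X := (sum_space Y).
Local Notation XX := (X * X)%type.

Lemma cXP (c : real) : sum_set Y (bcons true c). Proof. by left. Qed.
Lemma yXP (y : real) : Y y -> sum_set Y (bcons false y). Proof. by right. Qed.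

Definition cX (c : real) : X := mkpt (cXP c).
Definition yX (y : real) : X := if pselect (Y y) is left Yy then mkpt (yXP Yy) else cX y.

Lemma pt_cX c : pt (cX c) = bcons true c. Proof. by []. Qed.
Lemma pt_yX y : Y y -> pt (yX y) = bcons false y.
Proof. by rewrite /yX; case: pselect. Qed.

Lemma X_cases (x : X) : (exists c, x = cX c) \/ exists2 y, Y y & x = yX y.
Proof.
case x0: (pt x 0); first by left; exists (btail (pt x)); apply: pt_inj; rewrite pt_cX -x0 bcons_btail.
have Yt : Y (btail (pt x)) by have := ptP x; case=> //; rewrite x0.
by right; exists (btail (pt x)) => //; apply: pt_inj; rewrite pt_yX // -x0 bcons_btail.
Qed.

Lemma yX_inj y y' : Y y -> Y y' -> yX y = yX y' -> y = y'.
Proof.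
move=> Yy Yy' /(congr1 (@pt _)); rewrite !pt_yX // => /(congr1 btail); exact: id.
Qed.

Lemma cX_inj c c' : cX c = cX c' -> c = c'.
Proof. by move=> /(congr1 (@pt _)); rewrite !pt_cX => /(congr1 btail). Qed.

Lemma cX_compact : compact (range cX).
Proof.
rewrite -[range cX]/(cX @` [set: cantor_space]); apply: continuous_compact; last exact: cantor_space_compact.
apply: continuous_subspaceT => c U /sub_nbhsP[n HU]; apply/prod_nbhsP; exists n => c' cc'.
by apply: HU; rewrite !pt_cX; apply: agree_le (leqnSn n) _; exact: agree_bcons.
Qed.

(** For fixed [n] the points [yn n k] converge to [qn n] outside [Y], so no compact set contains
    fibres over all of them; as they leave [y0] exactly at coordinate [n], these sequences approach
    [y0]. The class of [ys] provides dense filler points different from [y0]. *)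
Variables (y0 ys : real) (yn : nat -> nat -> real) (qn : nat -> real).
Hypothesis Yy0 : Y y0.
Hypothesis Yys : Y ys.
Hypothesis nys : ~ eqfin ys y0.
Hypothesis Yyn : forall n k, Y (yn n k).
Hypothesis yn_agree : forall n k, agree n y0 (yn n k).
Hypothesis yn_ne : forall n k, yn n k n <> y0 n.
Hypothesis nqn : forall n, ~ Y (qn n).
Hypothesis yq : forall n k, agree (n.+1 + k) (qn n) (yn n k).

Lemma yn_y0 n k N : agree N y0 (yn n k) -> (N <= n)%N.
Proof. by move=> H; rewrite leqNgt; apply/negP => lt; apply: (@yn_ne n k); rewrite H. Qed.

(** The double sequence accumulates only at [y0] and at the points [qn n], and the latter are not in
    [Y]. *)
Lemma yn_isolated y : Y y -> y <> y0 ->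
  exists N, ~ agree N y y0 /\ forall n k, agree N y (yn n k) -> yn n k = y.
Proof.
move=> Yy ne; have [n0 [an0 nn0]] := agree_neq ne.
have [|M [aM nM]] := @agree_neq _ y (qn n0); first by move=> e; apply: (@nqn n0); rewrite -e.
have [N HN] : exists N, forall k, (k <= M)%N -> agree N y (yn n0 k) -> yn n0 k = y.
  elim: M {aM nM} => [|M [N HN]].
    have [e|/agree_neq[N [_ nN]]] := pselect (yn n0 0 = y); first by exists 0 => k; rewrite leqn0 => /eqP ->.
    exists N.+1 => k; rewrite leqn0 => /eqP -> H; case: nN; rewrite H //.
  have [e|/agree_neq[N' [_ nN]]] := pselect (yn n0 M.+1 = y).
    by exists N => k; rewrite leq_eqVlt => /predU1P[->//|]; exact: HN.
  exists (maxn N N'.+1) => k; rewrite leq_eqVlt => /predU1P[->|kM] H.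
    by case: nN; rewrite H // leq_max leqnn orbT.
  by apply: HN => //; apply: agree_le H; rewrite leq_maxl.
exists (maxn (maxn n0.+1 M.+1) N); split.
  by move=> H; apply: nn0; apply: H; rewrite !leq_max leqnn.
move=> n k H.
have n0n : n = n0.
  apply/eqP; rewrite eqn_leq; apply/andP; split; rewrite leqNgt; apply/negP => lt.
    apply: nn0; rewrite H ?leq_max ?leqnn //; apply: esym; apply: yn_agree => //.
  apply: (@yn_ne n k); rewrite -(an0 n lt) -H // !leq_max (ltn_trans lt) ?ltnSn //.
rewrite n0n in H *; apply: HN; last by apply: agree_le H; rewrite leq_maxr.
rewrite leqNgt; apply/negP => lt; apply: nM.
rewrite (yq (k := k)) ?H ?leq_max ?leqnn ?orbT //.
by rewrite addSn ltnS; apply: leq_trans (ltnW lt) (leq_addl _ _).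
Qed.

(** Clopen neighbourhoods shrinking to [Lder 0]: each is crowded, as a fibre over [yn n k] must be,
    while only [Lder 0] survives as [n] grows. *)
Definition L_nbhd n (u : real) := exists2 l, Lder 0 l & agree n u l.

(** A prefix for the coordinate in [Y], a flag that [right_pt] reads as the summand of the other
    coordinate, and a prefix for that one. *)
Definition box_dec (j : nat) : seq bool * bool * seq bool :=
  odflt ([::], true, [::]) (unpickle j).
(* Flipping the bit at [flip_pos j] makes the map [left_real] finite-to-one. *)
Definition flip_pos j := size (box_dec j).1.1 + j.
Definition left_real j : real := fun i => if (i < size (box_dec j).1.1)%N then nth false (box_dec j).1.1 i
  else ys i (+) (i == flip_pos j).
Definition fseq (s : seq bool) : real := nth false s.
Definition right_pt j : X := if (box_dec j).1.2 then cX (fseq (box_dec j).2)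
  else yX (ccat (size (box_dec j).2) (fseq (box_dec j).2) ys).

Lemma left_real_eqfin j : eqfin ys (left_real j).
Proof.
exists (flip_pos j).+1 => i lt; rewrite /left_real ltnNge (leq_trans _ (ltnW lt)) ?leq_addr //=.
by rewrite gtn_eqF // addbF.
Qed.

Lemma left_real_Y j : Y (left_real j). Proof. exact: Y_eqfin (left_real_eqfin j) Yys. Qed.

Lemma left_real_pos j : left_real j (flip_pos j) = ~~ ys (flip_pos j).
Proof. by rewrite /left_real ltnNge leq_addr /= eqxx addbT. Qed.

Lemma left_real_fin j j' : left_real j = left_real j' -> (j' <= flip_pos j)%N.
Proof.
move=> e; apply: leq_trans (leq_addl (size (box_dec j').1.1) j') _.
rewrite -/(flip_pos j') leqNgt; apply/negP => lt.
have := left_real_pos j'; rewrite -e {1}/left_real ltnNge (leq_trans _ (ltnW lt)) ?leq_addr //=.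
by rewrite gtn_eqF // addbF; case: (ys _).
Qed.

Lemma left_real_dense y n b t : exists j, [/\ agree n y (left_real j), (box_dec j).1.2 = b & (box_dec j).2 = t].
Proof.
exists (pickle (mkseq y n, b, t)); rewrite /left_real /box_dec pickleK /=; split=> // i lin.
by rewrite size_mkseq lin nth_mkseq.
Qed.

Lemma left_list (f : nat -> XX) x : exists l : seq XX, forall j, yX (left_real j) = x -> f j \in l.
Proof.
have [[j0 e0]|ne] := pselect (exists j, yX (left_real j) = x); last first.
  by exists [::] => j e; case: ne; exists j.
exists (map f (iota 0 (flip_pos j0).+1)) => j e; apply: map_f; rewrite mem_iota add0n ltnS.
by apply: left_real_fin; apply: yX_inj; [exact: left_real_Y|exact: left_real_Y|rewrite e0].
Qed.

Definition fin_supp (c : real) := exists t, c = fseq t.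

Lemma fin_supp_dense c n : exists2 t, fin_supp (fseq t) & agree n c (fseq t).
Proof.
exists (mkseq c n); first by exists (mkseq c n).
by move=> i lin; rewrite /fseq nth_mkseq.
Qed.

(* The pieces [C_fibre] make the non-locally-compact part equal to {y0} x [Lder 0], where
   the points marked by [C_mark] then reveal [s]; the remaining pieces have finite fibres
   over the lambda-set and only serve to make the set dense. *)
Inductive coded_set (s : set nat) : XX -> Prop :=
| C_fibre n k t : L_nbhd n (fseq t) -> coded_set s (yX (yn n k), cX (fseq t))
| C_mark m : s m -> coded_set s (yX y0, cX (unit_real m))
| C_left j : coded_set s (yX (left_real j), right_pt j)
| C_right j : coded_set s (cX (fseq (box_dec j).2), yX (left_real j))
| C_cantor t t' : coded_set s (cX (fseq t), cX (fseq t')).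

Lemma coded_set_countable s : countable (coded_set s).
Proof.
pose f (i : nat * nat * nat * seq bool * seq bool) : XX := let: (tag, n, k, t, t') := i in
  match tag with 0 => (yX (yn n k), cX (fseq t)) | 1 => (yX y0, cX (unit_real n))
  | 2 => (yX (left_real n), right_pt n) | 3 => (cX (fseq (box_dec n).2), yX (left_real n))
  | _ => (cX (fseq t), cX (fseq t')) end.
apply: (@sub_countable _ _ _ (range f)).
  apply: subset_card_le => p [n k t _|m _|j|j|t t'].
  - by exists (0, n, k, t, [::]).
  - by exists (1, m, 0, [::], [::]).
  - by exists (2, j, 0, [::], [::]).
  - by exists (3, j, 0, [::], [::]).
  - by exists (4, 0, 0, t, t').
exact: sub_countable (card_image_le _ _) (countableP _).
Qed.

Lemma dense_agree2 (A : set XX) : (forall p n, exists2 a, A a & agree2 n p a) -> dense A.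
Proof.
move=> H O [p Op] oO; have : nbhs p O by apply: open_nbhs_nbhs.
by move=> /nbhs_agree2[n HO]; have [a Aa pa] := H p n; exists a; split=> //; exact: HO.
Qed.

Lemma agree_yX n y y' : Y y -> Y y' -> agree n y y' -> agree n (pt (yX y)) (pt (yX y')).
Proof. by move=> Yy Yy' H; rewrite !pt_yX //; apply: agree_le (leqnSn n) _; exact: agree_bcons. Qed.

Lemma agree_cX n c c' : agree n c c' -> agree n (pt (cX c)) (pt (cX c')).
Proof. by move=> H; rewrite !pt_cX; apply: agree_le (leqnSn n) _; exact: agree_bcons. Qed.

Lemma yX_agree n y y' : Y y -> Y y' -> agree n.+1 (pt (yX y)) (pt (yX y')) -> agree n y y'.
Proof. by move=> Yy Yy'; rewrite !pt_yX // => /agree_btail. Qed.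

Lemma cX_agree n c c' : agree n.+1 (pt (cX c)) (pt (cX c')) -> agree n c c'.
Proof. by move=> /agree_btail. Qed.

Lemma coded_set_dense s : dense (coded_set s).
Proof.
apply: dense_agree2 => -[p1 p2] n.
have [[c1 ->]|[y1 Y1 ->]] := X_cases p1; last first.
  have [b [t H]] : exists b t, forall j, (box_dec j).1.2 = b -> (box_dec j).2 = t -> agree n (pt p2) (pt (right_pt j)).
    have [[c ->]|[y Yy ->]] := X_cases p2.
      exists true, (mkseq c n) => j e1 e2; rewrite /right_pt e1 e2; apply: agree_cX => i lin.
      by rewrite /fseq nth_mkseq.
    exists false, (mkseq y n) => j e1 e2; rewrite /right_pt e1 e2; apply: agree_yX => //.
      by apply: Y_eqfin Yys => //; exact: ccat_eqfin.
    by move=> i lin; rewrite /ccat size_mkseq lin /fseq nth_mkseq.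
  have [j [a e1 e2]] := left_real_dense y1 n b t.
  exists (yX (left_real j), right_pt j); first exact: C_left.
  by split=> /=; [apply: agree_yX => //; exact: left_real_Y|exact: H].
have [t _ ct] := fin_supp_dense c1 n.
have [[c ->]|[y Yy ->]] := X_cases p2.
  have [t' _ ct'] := fin_supp_dense c n.
  exists (cX (fseq t), cX (fseq t')); first exact: C_cantor.
  by split; exact: agree_cX.
have [j [a e1 e2]] := left_real_dense y n true t.
exists (cX (fseq (box_dec j).2), yX (left_real j)); first exact: C_right.
by split=> /=; [rewrite e2; exact: agree_cX|apply: agree_yX => //; exact: left_real_Y].
Qed.

Lemma fst_cont : continuous (fst : XX -> X).
Proof. by move=> p; exact: cvg_fst. Qed.
Lemma snd_cont : continuous (snd : XX -> X).
Proof. by move=> p; exact: cvg_snd. Qed.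

Lemma not_hull1 s p N : pt p.1 0 = false ->
  (forall n k t, L_nbhd n (fseq t) -> ~ agree2 N.+1 p (yX (yn n k), cX (fseq t))) ->
  (forall m, ~ agree2 N.+1 p (yX y0, cX (unit_real m))) -> ~ crowded_hull (coded_set s) p.
Proof.
move=> p1 H1 H2; apply: (box_lemma gY (pi := fst) (N := N)) => //; first exact: fst_cont.
  by move=> n q r [].
move=> x1; have [l lP] := left_list (fun j => (yX (left_real j), right_pt j)) x1.
exists l => a [n k t Ut _ /(H1 _ _ _ Ut)//|m _ _ /H2//|j /= e _|j _ [/= /(_ 0 isT)]|t t' _ [/= /(_ 0 isT)]].
- exact: lP.
- by rewrite p1.
- by rewrite p1.
Qed.

Lemma not_hull2 s p : pt p.1 0 = true -> pt p.2 0 = false -> ~ crowded_hull (coded_set s) p.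
Proof.
move=> p1 p2; apply: (box_lemma gY (pi := snd) (N := 0)) => //; first exact: snd_cont.
  by move=> n q r [].
move=> x1; have [l lP] := left_list (fun j => (cX (fseq (box_dec j).2), yX (left_real j))) x1.
have bitY y : Y y -> pt (yX y) 0 = false by move=> Yy; rewrite pt_yX.
exists l => a [n k t _ _ [/= /(_ 0 isT)]|m _ _ [/= /(_ 0 isT)]|j _ [/= /(_ 0 isT)]|j /= e _|t t' _ [_ /= /(_ 0 isT)]].
- by rewrite p1 bitY.
- by rewrite p1 bitY.
- by rewrite p1 bitY //; exact: left_real_Y.
- exact: lP.
- by rewrite p2.
Qed.

Lemma hull_fibre s n k u : L_nbhd n u -> crowded_hull (coded_set s) (yX (yn n k), cX u).
Proof.
move=> Uu; pose i c : XX := (yX (yn n k), cX c).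
have Uag c c' : agree n c c' -> L_nbhd n c -> L_nbhd n c'.
  by move=> cc' [l Ll cl]; exists l => //; apply: agree_trans cl; exact: agree_sym.
have ci : continuous (i : cantor_space -> XX).
  move=> c U /nbhs_agree2[N HU]; apply/prod_nbhsP; exists N => c' cc'; apply: HU.
  by split=> //=; exact: agree_cX.
have cU : compact (L_nbhd n : set cantor_space).
  apply: (subclosed_compact _ cantor_space_compact) => //.
  rewrite -[X in closed X]setCK; apply: open_closedC; rewrite openE => c nc.
  apply/prod_nbhsP; exists n => c' cc' Uc'; apply: nc; exact: Uag (agree_sym cc') Uc'.
exists (i @` L_nbhd n); split; last by exists u.
- apply: (continuous_compact (T := cantor_space)) => //; exact: continuous_subspaceT.
- move=> _ [c Uc <-]; apply/derivedP => N.
  pose c' : real := fun j => c j (+) (j == maxn n N).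
  have cc' : agree (maxn n N) c c' by move=> j lt; rewrite /c' ltn_eqF // addbF.
  exists (i c'); split.
  + by exists c' => //; apply: Uag Uc; apply: agree_le cc'; rewrite leq_maxl.
  + by split=> //=; apply: agree_cX; apply: agree_le cc'; rewrite leq_maxr.
  + case=> /(congr1 (fun x : real => x (maxn n N).+1)) /=.
    by rewrite /c' eqxx addbT; case: (c _).
- move=> _ U [c Uc <-] /nbhs_agree2[N HU]; have [t _ ct] := fin_supp_dense c (maxn n N).
  have Ut : L_nbhd n (fseq t) by apply: Uag Uc; apply: agree_le ct; rewrite leq_maxl.
  exists (i (fseq t)); split; [by exists (fseq t)| |exact: C_fibre].
  by apply: HU; split=> //=; apply: agree_cX; apply: agree_le ct; rewrite leq_maxr.
Qed.

(** Near [(yX y0, cX l)] the hull contains points over all [yn N k] for some [N], and a compact set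
    containing them would have a point over [qn N]. Near any other point a cylinder meets the hull
    in the empty set, within the square of the Cantor summand, or within one fibre by
    [yn_isolated]. *)
Lemma nonlcP s p : nonlc (coded_set s) p <-> exists2 l, Lder 0 l & p = (yX y0, cX l).
Proof.
split; last first.
  case=> l Ll -> V /nbhs_agree2[N HV] [Q [cQ VQ]].
  have Qk k : Q (yX (yn N k), cX l).
    apply: VQ; split; last by apply: hull_fibre; exists l.
    by apply: HV; split=> //=; exact: agree_yX.
  have [||x _ e] := @pt_closed Y (fst @` Q) _ (bcons false (qn N)).
  - by apply: continuous_compact => //; apply: continuous_subspaceT; exact: fst_cont.
  - move=> n; exists (yX (yn N n)); first by exists (yX (yn N n), cX l).
    rewrite pt_yX //; apply: agree_le (leqnSn n) _; apply: agree_bcons; apply: agree_le (yq (k := n)).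
    exact: leq_addl.
  - by apply: (@nqn N); have := ptP x; rewrite e; case.
case: p => p1 p2 np; apply: contrapT => H.
have bitY y : Y y -> pt (yX y) 0 = false by move=> Yy; rewrite pt_yX.
have out (V : set XX) Q : nbhs (p1, p2) V -> compact Q -> V `&` crowded_hull (coded_set s) `<=` Q -> False.
  by move=> hV cQ VQ; apply: np hV _; exists Q.
have [[c1 e1]|[y1 Y1 e1]] := X_cases p1.
  have [[c2 e2]|[y2 Y2 e2]] := X_cases p2.
    apply: (out (agree2 1 (p1, p2)) (range cX `*` range cX)).
    - by apply/nbhs_agree2; exists 1.
    - by apply: compact_setX; exact: cX_compact.
    - move=> [q1 q2] [[/= /(_ 0 isT) b1 /(_ 0 isT) b2] _]; rewrite e1 e2 /= in b1 b2.
      split=> /=.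
        by have [[c ->]|[y Yy e]] := X_cases q1; [exists c|rewrite e bitY in b1].
      by have [[c ->]|[y Yy e]] := X_cases q2; [exists c|rewrite e bitY in b2].
  apply: (out (agree2 1 (p1, p2)) set0); [by apply/nbhs_agree2; exists 1|exact: compact0|].
  move=> q [[/= /(_ 0 isT) b1 /(_ 0 isT) b2] hq]; exfalso; move: hq.
  by apply: not_hull2; [rewrite -b1 e1|rewrite -b2 e2 bitY].
have bq1 q n : agree n.+1 (pt p1) (pt q) -> pt q 0 = false by move=> /(_ 0 isT) <-; rewrite e1 bitY.
have [y10|ne] := pselect (y1 = y0).
  have [[c2 e2]|[y2 Y2 e2]] := X_cases p2; last first.
    apply: (out (agree2 1 (p1, p2)) set0); [by apply/nbhs_agree2; exists 1|exact: compact0|].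
    move=> q [[/= b1 /(_ 0 isT) b2] hq]; exfalso; move: hq; rewrite e2 bitY // in b2.
    apply: (not_hull1 (N := 0)); first exact: bq1 b1.
      by move=> n k t _ [_ /= /(_ 0 isT)]; rewrite -b2.
    by move=> m [_ /= /(_ 0 isT)]; rewrite -b2.
  have nL : ~ Lder 0 c2 by move=> L; apply: H; exists c2 => //; rewrite e1 e2 y10.
  have [N HN] : exists N, forall l, Lder 0 l -> ~ agree N c2 l.
    apply: contrapT => /forallNP HN; apply: nL; apply: Lder_closed => N.
    have /existsNP[l /not_implyP[Ll /contrapT a]] := HN N; by exists l.
  apply: (out (agree2 N.+1 (p1, p2)) set0); [by apply/nbhs_agree2; exists N.+1|exact: compact0|].
  move=> q [[/= b1 b2] hq]; exfalso; move: hq.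
  apply: (not_hull1 (N := N)); first exact: bq1 b1.
    move=> n k t [l Ll btail'] [/= a1 a2].
    have a1' : agree N y0 (yn n k) by apply: yX_agree => //; rewrite -y10 -e1; exact: agree_trans b1 a1.
    apply: (HN l Ll); apply: agree_trans (_ : agree N c2 (fseq t)) _.
      by apply: cX_agree; rewrite -e2; exact: agree_trans b2 a2.
    by apply: agree_le btail'; exact: yn_y0 a1'.
  move=> m [/= _ a2]; apply: (HN (unit_real m)); first exact/Lder_unit_real.
  by apply: cX_agree; rewrite -e2; exact: agree_trans b2 a2.
have [N [nN HN]] := yn_isolated Y1 ne.
apply: (out (agree2 N.+1 (p1, p2)) ([set p1] `*` range cX)).
- by apply/nbhs_agree2; exists N.+1.
- by apply: compact_setX; [exact: compact_set1|exact: cX_compact].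
move=> [q1 q2] [[/= b1 _] hq]; split=> /=; last first.
  have [[c ->]|[y Yy e]] := X_cases q2; first by exists c.
  exfalso; move: hq; apply: (not_hull1 (N := 0)); first exact: bq1 b1.
    by move=> n k t _ [_ /= /(_ 0 isT)]; rewrite e bitY.
  by move=> m [_ /= /(_ 0 isT)]; rewrite e bitY.
apply: contrapT => q1p1; move: hq.
have [M [_ nM]] := @agree_neq _ (pt q1) (pt p1) (fun e => q1p1 (pt_inj e)).
apply: (not_hull1 (N := maxn N M)); first exact: bq1 b1.
  move=> n k t _ [/= a1 _].
  have a1' : agree N.+1 (pt q1) (pt (yX (yn n k))) by apply: agree_le a1; rewrite ltnS leq_maxl.
  have e : yn n k = y1.
    by apply: HN; apply: yX_agree => //; rewrite -e1; exact: agree_trans b1 a1'.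
  by apply: nM; rewrite e1 -e; apply: a1; rewrite ltnS leq_maxr.
move=> m [/= a1 _]; apply: nN; apply: yX_agree => //; rewrite -e1.
by apply: agree_trans b1 _; apply: agree_le a1; rewrite ltnS leq_maxl.
Qed.

Lemma nonlc_derP s n p : nonlc_der (coded_set s) n p <-> exists2 l, Lder n l & p = (yX y0, cX l).
Proof.
elim: n p => [|n IH] p; first exact: nonlcP.
rewrite /nonlc_der iterS -/(nonlc_der (coded_set s) n) derivedP; split.
  move=> H; have H' N : exists l, [/\ Lder n l, agree2 N p (yX y0, cX l) & (yX y0, cX l) <> p].
    by have [q [/IH[l Ll e] pq ne]] := H N; exists l; rewrite -e.
  have p1 : p.1 = yX y0.
    by apply: pt_inj; apply: agree_all => N; have [l [_ [a _] _]] := H' N.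
  have [[c e2]|[y Yy e2]] := X_cases p.2; last first.
    by have [l [_ [_ /(_ 0 isT) + _]]] := H' 1; rewrite e2 pt_yX.
  have pE : p = (yX y0, cX c) by rewrite -p1 -e2; case: (p).
  exists c => //; apply/Lder_derived => N; have [l [Ll [_ a] ne]] := H' N.+1.
  exists l; split=> //; first by apply: cX_agree; rewrite -e2.
  by move=> e; apply: ne; rewrite e pE.
case=> c /Lder_derived H -> N; have [l [Ll a ne]] := H N.
exists (yX y0, cX l); split; first by apply/IH; exists l.
  by split=> //=; exact: agree_cX.
by case=> /(congr1 btail) e; apply: ne.
Qed.

(** The fillers have first coordinates in the class of [ys] or in the Cantor summand, and every
    [yn n k] differs from [y0]; only the marks remain over [y0]. *)
Lemma coded_set_y0 s l : coded_set s (yX y0, cX l) -> exists2 m, s m & l = unit_real m.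
Proof.
move E: (_, _) => p Ap; case: Ap E => [n k t _|m sm|j|j|t t'] E;
  have /= e1 := congr1 fst E; have /= e2 := congr1 snd E.
- by case: (@yn_ne n k); rewrite -(yX_inj _ _ e1).
- by exists m => //; exact: cX_inj.
- by case: nys; rewrite (yX_inj _ _ e1) //; [exact: left_real_eqfin|exact: left_real_Y].
- by have := congr1 (fun x => pt x 0) e1; rewrite /= pt_yX.
- by have := congr1 (fun x => pt x 0) e1; rewrite /= pt_yX.
Qed.

Lemma marks_coded_set s : marks (coded_set s) = s.
Proof.
apply/seteqP; split=> n.
  case=> a [Aa /nonlc_derP[l Ll e] nd]; subst a.
  have [m sm lE] := coded_set_y0 Aa; rewrite lE in Ll nd.
  have nm : (n <= m)%N by apply/Lder_unit_real.
  suff -> : n = m by [].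
  apply/eqP; rewrite eqn_leq nm leqNgt; apply/negP => lt; apply: nd.
  by apply/nonlc_derP; exists (unit_real m) => //; apply/Lder_unit_real.
move=> sn; exists (yX y0, cX (unit_real n)); split; first exact: C_mark.
  by apply/nonlc_derP; exists (unit_real n) => //; apply/Lder_unit_real.
case/nonlc_derP=> l Ll /(congr1 snd) /= /cX_inj e.
by rewrite -e in Ll; move/Lder_unit_real: Ll; rewrite ltnn.
Qed.

End Construction.

(** * The number of types *)

Section Types.
Variable Y : set real.
Hypothesis gY : tail_lambda Y.
Local Notation XX := (sum_space Y * sum_space Y)%type.

Lemma many_types : exists coded_set : set nat -> set XX, forall s,
  countable_dense (coded_set s) /\ marks (coded_set s) = s.
Proof.
have [Ye lY cY] := gY.
have [y0 Yy0] := Y_nonempty gY.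
have [ys [Yys nys]] : exists ys, Y ys /\ ~ eqfin ys y0.
  apply: contrapT => /forallNP H; apply: cY.
  apply: sub_countable (eqfin_closure_countable (countable1 y0)); apply: subset_card_le => y Yy.
  by exists y0 => //; apply: eqfin_sym; apply: contrapT => ne; apply: (H y).
(* Otherwise [Y] would contain the whole cylinder of reals that leave [y0] exactly at [n], which has
   no isolated point. *)
have /choice[qn qP] : forall n, exists q, [/\ ~ Y q, agree n y0 q & q n <> y0 n].
  move=> n; apply: contrapT => /forallNP H.
  have QY : [set q | agree n y0 q /\ q n <> y0 n] `<=` Y.
    by move=> q [a ne]; apply: contrapT => nq; apply: (H q).
  have [||q [a ne] [m mP]] := lambda_set_no_perfect lY QY.
  - exists (fun i => y0 i (+) (i == n)); split; last by rewrite eqxx addbT; case: (y0 n).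
    by move=> i lin; rewrite ltn_eqF // addbF.
  - move=> z zP; have [q [a ne] zq] := zP n.+1; split; last by rewrite zq.
    by apply: agree_trans a _; apply: agree_sym; exact: agree_le zq.
  - pose q' : real := fun i => q i (+) (i == maxn m n.+1).
    have e : q' = q.
      apply: mP; last by move=> i lin; rewrite /q' ltn_eqF ?addbF // leq_max lin.
      split; last by rewrite /q' ltn_eqF ?addbF // leq_max ltnSn orbT.
      by move=> i lin; rewrite /q' ltn_eqF ?addbF ?a // leq_max ltnS (ltnW lin) orbT.
    move/(congr1 (fun x : real => x (maxn m n.+1))): e; rewrite /q' eqxx addbT.
    by case: (q _).
have /choice[yn2 ynP] : forall nk : nat * nat, exists y, Y y /\ agree (nk.1.+1 + nk.2) (qn nk.1) y.
  by case=> n k; exact: (Y_full_dense gY (qn n) (n.+1 + k)).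
pose yn n k := yn2 (n, k).
have Yyn n k : Y (yn n k) by have [] := ynP (n, k).
have yq n k : agree (n.+1 + k) (qn n) (yn n k) by have [] := ynP (n, k).
have yn_agree n k : agree n y0 (yn n k).
  have [_ a _] := qP n; apply: agree_trans a _; apply: agree_le (yq n k).
  by rewrite addSn leqW // leq_addr.
have yn_ne n k : yn n k n <> y0 n.
  by have [_ _ ne] := qP n; rewrite -(yq n k) // addSn ltnS leq_addr.
have nqn n : ~ Y (qn n) by have [] := qP n.
exists (coded_set y0 ys yn (Y := Y)) => s; split; first split.
- exact: coded_set_countable.
- exact: coded_set_dense.
- exact: (marks_coded_set gY Yy0 Yys nys Yyn yn_agree yn_ne nqn yq).
Qed.

Lemma same_type_refl (Z : topologicalType) (A : set Z) : same_type A A.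
Proof.
exists id; split; last by rewrite image_id.
by split; [move=> x; exact: cvg_id|exists id; split=> // x; exact: cvg_id].
Qed.

Lemma card_types : dense_types XX #= continuum.
Proof.
apply/card_eqPle; split; last first.
  have [A AP] := many_types.
  pose cls (s : nat -> bool) := [set B | countable_dense B /\ same_type (A [set n | s n]) B].
  apply/pcard_leP/injfunPex; exists cls.
    move=> s _; exists (A [set n | s n]) => //; by have [] := AP [set n | s n].
  move=> s s' _ _ e; have [cds ms] := AP [set n | s n]; have [_ ms'] := AP [set n | s' n].
  have : cls s (A [set n | s n]) by split=> //; exact: same_type_refl.
  rewrite e => -[_ /marks_same_type]; rewrite ms ms' => H.
  by apply/funext => n; apply/idP/idP => sn; [have : [set n | s' n] n by rewrite H|
    have : [set n | s n] n by rewrite -H].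
have [y0 Yy0] := Y_nonempty gY.
pose x0 : sum_space Y := mkpt (yXP Yy0).
pose dec (c : real) : sum_space Y := if pselect (sum_set Y c) is left Cc then mkpt Cc else x0.
have decK x : dec (pt x) = x.
  rewrite /dec; case: pselect => [Cc|nC]; first exact: pt_inj.
  by case: nC; exact: ptP.
(* Conversely, a countable dense set is coded by one real, whose sections [n.*2] and [n.*2.+1] are
   the coordinates of the [n]-th point. *)
pose sq (r : real) : set XX := range (fun n => (dec (sec n.*2 r), dec (sec n.*2.+1 r))).
apply: card_le_trans (card_image_le (fun r => [set B | countable_dense B /\ same_type (sq r) B])
  [set: real]).
apply: subset_card_le => _ [A [cA dA] ->].
have [p Ap] : A !=set0.
  have [|p [_ Ap]] := dA setT _ (openT); first by exists (x0, x0).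
  by exists p.
have [a [Aa aP]] := countable_seq Ap cA.
pose r : real := fun i => if (unpickle i : option (nat * nat)) is Some (n, j)
  then (if odd n then pt (a n./2).2 j else pt (a n./2).1 j) else false.
exists r => //.
have e0 n : sec n.*2 r = pt (a n).1.
  by apply/funext => j; rewrite /sec /r pickleK odd_double doubleK.
have e1 n : sec n.*2.+1 r = pt (a n).2.
  by apply/funext => j; rewrite /sec /r pickleK /= odd_double /= uphalf_double.
suff -> : sq r = A by [].
apply/seteqP; split=> [_ [n _ <-]|q /aP[n <-]].
  by rewrite e0 e1 !decK -surjective_pairing; exact: Aa.
by exists n => //; rewrite e0 e1 !decK -surjective_pairing.
Qed.

End Types.

Theorem theorem7 (R : realType) :
  exists X : topologicalType,
    [/\ separable_space X, metrizable R X, has_clopen_base X & CDH X] /\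
    (dense_types (X * X)%type #= continuum) /\
    (MA /\ ~ CH /\ omega1_eq_omega1L -> coanalytic_space X).
Proof.
(* A single space meets both demands because the choice of [Y] depends on whether the hypothesis of
   the second one holds. *)
have [Y gY cY] : exists2 Y, tail_lambda Y & MA /\ ~ CH /\ omega1_eq_omega1L -> sigma11 (~` Y).
  have [[ma [nch w1]]|nh] := pselect (MA /\ ~ CH /\ omega1_eq_omega1L).
    by have [Y [gY aY]] := coanalytic_tail_lambda ma nch w1; exists Y.
  by have [Y gY] := tail_lambda_exists; exists Y.
exists (sum_space Y); split; [split|split].
- exact: sub_separable.
- exact: sub_metrizable.
- exact: sub_clopen_base.
- exact: sum_space_CDH gY.
- exact: card_types gY.
- by move=> /cY; exact: coanalytic_sum_space.
Qed.
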